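(* For every finitely generated family of circuits $(f,g,h)$ there is a quantum relevant term $M$ such that for each list $![!c_1,\dots,!c_n]$ (with $c_i\in\{0,1\}$), $[1,M![!c_1,\dots,!c_n]]\Downarrow[\mathcal{Q},N]$ with $N=[r_1,\dots,r_m]$ if and only if $m=f(n)$ and $\mathcal{Q}=U_{\mathbf{K}_{h(n)}}\big(|r_1\mapsto c_{g(n,1)},\dots,r_{f(n)}\mapsto c_{g(n,f(n))}\rangle\big)$, where by convention $c_0=0$ and $c_{n+1}=1$.
   Context: The Q-calculus. Fix an effective enumeration $(\mathbf{U}_i)$ of all computable unitary operators $\mathbf{U}_i:\mathbb{C}^{2^{n_i}}\to\mathbb{C}^{2^{n_i}}$ (those mapping vectors with polynomial-time computable complex entries to such vectors), with constant symbols $U_i$. Terms: classical variables $x$; quantum variables $r$; patterns $\pi::=x\mid\langle x_1,\dots,x_n\rangle$; constants $0,1,U_i$; terms $M::=x\mid r\mid\ !M\mid C\mid \mathtt{new}(M)\mid (M_1)M_2\mid\langle M_1,\dots,M_n\rangle\ (n\ge2)\mid \lambda!x.M\mid\lambda\pi.M$ modulo $\alpha$-conversion; $\mathrm{Q}(M)$ = quantum variables of $M$. Well-formedness of $\Gamma\vdash M$: axioms $\vdash C$, $r\vdash r$, $x\vdash x$; $\Gamma\vdash M\Rightarrow\Gamma,!x\vdash M$; $\Gamma,!x,!y\vdash M\Rightarrow\Gamma,!z\vdash M\{z/x,z/y\}$; $!\Gamma\vdash M\Rightarrow!\Gamma\vdash!M$; $\Gamma,x\vdash M\Rightarrow\Gamma,!x\vdash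 M$; $\Gamma,x_1,\dots,x_k\vdash M\Rightarrow\Gamma,\langle x_1,\dots,x_k\rangle\vdash M$; $\Gamma_i\vdash M_i\Rightarrow\Gamma_1,\dots,\Gamma_k\vdash\langle M_1,\dots,M_k\rangle$; $\Gamma\vdash M\Rightarrow\Gamma\vdash\mathtt{new}(M)$; $\Gamma,\pi\vdash M\Rightarrow\Gamma\vdash\lambda\pi.M$; $\Gamma,!x\vdash M\Rightarrow\Gamma\vdash\lambda!x.M$; $\Gamma_1\vdash M_1,\Gamma_2\vdash M_2\Rightarrow\Gamma_1,\Gamma_2\vdash(M_1)M_2$. $M$ is well formed if $\mathrm{Q}(M)\vdash M$ is. For finite $V$, $\mathcal{H}(V)$ is the Hilbert space of functions $\{0,1\}^V\to\mathbb{C}$ with basis $|f\rangle$, $f\in\{0,1\}^V$ (written $|r_1\mapsto b_1,\dots\rangle$), and $\mathcal{H}(V)\otimes\mathcal{H}(V')\cong\mathcal{H}(V\cup V')$ for disjoint $V,V'$; $\mathbf{U}_{\langle\langle r_1,\dots,r_n\rangle\rangle}$ acts as $\mathbf{U}$ on qubits $r_1,\dots,r_n$ (in order) and as identity elsewhere. Configurations $[\mathcal{Q},\mathcal{QV},M]$ ($\mathcal{QV}\supseteq\mathrm{Q}(M)$ finite, $\mathcal{Q}\in\mathcal{H}(\mathcal{QV})$) are taken modulo bijective renaming of quantum variables; $[\mathcal{Q},M]$ abbreviates $[\mathcal{Q},\mathrm{Q}(M),M]$, and $1$ denotes the unit vector $1\in\mathcal{H}(\emptyset)\cong\mathbb{C}$.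 Reduction $\to$ on well-formed configurations: $[\mathcal{Q},\mathcal{QV},U\langle r_1,\dots,r_n\rangle]\to[\mathbf{U}_{\langle\langle r_1,\dots,r_n\rangle\rangle}\mathcal{Q},\mathcal{QV},\langle r_1,\dots,r_n\rangle]$; $[\mathcal{Q},\mathcal{QV},\mathtt{new}(c)]\to[\mathcal{Q}\otimes|r\mapsto c\rangle,\mathcal{QV}\cup\{r\},r]$, $c\in\{0,1\}$, $r$ fresh; and with $\mathcal{Q},\mathcal{QV}$ unchanged $(\lambda x.M)N\to M\{N/x\}$, $(\lambda\langle x_1,\dots,x_n\rangle.M)\langle r_1,\dots,r_n\rangle\to M\{r_i/x_i\}_i$, $(\lambda!x.M)!N\to M\{N/x\}$, $L((\lambda\pi.M)N)\to(\lambda\pi.LM)N$, $((\lambda\pi.M)N)L\to(\lambda\pi.ML)N$; closed under tuple components, both sides of application and the body of $\lambda\pi.(\cdot)$ (not inside $!M$). $[\mathcal{Q},M]\Downarrow[\mathcal{Q}',M']$ means $[\mathcal{Q},M]\to^*[\mathcal{Q}',M']$ and $[\mathcal{Q}',M']$ has no reduct. Lists: $[\,]=\lambda!x.\lambda!y.y$ and $[M,M_1,\dots,M_n]=\lambda!x.\lambda!y.(xM)[M_1,\dots,M_n]$. A term $M$ is quantum relevant if it is well formed and for every list $![!c_1,\dots,!c_n]$ with $c_i\in\{0,1\}$ there are a quantum register $\mathcal{Q}$ and $m\in\mathbb{N}$ with $[1,M![!c_1,\dots,!c_n]]\Downarrow[\mathcal{Q},[r_1,\dots,r_m]]$ for some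 quantum variables $r_1,\dots,r_m$. Circuits: for a set $\mathcal{G}$ of qubit gates (unitary $U:\mathbb{C}^{2^k}\to\mathbb{C}^{2^k}$), a $\Lambda$-circuit based on $\mathcal{G}$ ($\Lambda$ a set of quantum variables) is a sequence $U_1,r^1_1,\dots,r^1_{n_1},\dots,U_m,r^m_1,\dots,r^m_{n_m}$ with $U_i\in\mathcal{G}$ an $n_i$-qubit gate and $r^i_1,\dots,r^i_{n_i}$ distinct variables of $\Lambda$; it determines the operator $U_K=(U_m)_{\langle\langle r^m_1,\dots,r^m_{n_m}\rangle\rangle}\circ\dots\circ(U_1)_{\langle\langle r^1_1,\dots,r^1_{n_1}\rangle\rangle}$. $(\mathbf{K}_i)_{i<\omega}$ is a fixed effective enumeration of circuits. A family of circuits generated by $\mathcal{G}$ is a triple $(f,g,h)$ of computable functions $f:\mathbb{N}\to\mathbb{N}$, $g:\mathbb{N}\times\mathbb{N}\to\mathbb{N}$ with $0\le g(n,m)\le n+1$ for $1\le m\le f(n)$, and $h:\mathbb{N}\to\mathbb{N}$ such that each $\mathbf{K}_{h(n)}$ is an $\{r_1,\dots,r_{f(n)}\}$-circuit based on $\mathcal{G}$; it is finitely generated if $\mathcal{G}$ is finite. *)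

(* Defs.v *)
(* The reals are a realType R and the complex numbers are R[i]. *)
From mathcomp Require Import all_boot all_order all_algebra.
From mathcomp Require Import finmap complex classical_sets cardinality reals.
From Stdlib Require List Permutation.

Set Implicit Arguments.
Unset Strict Implicit.
Unset Printing Implicit Defensive.

Import GRing.Theory Num.Theory.

Local Open Scope nat_scope.

(** * Computable functions on the natural numbers *)

(* Kleene's partial recursive functions; a code takes a sequence of arguments
   and missing arguments of a projection read as 0. *)
Inductive rec_code :=
| RZero
| RSucc
| RProj of nat
| RComp of rec_code & seq rec_code
| RRec of rec_code & rec_code
| RMu of rec_code.

Inductive rec_eval : rec_code -> seq nat -> nat -> Prop :=
| rev_zero xs : rec_eval RZero xs 0
| rev_succ x xs : rec_eval RSucc (x :: xs) x.+1
| rev_proj i xs : rec_eval (RProj i) xs (nth 0 xs i)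
| rev_comp e es xs ys z :
    size ys = size es ->
    (forall i, i < size es -> rec_eval (nth RZero es i) xs (nth 0 ys i)) ->
    rec_eval e ys z ->
    rec_eval (RComp e es) xs z
| rev_rec0 e1 e2 xs y :
    rec_eval e1 xs y -> rec_eval (RRec e1 e2) (0 :: xs) y
| rev_recS e1 e2 n xs y z :
    rec_eval (RRec e1 e2) (n :: xs) y ->
    rec_eval e2 [:: n, y & xs] z ->
    rec_eval (RRec e1 e2) (n.+1 :: xs) z
| rev_mu e n xs (w : nat -> nat) :
    rec_eval e (n :: xs) 0 ->
    (forall m, m < n -> rec_eval e (m :: xs) (w m).+1) ->
    rec_eval (RMu e) xs n.

Fixpoint nfun (k : nat) : Type := if k is k'.+1 then nat -> nfun k' else nat.

Fixpoint rec_computes (e : rec_code) (k : nat) (xs : seq nat) :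
    nfun k -> Prop :=
  match k return nfun k -> Prop with
  | 0 => fun v => rec_eval e xs v
  | k'.+1 => fun F => forall n, @rec_computes e k' (rcons xs n) (F n)
  end.

Definition computable (k : nat) (F : nfun k) : Prop :=
  exists e, @rec_computes e k [::] F.

(** * Polynomial-time computable complex numbers *)

(* Most significant bit first. *)
Definition nat_of_bits (bs : seq bool) : nat :=
  foldl (fun a (b : bool) => a.*2 + b) 0 bs.

(* Deterministic one-tape Turing machines over the alphabet {0, 1, blank},
   with None as the blank; a transition that returns None halts. *)
Definition symbol := option bool.

Inductive move := MoveLeft | MoveRight.

Record machine := Machine {
  mstate : finType;
  mstart : mstate;
  mdelta : mstate -> symbol -> option (mstate * symbol * move)
}.

(* State, tape left of the head (nearest cell first), and tape from the
   head on; cells not listed are blank. *)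
Definition mconf (T : machine) : Type :=
  (mstate T * seq symbol * seq symbol)%type.

Definition mstep (T : machine) (c : mconf T) : option (mconf T) :=
  let: (q, l, r) := c in
  match mdelta q (head None r) with
  | None => None
  | Some (q', s, MoveLeft) => Some (q', behead l, head None l :: s :: behead r)
  | Some (q', s, MoveRight) => Some (q', s :: l, behead r)
  end.

Fixpoint mrun (T : machine) (t : nat) (c : mconf T) : mconf T :=
  if t is t'.+1 then
    if mstep c is Some c' then mrun t' c' else c
  else c.

Fixpoint read_bits (r : seq symbol) : seq bool :=
  if r is Some b :: r' then b :: read_bits r' else [::].

(* A sign bit followed by the magnitude. *)
Definition int_of_bits (w : seq bool) : int :=
  if w is s :: m then ((-1) ^+ s * (nat_of_bits m)%:Z)%R else 0%R.

(* On input k in unary, some machine prints within k ^ d + d steps the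
   numerator of a dyadic approximation of x with denominator 2 ^ k and error
   at most 2 ^ - k. *)
Definition ptime_real (R : realType) (x : R) : Prop :=
  exists (T : machine) (d : nat), forall k : nat,
    let c := mrun (k ^ d + d)
               ((mstart T, [::], nseq k (Some true)) : mconf T) in
    mstep c = None /\
    (`|x - (int_of_bits (read_bits c.2))%:~R / 2 ^+ k| <= 2 ^- k)%R.

Definition ptime_complex (R : realType) (z : R[i]) : Prop :=
  ptime_real (complex.Re z) /\ ptime_real (complex.Im z).

(** * Qubit gates and their effective enumerations *)

(* An operator on C^(2^n), together with n. *)
Definition qgate (R : realType) : Type := {n : nat & 'M[R[i]]_(2 ^ n)}.

Definition arity (R : realType) (u : qgate R) : nat := tag u.

Definition gmat (R : realType) (u : qgate R) : 'M[R[i]]_(2 ^ arity u) :=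
  tagged u.

(* No term applies a gate to zero qubits, so arities are positive. *)
Definition qubit_gate (R : realType) (u : qgate R) : Prop :=
  0 < arity u /\ gmat u \is unitarymx.

Definition computable_gate (R : realType) (u : qgate R) : Prop :=
  qubit_gate u /\
  forall v : 'cV[R[i]]_(2 ^ arity u),
    (forall i, ptime_complex (v i ord0)) ->
    forall i, ptime_complex ((gmat u *m v)%R i ord0).

(* The entries x i r c of a sequence of matrices are computable uniformly in
   i, r, c and the precision k; the integer numerators of the dyadic
   approximations are given as differences of natural numbers. *)
Definition uniformly_approximable (R : realType) (dim : nat -> nat)
    (x : forall i, 'I_(dim i) -> 'I_(dim i) -> R) : Prop :=
  exists p n : nat -> nat -> nat -> nat -> nat,
    [/\ computable (k := 4) p, computable (k := 4) n &
      forall i (r c : 'I_(dim i)) k,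
        (`|x i r c - ((p i r c k)%:R - (n i r c k)%:R) / 2 ^+ k|
           <= 2 ^- k)%R].

(* The operators enumerated are exactly the computable unitary ones, and
   arities and entries can be computed from the index. *)
Definition effective_gate_enum (R : realType) (U : nat -> qgate R) : Prop :=
  [/\ forall i, computable_gate (U i),
      forall u, computable_gate u -> exists i, U i = u,
      computable (k := 1) (fun i => arity (U i)),
      uniformly_approximable (dim := fun i => 2 ^ arity (U i))
        (fun i r c => complex.Re (gmat (U i) r c)) &
      uniformly_approximable (dim := fun i => 2 ^ arity (U i))
        (fun i r c => complex.Im (gmat (U i) r c))].

(** * Quantum registers *)

(* The quantum variable r_i is the number i. *)
Notation qvar := nat (only parsing).

Definition asg (V : {fset qvar}) : Type := {ffun V -> bool}.

(* H(V): the coordinates in the basis |f>, f in {0,1}^V. *)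
Definition hilb (R : realType) (V : {fset qvar}) : Type :=
  {ffun {ffun V -> bool} -> R[i]}.

(* Junk value false outside V. *)
Definition qget (V : {fset qvar}) (f : asg V) (r : qvar) : bool :=
  if insub r is Some v then f v else false.

Definition qset (V : {fset qvar}) (f : asg V) (rs : seq qvar) (bs : seq bool) :
    asg V :=
  [ffun v : V => nth (f v) bs (index (val v) rs)].

Definition pullback (V W : {fset qvar}) (s : qvar -> qvar) (f : asg W) :
    asg V :=
  [ffun v : V => qget f (s (val v))].

Definition ket (R : realType) (V : {fset qvar}) (b : qvar -> bool) :
    hilb R V :=
  [ffun f : {ffun V -> bool} => ((f == [ffun v : V => b (val v)])%:R)%R].

Definition unit_reg (R : realType) : hilb R fset0 := [ffun=> 1%R].

(* Q (x) |r |-> c>, for r not in V. *)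
Definition tensor_ket (R : realType) (V : {fset qvar}) (r : qvar) (c : bool)
    (Q : hilb R V) : hilb R (r |` V)%fset :=
  [ffun f : {ffun (r |` V)%fset -> bool} =>
     if qget f r == c then Q (pullback V id f) else 0%R].

Lemma nat_of_bits_lt (n : nat) (b : n.-tuple bool) : nat_of_bits b < 2 ^ n.
Proof.
rewrite -[n in 2 ^ n](size_tuple b) /nat_of_bits.
elim/last_ind: (tval b) => // s x IHs.
rewrite foldl_rcons size_rcons expnS mul2n.
apply: leq_trans (_ : (nat_of_bits s).+1.*2 <= _); last by rewrite leq_double.
by rewrite doubleS; case: x; rewrite ?addn1 ?addn0.
Qed.

(* The position of |b_1 ... b_n> in the standard basis of C^(2^n). *)
Definition bits_ord (n : nat) (b : n.-tuple bool) : 'I_(2 ^ n) :=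
  Ordinal (nat_of_bits_lt b).

(* U_<<r_1, ..., r_n>>, for distinct r_i in V. *)
Definition gate_act (R : realType) (n : nat) (U : 'M[R[i]]_(2 ^ n))
    (rs : n.-tuple qvar) (V : {fset qvar}) (Q : hilb R V) : hilb R V :=
  [ffun f : {ffun V -> bool} =>
     (\sum_(b : n.-tuple bool)
        U (bits_ord (map_tuple (qget f) rs)) (bits_ord b) * Q (qset f rs b))%R].

(** * Circuits *)

Definition gate_app (R : realType) : Type :=
  {u : qgate R & (arity u).-tuple qvar}.

Definition circuit (R : realType) : Type := seq (gate_app R).

Definition circuit_on (R : realType) (G : set (qgate R)) (L : pred qvar)
    (K : circuit R) : Prop :=
  List.Forall (fun a : gate_app R =>
    [/\ G (tag a), uniq (tagged a) & all L (tagged a)]) K.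

Definition circuit_op (R : realType) (K : circuit R) (V : {fset qvar})
    (Q : hilb R V) : hilb R V :=
  foldl (fun Q' (a : gate_app R) => gate_act (gmat (tag a)) (tagged a) Q') Q K.

(* The circuits enumerated are exactly those built from the gates U_i, and
   from an index one can compute the number of gates of the circuit, the name
   of each gate and the variables to which it is applied. *)
Definition effective_circuit_enum (R : realType) (U : nat -> qgate R)
    (K : nat -> circuit R) : Prop :=
  [/\ forall i, circuit_on (range U) predT (K i),
      forall K', circuit_on (range U) predT K' -> exists i, K i = K' &
      exists (len : nat -> nat) (gate : nat -> nat -> nat)
             (wire : nat -> nat -> nat -> nat),
        [/\ computable (k := 1) len, computable (k := 2) gate,
            computable (k := 3) wire &
          forall i, K i =
            mkseq (fun j => Tagged (fun u : qgate R => (arity u).-tuple qvar)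
                     [tuple wire i j l | l < arity (U (gate i j))])
                  (len i)]].

Definition circuit_family (R : realType) (K : nat -> circuit R)
    (G : set (qgate R)) (f : nat -> nat) (g : nat -> nat -> nat)
    (h : nat -> nat) : Prop :=
  [/\ computable (k := 1) f, computable (k := 2) g, computable (k := 1) h,
      forall n m, 1 <= m <= f n -> g n m <= n.+1 &
      forall n, circuit_on G (fun r => 1 <= r <= f n) (K (h n))].

Definition finitely_generated_family (R : realType) (K : nat -> circuit R)
    (f : nat -> nat) (g : nat -> nat -> nat) (h : nat -> nat) : Prop :=
  exists G : set (qgate R),
    [/\ finite_set G, forall u, G u -> qubit_gate u &
        circuit_family K G f g h].

(** * Terms *)

(* PTup n is <x_1, ..., x_n>; well-formedness requires 2 <= n. *)
Inductive pattern := PVar | PTup of nat.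

Definition pat_arity (p : pattern) : nat := if p is PTup n then n else 1.

(* Classical variables are de Bruijn indices: under a binder for
   <x_1, ..., x_n>, the index of x_i is i - 1.  Tup requires at least two
   components, again through well-formedness. *)
Inductive term :=
| Var of nat
| QVar of qvar
| Bang of term
| Bit of bool
| Gate of nat
| New of term
| App of term & term
| Tup of seq term
| LamB of term
| Lam of pattern & term.

Fixpoint qvars (M : term) : seq qvar :=
  match M with
  | QVar r => [:: r]
  | Bang M | New M | LamB M | Lam _ M => qvars M
  | App M N => qvars M ++ qvars N
  | Tup Ms => flatten (map qvars Ms)
  | Var _ | Bit _ | Gate _ => [::]
  end.

Definition qfv (M : term) : {fset qvar} := [fset r in qvars M]%fset.

Fixpoint rename_qvars (s : qvar -> qvar) (M : term) : term :=
  match M with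
  | QVar r => QVar (s r)
  | Var x => Var x
  | Bit c => Bit c
  | Gate i => Gate i
  | Bang M => Bang (rename_qvars s M)
  | New M => New (rename_qvars s M)
  | App M N => App (rename_qvars s M) (rename_qvars s N)
  | Tup Ms => Tup (map (rename_qvars s) Ms)
  | LamB M => LamB (rename_qvars s M)
  | Lam p M => Lam p (rename_qvars s M)
  end.

Definition up_ren (k : nat) (s : nat -> nat) (i : nat) : nat :=
  if i < k then i else k + s (i - k).

Fixpoint rename (s : nat -> nat) (M : term) : term :=
  match M with
  | Var x => Var (s x)
  | QVar r => QVar r
  | Bit c => Bit c
  | Gate i => Gate i
  | Bang M => Bang (rename s M)
  | New M => New (rename s M)
  | App M N => App (rename s M) (rename s N)
  | Tup Ms => Tup (map (rename s) Ms)
  | LamB M => LamB (rename (up_ren 1 s) M)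
  | Lam p M => Lam p (rename (up_ren (pat_arity p) s) M)
  end.

Definition lift (k : nat) : term -> term := rename (addn k).

Definition up_sub (k : nat) (s : nat -> term) (i : nat) : term :=
  if i < k then Var i else lift k (s (i - k)).

Fixpoint subst (s : nat -> term) (M : term) : term :=
  match M with
  | Var x => s x
  | QVar r => QVar r
  | Bit c => Bit c
  | Gate i => Gate i
  | Bang M => Bang (subst s M)
  | New M => New (subst s M)
  | App M N => App (subst s M) (subst s N)
  | Tup Ms => Tup (map (subst s) Ms)
  | LamB M => LamB (subst (up_sub 1 s) M)
  | Lam p M => Lam p (subst (up_sub (pat_arity p) s) M)
  end.

(* Replaces the indices 0, ..., size Ns - 1 by Ns and unbinds them. *)
Definition inst (Ns : seq term) (M : term) : term :=
  subst (fun i => nth (Var (i - size Ns)) Ns i) M.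

(** * Well-formed judgements *)

(* Environment entries: r, x, !x and <x_1, ..., x_n>.  The names of the
   classical variables are the de Bruijn indices of the term. *)
Inductive entry :=
| EQVar of qvar
| ELin of nat
| EBang of nat
| ETup of seq nat.

Definition env : Type := seq entry.

Definition entry_vars (e : entry) : seq nat :=
  match e with
  | EQVar _ => [::] | ELin x | EBang x => [:: x] | ETup xs => xs
  end.

Definition entry_qvars (e : entry) : seq qvar :=
  if e is EQVar r then [:: r] else [::].

Definition env_vars (G : env) : seq nat := flatten (map entry_vars G).

Definition env_qvars (G : env) : seq qvar := flatten (map entry_qvars G).

(* No variable is declared twice. *)
Definition env_ok (G : env) : bool :=
  uniq (env_vars G) && uniq (env_qvars G).

Definition is_bang (e : entry) : bool := if e is EBang _ then true else false.

Definition shift_entry (k : nat) (e : entry) : entry :=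
  match e with
  | EQVar r => EQVar r
  | ELin x => ELin (k + x)
  | EBang x => EBang (k + x)
  | ETup xs => ETup (map (addn k) xs)
  end.

Definition shift_env (k : nat) (G : env) : env := map (shift_entry k) G.

Definition pat_entry (p : pattern) : entry :=
  if p is PTup n then ETup (iota 0 n) else ELin 0.

Definition merge_vars (x y z i : nat) : nat :=
  if (i == x) || (i == y) then z else i.

Inductive wf : env -> term -> Prop :=
| wf_exch G G' M : Permutation.Permutation G G' -> wf G M -> wf G' M
| wf_bit c : wf [::] (Bit c)
| wf_gate i : wf [::] (Gate i)
| wf_qvar r : wf [:: EQVar r] (QVar r)
| wf_var x : wf [:: ELin x] (Var x)
| wf_weak G x M :
    x \notin env_vars G -> wf G M -> wf (EBang x :: G) M
| wf_contr G x y z M :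
    z \notin env_vars G -> wf (EBang x :: EBang y :: G) M ->
    wf (EBang z :: G) (rename (merge_vars x y z) M)
| wf_prom G M : all is_bang G -> wf G M -> wf G (Bang M)
| wf_der G x M : wf (ELin x :: G) M -> wf (EBang x :: G) M
| wf_pat G xs M :
    1 < size xs -> wf (map ELin xs ++ G) M -> wf (ETup xs :: G) M
| wf_tup (Gs : seq env) Ms :
    1 < size Ms -> size Gs = size Ms -> env_ok (flatten Gs) ->
    (forall i, i < size Ms -> wf (nth [::] Gs i) (nth (Var 0) Ms i)) ->
    wf (flatten Gs) (Tup Ms)
| wf_new G M : wf G M -> wf G (New M)
| wf_lam G p M :
    wf (pat_entry p :: shift_env (pat_arity p) G) M -> wf G (Lam p M)
| wf_lamB G M : wf (EBang 0 :: shift_env 1 G) M -> wf G (LamB M)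
| wf_app G1 G2 M N :
    env_ok (G1 ++ G2) -> wf G1 M -> wf G2 N -> wf (G1 ++ G2) (App M N).

Definition wf_term (M : term) : Prop := wf (map EQVar (qfv M)) M.

(** * Configurations and reduction *)

Record config (R : realType) := Config {
  cqv : {fset qvar};
  creg : hilb R cqv;
  ctm : term
}.

Definition wf_config (R : realType) (C : config R) : Prop :=
  (qfv (ctm C) `<=` cqv C)%fset /\ wf_term (ctm C).

(* [Q, M] *)
Definition conf (R : realType) (M : term) (Q : hilb R (qfv M)) : config R :=
  Config Q M.

(* Equality of configurations up to bijective renaming of quantum variables. *)
Definition config_equiv (R : realType) (C D : config R) : Prop :=
  exists s : qvar -> qvar,
    [/\ bijective s, cqv D = (s @` cqv C)%fset, ctm D = rename_qvars s (ctm C) &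
        forall f : asg (cqv D), creg D f = creg C (pullback (cqv C) s f)].

(* <r_1, ..., r_n> as the argument of an n-ary gate; there being no
   one-component tuples, it stands for r_1 when n = 1. *)
Definition qtuple (rs : seq qvar) : term :=
  if rs is [:: r] then QVar r else Tup (map QVar rs).

Inductive step (R : realType) (U : nat -> qgate R) :
    config R -> config R -> Prop :=
| step_gate V (Q : hilb R V) i (rs : (arity (U i)).-tuple qvar) :
    step U (Config Q (App (Gate i) (qtuple rs)))
           (Config (gate_act (gmat (U i)) rs Q) (qtuple rs))
| step_new V (Q : hilb R V) c r :
    r \notin V ->
    step U (Config Q (New (Bit c))) (Config (tensor_ket r c Q) (QVar r))
| step_lin V (Q : hilb R V) M N :
    step U (Config Q (App (Lam PVar M) N)) (Config Q (inst [:: N] M))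
| step_tup V (Q : hilb R V) M (rs : seq qvar) :
    step U (Config Q (App (Lam (PTup (size rs)) M) (Tup (map QVar rs))))
           (Config Q (inst (map QVar rs) M))
| step_bang V (Q : hilb R V) M N :
    step U (Config Q (App (LamB M) (Bang N))) (Config Q (inst [:: N] M))
| step_comm_l V (Q : hilb R V) L p M N :
    step U (Config Q (App L (App (Lam p M) N)))
           (Config Q (App (Lam p (App (lift (pat_arity p) L) M)) N))
| step_comm_r V (Q : hilb R V) L p M N :
    step U (Config Q (App (App (Lam p M) N) L))
           (Config Q (App (Lam p (App M (lift (pat_arity p) L))) N))
| step_in_tup V V' (Q : hilb R V) (Q' : hilb R V') M M' Ms1 Ms2 :
    step U (Config Q M) (Config Q' M') ->
    step U (Config Q (Tup (Ms1 ++ M :: Ms2)))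
           (Config Q' (Tup (Ms1 ++ M' :: Ms2)))
| step_in_appl V V' (Q : hilb R V) (Q' : hilb R V') M M' N :
    step U (Config Q M) (Config Q' M') ->
    step U (Config Q (App M N)) (Config Q' (App M' N))
| step_in_appr V V' (Q : hilb R V) (Q' : hilb R V') M M' N :
    step U (Config Q M) (Config Q' M') ->
    step U (Config Q (App N M)) (Config Q' (App N M'))
| step_in_lam V V' (Q : hilb R V) (Q' : hilb R V') p M M' :
    step U (Config Q M) (Config Q' M') ->
    step U (Config Q (Lam p M)) (Config Q' (Lam p M')).

(* Reduction of well-formed configurations, up to renaming. *)
Definition red (R : realType) (U : nat -> qgate R) (C D : config R) : Prop :=
  exists C' D' : config R,
    [/\ wf_config C', wf_config D', config_equiv C C', step U C' D' &
        config_equiv D' D].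

Inductive reds (R : realType) (U : nat -> qgate R) :
    config R -> config R -> Prop :=
| reds_refl C D : config_equiv C D -> reds U C D
| reds_step C D E : red U C D -> reds U D E -> reds U C E.

Definition evaluates (R : realType) (U : nat -> qgate R) (C D : config R) :
    Prop :=
  reds U C D /\ ~ exists E, red U D E.

(** * Lists and quantum relevant terms *)

Fixpoint tlist (Ms : seq term) : term :=
  if Ms is M :: Ms' then
    LamB (LamB (App (App (Var 1) (lift 2 M)) (lift 2 (tlist Ms'))))
  else LamB (LamB (Var 0)).

(* ![!c_1, ..., !c_n] *)
Definition bit_list (cs : seq bool) : term :=
  Bang (tlist [seq Bang (Bit c) | c <- cs]).

(* [r_1, ..., r_m] *)
Definition qvar_list (rs : seq qvar) : term := tlist (map QVar rs).

(* [1, M ![!c_1, ..., !c_n]].  As the register lives in H(emptyset), this is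
   well formed only if M has no quantum variables. *)
Definition init_conf (R : realType) (M : term) (cs : seq bool) : config R :=
  Config (unit_reg R) (App M (bit_list cs)).

Definition quantum_relevant (R : realType) (U : nat -> qgate R) (M : term) :
    Prop :=
  wf_term M /\
  forall cs : seq bool,
    exists (m : nat) (rs : m.-tuple qvar) (Q : hilb R (qfv (qvar_list rs))),
      evaluates U (init_conf R M cs) (conf Q).

(* c_j, where c_0 = 0 and c_(n+1) = 1. *)
Definition ext_bit (cs : seq bool) (j : nat) : bool := nth true (false :: cs) j.

(* Main.v *)
(* Uniqueness: a pending linear argument may be substituted under a lambda-! or
   a new, where reduction is forbidden, and new chooses arbitrary names.  Once
   registers are read as functions of total bit assignments and reduction is also
   allowed under lambda-! and new, every step commutes, up to renaming of qubits,
   with each step that avoids the commutative rules and passes only values to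
   linear abstractions.  Hence a terminating path of the latter steps determines
   all normal forms.

   Existence: the lambda-! fragment is an ordinary call-by-name calculus in which
   the computable functions f, g, h and the circuit enumeration are programmed
   on Scott numerals.  The qubits are kept in a linear list; the gate names that a
   program computes are turned into gates by a finite table.  The table is
   available because finitely many gates U_j are told apart by finitely many
   dyadic approximations of their entries, so a class of each name j is
   computable even though equality of gates need not be. *)

Require Import Defs.
From mathcomp Require Import all_boot all_order all_algebra.
From mathcomp Require Import finmap complex classical_sets cardinality reals.
From Stdlib Require Import FunctionalExtensionality.
From mathcomp Require Import zify lra boolp.
Import Defs.

Set Implicit Arguments.
Unset Strict Implicit.
Unset Printing Implicit Defensive.

Import Order.TTheory GRing.Theory Num.Theory.

Local Open Scope nat_scope.

(** * Terms and substitution *)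

(** Uniqueness hinges on one overlap: at [App (Lam PVar M) (App (Lam p P) N)] linear beta moves the
    inner redex into [M], a commutative rule moves it outwards, and the results need not meet in one
    step. Contracting linear redexes only on values keeps this overlap off the distinguished path;
    every other critical pair closes with at most one step on each side. Reduction is defined on
    well-formed configurations only, and derivations with contraction are awkward to carry along a
    step. They are replaced by a count of occurrences, [lin], which reduction preserves and from
    which a derivation is rebuilt for closed terms with distinct qubits. The programs are shaped by
    boxes. The branches of a case distinction are contents of a [Bang], so they capture neither
    qubits nor linear variables; linear data are handed to the selected branch as further arguments.
    As a qubit can be neither copied nor dropped, a gate is applied by moving its qubits to the
    front of the list and back again. *)

Lemma term_nested_ind (P : term -> Prop) :
  (forall x, P (Var x)) -> (forall r, P (QVar r)) ->
  (forall M, P M -> P (Bang M)) -> (forall c, P (Bit c)) ->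
  (forall i, P (Gate i)) -> (forall M, P M -> P (New M)) ->
  (forall M N, P M -> P N -> P (App M N)) ->
  (forall Ms, List.Forall P Ms -> P (Tup Ms)) ->
  (forall M, P M -> P (LamB M)) -> (forall p M, P M -> P (Lam p M)) ->
  forall M, P M.
Proof.
move=> hV hQ hB hb hG hN hA hT hL hp; fix IH 1 => -[x|r|M|c|i|M|M N|Ms|M|p M].
- exact: hV.
- exact: hQ.
- exact/hB/IH.
- exact: hb.
- exact: hG.
- exact/hN/IH.
- by apply: hA; apply: IH.
- by apply: hT; elim: Ms => [|M Ms IHs]; constructor.
- exact/hL/IH.
- exact/hp/IH.
Qed.

Lemma map_ext_Forall (A B : Type) (f g : A -> B) (s : seq A) :
  List.Forall (fun x => f x = g x) s -> map f s = map g s.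
Proof. by elim=> //= x {}s -> _ ->. Qed.

Lemma up_sub_lt k s i : i < k -> up_sub k s i = Var i.
Proof. by rewrite /up_sub => ->. Qed.

Lemma up_sub_ge k s i : k <= i -> up_sub k s i = lift k (s (i - k)).
Proof. by rewrite /up_sub ltnNge => ->. Qed.

Lemma up_ren_sub k (s : nat -> nat) : up_sub k (Var \o s) = Var \o up_ren k s.
Proof. by apply: functional_extensionality => i; rewrite /up_sub /up_ren /=; case: ifP. Qed.

Lemma rename_subst s M : rename s M = subst (Var \o s) M.
Proof.
elim/term_nested_ind: M s => //=; try by move=> *; congr _.
- by move=> M IH s; rewrite IH.
- by move=> M IH s; rewrite IH.
- by move=> M N IHM IHN s; rewrite IHM IHN.
- by move=> Ms IH s; congr Tup; apply: map_ext_Forall; apply: List.Forall_impl IH.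
- by move=> M IH s; rewrite IH up_ren_sub.
- by move=> p M IH s; rewrite IH up_ren_sub.
Qed.

Lemma up_sub_comp_ren k (s : nat -> term) (t : nat -> nat) :
  up_sub k s \o up_ren k t = up_sub k (s \o t).
Proof.
apply: functional_extensionality => i; rewrite /= /up_ren.
case: (ltnP i k) => h; first by rewrite !up_sub_lt.
by rewrite !up_sub_ge ?leq_addr //= addKn.
Qed.

Lemma subst_rename s t M : subst s (rename t M) = subst (s \o t) M.
Proof.
elim/term_nested_ind: M s t => //=.
- by move=> M IH s t; rewrite IH.
- by move=> M IH s t; rewrite IH.
- by move=> M N IHM IHN s t; rewrite IHM IHN.
- move=> Ms IH s t; congr Tup; rewrite -map_comp; apply: map_ext_Forall.
  by apply: List.Forall_impl IH => M /=.
- by move=> M IH s t; rewrite IH up_sub_comp_ren.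
- by move=> p M IH s t; rewrite IH up_sub_comp_ren.
Qed.

Lemma rename_rename s t M : rename s (rename t M) = rename (s \o t) M.
Proof. by rewrite [LHS]rename_subst subst_rename rename_subst. Qed.

Lemma up_ren_comp_sub k (s : nat -> nat) (t : nat -> term) :
  rename (up_ren k s) \o up_sub k t = up_sub k (rename s \o t).
Proof.
apply: functional_extensionality => i /=.
case: (ltnP i k) => h; first by rewrite !up_sub_lt //= /up_ren h.
rewrite !up_sub_ge //= /lift !rename_rename; congr rename.
by apply: functional_extensionality => j /=; rewrite /up_ren ltnNge leq_addr /= addKn.
Qed.

Lemma rename_of_subst s t M : rename s (subst t M) = subst (rename s \o t) M.
Proof.
elim/term_nested_ind: M s t => //=.
- by move=> M IH s t; rewrite IH.
- by move=> M IH s t; rewrite IH.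
- by move=> M N IHM IHN s t; rewrite IHM IHN.
- move=> Ms IH s t; congr Tup; rewrite -map_comp; apply: map_ext_Forall.
  by apply: List.Forall_impl IH => M /=.
- by move=> M IH s t; rewrite IH up_ren_comp_sub.
- by move=> p M IH s t; rewrite IH up_ren_comp_sub.
Qed.

Lemma up_sub_comp k (s t : nat -> term) :
  subst (up_sub k s) \o up_sub k t = up_sub k (subst s \o t).
Proof.
apply: functional_extensionality => i /=.
case: (ltnP i k) => h; first by rewrite !up_sub_lt //= up_sub_lt.
rewrite !up_sub_ge //= /lift subst_rename rename_of_subst; congr subst.
by apply: functional_extensionality => j /=; rewrite up_sub_ge ?leq_addr // addKn.
Qed.

Lemma subst_subst s t M : subst s (subst t M) = subst (subst s \o t) M.
Proof.
elim/term_nested_ind: M s t => //=.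
- by move=> M IH s t; rewrite IH.
- by move=> M IH s t; rewrite IH.
- by move=> M N IHM IHN s t; rewrite IHM IHN.
- move=> Ms IH s t; congr Tup; rewrite -map_comp; apply: map_ext_Forall.
  by apply: List.Forall_impl IH => M /=.
- by move=> M IH s t; rewrite IH up_sub_comp.
- by move=> p M IH s t; rewrite IH up_sub_comp.
Qed.

Lemma up_sub_Var k : up_sub k Var = Var.
Proof.
apply: functional_extensionality => i.
case: (ltnP i k) => h; first by rewrite up_sub_lt.
by rewrite up_sub_ge // /lift /= subnKC.
Qed.

Lemma subst_Var M : subst Var M = M.
Proof.
elim/term_nested_ind: M => //=.
- by move=> M ->.
- by move=> M ->.
- by move=> M N -> ->.
- by move=> Ms IH; congr Tup; elim: IH => //= M {}Ms -> _ ->.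
- by move=> M IH; rewrite up_sub_Var IH.
- by move=> p M IH; rewrite up_sub_Var IH.
Qed.

Lemma up_sub_lift k s L : subst (up_sub k s) (lift k L) = lift k (subst s L).
Proof.
rewrite /lift subst_rename rename_of_subst; congr subst.
by apply: functional_extensionality => j /=; rewrite up_sub_ge ?leq_addr // addKn.
Qed.

Definition inst_sub (Ns : seq term) (i : nat) : term :=
  nth (Var (i - size Ns)) Ns i.

Lemma instE Ns M : inst Ns M = subst (inst_sub Ns) M.
Proof. by []. Qed.

Lemma inst_lift Ns L : inst Ns (lift (size Ns) L) = L.
Proof.
rewrite instE /lift subst_rename -[RHS]subst_Var; congr subst.
apply: functional_extensionality => j /=.
by rewrite /inst_sub nth_default ?leq_addr // addKn.
Qed.

Lemma subst_inst s Ns M :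
  subst s (inst Ns M) = inst (map (subst s) Ns) (subst (up_sub (size Ns) s) M).
Proof.
rewrite !instE !subst_subst; congr subst.
apply: functional_extensionality => i /=.
case: (ltnP i (size Ns)) => h.
  by rewrite up_sub_lt //= /inst_sub (nth_map (Var (i - size Ns))) ?size_map.
rewrite up_sub_ge // /inst_sub nth_default //=.
by rewrite -instE -[X in lift X _](size_map (subst s)) inst_lift.
Qed.

(** * Occurrences of variables *)

Definition unbind (k : nat) (s : seq nat) : seq nat := [seq x - k | x <- s & k <= x].

(* Free occurrences of classical variables outside (lfv) and inside (bfv) the
   scope of a !. *)
Fixpoint lfv (M : term) : seq nat :=
  match M with
  | Var x => [:: x]
  | Bang _ | QVar _ | Bit _ | Gate _ => [::]
  | New M => lfv M
  | App M N => lfv M ++ lfv N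
  | Tup Ms => flatten (map lfv Ms)
  | LamB M => unbind 1 (lfv M)
  | Lam p M => unbind (pat_arity p) (lfv M)
  end.

Fixpoint bfv (M : term) : seq nat :=
  match M with
  | Var _ | QVar _ | Bit _ | Gate _ => [::]
  | Bang M => lfv M ++ bfv M
  | New M => bfv M
  | App M N => bfv M ++ bfv N
  | Tup Ms => flatten (map bfv Ms)
  | LamB M => unbind 1 (bfv M)
  | Lam p M => unbind (pat_arity p) (bfv M)
  end.

Definition fv (M : term) : seq nat := lfv M ++ bfv M.

Lemma mem_unbind k s x : (x \in unbind k s) = (k + x \in s).
Proof.
apply/mapP/idP => [[y]|h].
  by rewrite mem_filter => /andP[ky ys ->]; rewrite subnKC.
by exists (k + x); rewrite ?mem_filter ?leq_addr ?addKn.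
Qed.

Lemma count_unbind k s x : count_mem x (unbind k s) = count_mem (k + x) s.
Proof.
rewrite /unbind count_map count_filter; apply: eq_count => y /=.
by apply/andP/eqP => [[/eqP <- ky]|->]; rewrite ?subnKC // leq_addr addKn.
Qed.

Lemma unbind_cat k s t : unbind k (s ++ t) = unbind k s ++ unbind k t.
Proof. by rewrite /unbind filter_cat map_cat. Qed.

(** An occurrence in a box does not count as linear, because the box may be copied or erased by a
    later step. *)
Definition linocc (i : nat) (M : term) : bool :=
  (count_mem i (lfv M) == 1) && (i \notin bfv M).

Definition pat_ok (p : pattern) : bool := if p is PTup n then 1 < n else true.

(** Stands in for [wf]: occurrences are counted instead of splitting environments. A box must be
    free of qubits, since copying it would clone them. The variable of a [LamB] may occur any number
    of times, so nothing is asked of it. *)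
Fixpoint lin (M : term) : bool :=
  match M with
  | Var _ | QVar _ | Bit _ | Gate _ => true
  | Bang M => lin M && nilp (qvars M)
  | New M | LamB M => lin M
  | App M N => lin M && lin N
  | Tup Ms => (1 < size Ms) && all lin Ms
  | Lam p M => [&& lin M, pat_ok p & all (linocc ^~ M) (iota 0 (pat_arity p))]
  end.

Lemma subst_ext_fv s t M : {in fv M, s =1 t} -> subst s M = subst t M.
Proof.
have upP k (u v : nat -> term) (A : term) :
    {in [predU unbind k (lfv A) & unbind k (bfv A)], u =1 v} ->
    {in fv A, up_sub k u =1 up_sub k v}.
  move=> h i; rewrite mem_cat => hi; case: (ltnP i k) => ik; first by rewrite !up_sub_lt.
  by rewrite !up_sub_ge // h // !inE !mem_unbind subnKC.
elim/term_nested_ind: M s t => //=.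
- by move=> x s t ->; rewrite // /fv inE.
- by move=> M IH s t h; rewrite (IH s t) // => i hi; apply: h; rewrite /fv /= mem_cat hi ?orbT.
- by move=> M IH s t h; rewrite (IH s t).
- move=> M N IHM IHN s t h; rewrite (IHM s t) 1?(IHN s t) // => i hi; apply: h;
    by rewrite /fv /= !mem_cat; move: hi; rewrite mem_cat => /orP[] ->; rewrite ?orbT.
- move=> Ms IH s t h; congr Tup; rewrite /fv /= in h; elim: IH h => //= M {}Ms IHM _ IHs h.
  rewrite (IHM s t) 1?IHs // => i hi; apply: h;
    by move: hi; rewrite /fv !mem_cat => /orP[] ->; rewrite ?orbT.
- by move=> M IH s t h; congr LamB; apply: IH; apply: upP => i hi; apply: h; rewrite /fv mem_cat.
- by move=> p M IH s t h; congr Lam; apply: IH; apply: upP => i hi; apply: h; rewrite /fv mem_cat.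
Qed.

Lemma subst_closed s M : fv M = [::] -> subst s M = M.
Proof.
by move=> h; rewrite -[RHS]subst_Var; apply: subst_ext_fv => i; rewrite h.
Qed.

Lemma rename_closed s M : fv M = [::] -> rename s M = M.
Proof. by move=> h; rewrite rename_subst subst_closed. Qed.

Lemma lift_closed k M : fv M = [::] -> lift k M = M.
Proof. exact: rename_closed. Qed.

Lemma unbind_map_ren k s (l : seq nat) :
  unbind k (map (up_ren k s) l) = map s (unbind k l).
Proof.
elim: l => //= i l IH; rewrite /unbind /=.
have -> : (k <= up_ren k s i) = (k <= i) by rewrite /up_ren; case: (ltnP i k) => h; rewrite ?leq_addr ?h // leqNgt h.
case: (leqP k i) => ki /=; rewrite -!/(unbind _ _) IH //.
by rewrite /up_ren ltnNge ki addKn.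
Qed.

Lemma lfv_rename s M : lfv (rename s M) = map s (lfv M).
Proof.
elim/term_nested_ind: M s => //=.
- by move=> M N IHM IHN s; rewrite map_cat IHM IHN.
- by move=> Ms IH s; elim: IH => //= M {}Ms -> _ ->; rewrite map_cat.
- by move=> M IH s; rewrite IH unbind_map_ren.
- by move=> p M IH s; rewrite IH unbind_map_ren.
Qed.

Lemma bfv_rename s M : bfv (rename s M) = map s (bfv M).
Proof.
elim/term_nested_ind: M s => //=.
- by move=> M IH s; rewrite map_cat IH lfv_rename.
- by move=> M N IHM IHN s; rewrite map_cat IHM IHN.
- by move=> Ms IH s; elim: IH => //= M {}Ms -> _ ->; rewrite map_cat.
- by move=> M IH s; rewrite IH unbind_map_ren.
- by move=> p M IH s; rewrite IH unbind_map_ren.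
Qed.

Lemma fv_rename s M : fv (rename s M) = map s (fv M).
Proof. by rewrite /fv lfv_rename bfv_rename map_cat. Qed.

Lemma qvars_rename s M : qvars (rename s M) = qvars M.
Proof.
elim/term_nested_ind: M s => //=.
- by move=> M N IHM IHN s; rewrite IHM IHN.
- by move=> Ms IH s; elim: IH => //= M {}Ms -> _ ->.
Qed.

Lemma linocc_up_ren k s i M : i < k -> linocc i (rename (up_ren k s) M) = linocc i M.
Proof.
move=> ik; rewrite /linocc lfv_rename bfv_rename count_map.
have e j : (up_ren k s j == i) = (j == i).
  by rewrite /up_ren; case: ltnP => jk //; apply/eqP/eqP; lia.
congr ((_ == _) && ~~ _); first by apply: eq_count => j /=; rewrite e.
by apply/mapP/idP => [[j jM /eqP]|h]; [rewrite eq_sym e => /eqP <- | exists i; rewrite // /up_ren ik].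
Qed.

Lemma lin_rename s M : lin (rename s M) = lin M.
Proof.
elim/term_nested_ind: M s => //=.
- by move=> M IH s; rewrite IH qvars_rename.
- by move=> M N IHM IHN s; rewrite IHM IHN.
- by move=> Ms IH s; rewrite size_map; congr andb; elim: IH => //= M {}Ms -> _ ->.
- move=> p M IH s; rewrite IH; congr [&& _, _ & _]; apply: eq_in_all => i.
  by rewrite mem_iota add0n => /andP[_ /linocc_up_ren ->].
Qed.

Lemma unbind_flatten_up k s (l : seq nat) :
  unbind k (flatten [seq lfv (up_sub k s i) | i <- l]) =
  flatten [seq lfv (s i) | i <- unbind k l].
Proof.
elim: l => //= i l IH; rewrite unbind_cat IH /unbind /=; case: (ltnP i k) => ik.
  by rewrite up_sub_lt //= leqNgt ik.
rewrite up_sub_ge //= lfv_rename; congr (_ ++ _).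
by elim: (lfv _) => //= j m IHm; rewrite leq_addr /= addKn IHm.
Qed.

Lemma lfv_subst s M : lfv (subst s M) = flatten [seq lfv (s i) | i <- lfv M].
Proof.
elim/term_nested_ind: M s => //=.
- by move=> x s; rewrite cats0.
- by move=> M N IHM IHN s; rewrite IHM IHN map_cat flatten_cat.
- by move=> Ms IH s; elim: IH => //= M {}Ms -> _ ->; rewrite map_cat flatten_cat.
- by move=> M IH s; rewrite IH unbind_flatten_up.
- by move=> p M IH s; rewrite IH unbind_flatten_up.
Qed.

Lemma fv_subst_up k s x i : k + x \in fv (up_sub k s i) -> k <= i /\ x \in fv (s (i - k)).
Proof.
case: (ltnP i k) => ik; first by rewrite up_sub_lt // inE => /eqP e; lia.
rewrite up_sub_ge // fv_rename => /mapP[y ys e]; split=> //.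
by have -> : x = y by lia.
Qed.

Lemma bfv_subst_up k s x i : k + x \in bfv (up_sub k s i) -> k <= i /\ x \in bfv (s (i - k)).
Proof.
case: (ltnP i k) => ik; first by rewrite up_sub_lt.
rewrite up_sub_ge // bfv_rename => /mapP[y ys e]; split=> //.
by have -> : x = y by lia.
Qed.

Lemma bfv_subst s M x : x \in bfv (subst s M) ->
  (exists2 i, i \in lfv M & x \in bfv (s i)) \/ (exists2 i, i \in bfv M & x \in fv (s i)).
Proof.
have up k s' (A : term) y :
    (exists2 i, i \in lfv A & k + y \in bfv (up_sub k s' i)) \/
    (exists2 i, i \in bfv A & k + y \in fv (up_sub k s' i)) ->
    (exists2 i, i \in unbind k (lfv A) & y \in bfv (s' i)) \/
    (exists2 i, i \in unbind k (bfv A) & y \in fv (s' i)).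
  by case=> -[i iA]; [move/bfv_subst_up|move/fv_subst_up] => -[ki ys]; [left|right];
    exists (i - k); rewrite ?mem_unbind ?subnKC.
elim/term_nested_ind: M s x => //=.
- by move=> x s y h; left; exists x; rewrite ?inE.
- move=> M IH s x; rewrite mem_cat lfv_subst => /orP[/flatten_mapP[i iM xi]|/IH[] [i iM xi]]; right;
    exists i; rewrite ?mem_cat ?iM ?orbT //; move: xi; rewrite /fv ?mem_cat => ->; by rewrite ?orbT.
- move=> M N IHM IHN s x; rewrite mem_cat => /orP[/IHM|/IHN] [] [i iM xi]; [left|right|left|right];
    by exists i; rewrite // mem_cat iM ?orbT.
- move=> Ms IH s x; elim: IH => //= M {}Ms IHM _ IHs.
  rewrite mem_cat => /orP[/IHM|/IHs] [] [i iM xi]; [left|right|left|right];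
    by exists i; rewrite // mem_cat iM ?orbT.
- by move=> M IH s x; rewrite mem_unbind => /IH/up.
- by move=> p M IH s x; rewrite mem_unbind => /IH/up.
Qed.

Lemma fv_subst s M x : x \in fv (subst s M) -> exists2 i, i \in fv M & x \in fv (s i).
Proof.
rewrite {1}/fv mem_cat lfv_subst => /orP[/flatten_mapP[i iM xi]|/bfv_subst[] [i iM xi]];
  exists i; rewrite /fv ?mem_cat ?iM ?orbT //; move: xi; rewrite /fv ?mem_cat => ->; by rewrite ?orbT.
Qed.

Lemma count_lfv_subst x s M :
  count_mem x (lfv (subst s M)) = \sum_(i <- lfv M) count_mem x (lfv (s i)).
Proof.
by rewrite lfv_subst; elim: (lfv M) => [|i l IH] /=; rewrite ?big_nil ?big_cons ?count_cat ?IH.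
Qed.

Lemma sum_unbind k (l : seq nat) (F G : nat -> nat) :
  (forall i, F i = if i < k then 0 else G (i - k)) ->
  \sum_(i <- l) F i = \sum_(i <- unbind k l) G i.
Proof.
move=> FG; elim: l => [|i l IH]; first by rewrite !big_nil.
have -> : unbind k (i :: l) = if i < k then unbind k l else i - k :: unbind k l.
  by rewrite /unbind /= leqNgt; case: ltnP.
by rewrite big_cons IH FG; case: ltnP => // _; rewrite big_cons.
Qed.

(** Boxed occurrences receive terms without qubits, so only the unboxed ones, listed with
    multiplicity in [lfv], contribute. *)
Lemma count_qvars_subst r s M : {in bfv M, forall i, qvars (s i) = [::]} ->
  count_mem r (qvars (subst s M)) =
  count_mem r (qvars M) + \sum_(i <- lfv M) count_mem r (qvars (s i)).
Proof.
have up k s' i : count_mem r (qvars (up_sub k s' i)) =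
    if i < k then 0 else count_mem r (qvars (s' (i - k))).
  by rewrite /up_sub; case: ifP => //= _; rewrite qvars_rename.
have upb k s' (l : seq nat) : {in unbind k l, forall i, qvars (s' i) = [::]} ->
    {in l, forall i, qvars (up_sub k s' i) = [::]}.
  move=> h i il; rewrite /up_sub; case: ltnP => //= ki.
  by rewrite qvars_rename h // mem_unbind subnKC.
elim/term_nested_ind: M s => //=; rewrite ?big_nil ?addn0 //.
- by move=> x s h; rewrite big_seq1.
- by move=> x s h; rewrite big_nil !addn0.
- move=> M IH s h; rewrite IH; last by move=> i hi; rewrite h // mem_cat hi orbT.
  rewrite big_nil; have -> : \sum_(i <- lfv M) count_mem r (qvars (s i)) = 0; last by rewrite addn0.
  by rewrite big_seq big1 // => i hi; rewrite h // mem_cat hi.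
- by move=> *; rewrite big_nil.
- by move=> *; rewrite big_nil.
- move=> M N IHM IHN s h; rewrite !count_cat big_cat /= IHM ?IHN; first lia;
    by move=> i hi; rewrite h // mem_cat hi ?orbT.
- move=> Ms IH s h; elim: IH h => [|M {}Ms IHM _ IHs] /= h; first by rewrite big_nil.
  rewrite !count_cat big_cat /= IHM ?IHs; first lia;
    by move=> i hi; rewrite h // mem_cat hi ?orbT.
- by move=> M IH s h; rewrite (IH _ (upb _ _ _ h)); congr (_ + _); apply: sum_unbind.
- by move=> p M IH s h; rewrite (IH _ (upb _ _ _ h)); congr (_ + _); apply: sum_unbind.
Qed.

Lemma linocc_up_sub k s i M : i < k -> linocc i M -> linocc i (subst (up_sub k s) M).
Proof.
move=> ik /andP[/eqP c b]; apply/andP; split.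
  rewrite count_lfv_subst -c; apply/eqP; elim: (lfv M) => [|j l IH] /=; first by rewrite big_nil.
  rewrite big_cons IH; congr (_ + _); rewrite /up_sub; case: ltnP => jk //=; first by rewrite addn0.
  rewrite lfv_rename count_map (eq_count (a2 := pred0)) ?count_pred0.
    by apply/esym/eqP; rewrite eqb0; apply/eqP; lia.
  by move=> x /=; apply/eqP; lia.
apply/negP => /bfv_subst[] [j jM].
  case: (ltnP j k) => jk; first by rewrite up_sub_lt.
  by rewrite up_sub_ge // bfv_rename => /mapP[y _ e]; lia.
case: (ltnP j k) => jk; first by rewrite up_sub_lt // inE => /eqP e; rewrite e jM in b.
by rewrite up_sub_ge // fv_rename => /mapP[y _ e]; lia.
Qed.

Lemma lin_subst s M : lin M -> {in fv M, forall i, lin (s i)} ->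
  {in bfv M, forall i, qvars (s i) = [::]} -> lin (subst s M).
Proof.
have up1 k s' (A : term) : {in predU (mem (unbind k (lfv A))) (mem (unbind k (bfv A))), forall i, lin (s' i)} ->
    {in fv A, forall i, lin (up_sub k s' i)}.
  move=> h i; rewrite /fv mem_cat => hi; rewrite /up_sub; case: ltnP => // ki.
  by rewrite lin_rename h // !inE !mem_unbind subnKC.
have up2 k s' (l : seq nat) : {in unbind k l, forall i, qvars (s' i) = [::]} ->
    {in l, forall i, qvars (up_sub k s' i) = [::]}.
  move=> h i il; rewrite /up_sub; case: ltnP => //= ki.
  by rewrite qvars_rename h // mem_unbind subnKC.
elim/term_nested_ind: M s => //=.
- by move=> x s _ h _; rewrite h // inE.
- move=> M IH s /andP[lM /nilP qM] h1 h2; rewrite IH //=; last by move=> i hi; apply: h2; rewrite mem_cat hi orbT.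
  case E: (qvars (subst s M)) => [|r l] //.
  have : count_mem r (qvars (subst s M)) = 0.
    rewrite count_qvars_subst ?qM; last by move=> i hi; apply: h2; rewrite mem_cat hi orbT.
    by rewrite big_seq big1 // => i hi; rewrite h2 // mem_cat hi.
  by rewrite E /= eqxx.
- move=> M N IHM IHN s /andP[lM lN] h1 h2; rewrite IHM ?IHN //; move=> i hi;
    by [apply: h2; rewrite mem_cat hi ?orbT | apply: h1; move: hi; rewrite /fv /= !mem_cat => /orP[] ->; rewrite ?orbT].
- move=> Ms IH s /andP[]; rewrite size_map => ->; rewrite /fv /=; elim: IH => //= M {}Ms IHM _ IHs.
  move=> /andP[lM lMs] h1 h2; rewrite IHM ?IHs //; move=> i hi;
    by [apply: h2; rewrite mem_cat hi ?orbT | apply: h1; move: hi; rewrite /fv /= !mem_cat => /orP[] ->; rewrite ?orbT].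
- move=> M IH s lM h1 h2; apply: IH => //; first by apply: up1 => i hi; apply: h1; rewrite /fv mem_cat.
  exact: up2.
- move=> p M IH s /and3P[lM -> /allP oc] h1 h2; rewrite IH //=; first last.
  + exact: up2.
  + by apply: up1 => i hi; apply: h1; rewrite /fv mem_cat.
  apply/allP => i hi; move: (hi); rewrite mem_iota add0n => /andP[_ ik].
  by apply: linocc_up_sub => //; apply: oc.
Qed.

Lemma inst_subq_lt rs i : i < size rs -> inst_sub (map QVar rs) i = QVar (nth 0 rs i).
Proof. by move=> h; rewrite /inst_sub (nth_map 0). Qed.

Lemma inst_subq_ge rs i : size rs <= i -> inst_sub (map QVar rs) i = Var (i - size rs).
Proof. by move=> h; rewrite /inst_sub nth_default ?size_map. Qed.

Lemma count_lfv_inst1 x N M :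
  count_mem x (lfv (inst [:: N] M)) =
  count_mem x.+1 (lfv M) + count_mem 0 (lfv M) * count_mem x (lfv N).
Proof.
rewrite instE count_lfv_subst; elim: (lfv M) => [|[|i] l IH] /=; rewrite ?big_nil // big_cons IH.
  by rewrite /inst_sub /= mulnDl mul1n addnCA.
rewrite /inst_sub /= nth_nil subn1 /= eqSS addn0; lia.
Qed.

Lemma count_lfv_instq x rs M :
  count_mem x (lfv (inst (map QVar rs) M)) = count_mem (size rs + x) (lfv M).
Proof.
rewrite instE count_lfv_subst; elim: (lfv M) => [|i l IH] /=; rewrite ?big_nil // big_cons IH.
congr (_ + _); case: (ltnP i (size rs)) => h.
  by rewrite inst_subq_lt //=; apply/esym/eqP; rewrite eqb0; apply/eqP; lia.
by rewrite inst_subq_ge //= addn0; congr nat_of_bool; apply/eqP/eqP; lia.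
Qed.

Lemma bfv_inst1 x N M : x \in bfv (inst [:: N] M) ->
  [\/ x.+1 \in bfv M, 0 \in lfv M /\ x \in bfv N | 0 \in bfv M /\ x \in fv N].
Proof.
rewrite instE => /bfv_subst[] [[|i] iM]; rewrite /inst_sub /= ?nth_nil ?subn1 //=.
- by move=> ?; apply: Or32.
- by move=> ?; apply: Or33.
- by rewrite /fv /= inE => /eqP ->; apply: Or31.
Qed.

Lemma bfv_instq x rs M : x \in bfv (inst (map QVar rs) M) -> size rs + x \in bfv M.
Proof.
rewrite instE => /bfv_subst[] [i iM]; case: (ltnP i (size rs)) => h;
  rewrite ?(inst_subq_lt h) ?(inst_subq_ge h) //=.
by rewrite /fv /= inE => /eqP ->; rewrite subnKC.
Qed.

Lemma fv_inst1 x N M : x \in fv (inst [:: N] M) -> x.+1 \in fv M \/ 0 \in fv M /\ x \in fv N.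
Proof.
rewrite instE => /fv_subst[[|i] iM]; rewrite /inst_sub /= ?nth_nil ?subn1 //=; first by right.
by rewrite /fv /= inE => /eqP ->; left.
Qed.

Lemma fv_instq x rs M : x \in fv (inst (map QVar rs) M) -> size rs + x \in fv M.
Proof.
rewrite instE => /fv_subst[i iM]; case: (ltnP i (size rs)) => h;
  rewrite ?(inst_subq_lt h) ?(inst_subq_ge h) //=.
by rewrite /fv /= inE => /eqP ->; rewrite subnKC.
Qed.

Lemma count_qvars_inst1 r N M : (0 \in bfv M -> qvars N = [::]) ->
  count_mem r (qvars (inst [:: N] M)) =
  count_mem r (qvars M) + count_mem 0 (lfv M) * count_mem r (qvars N).
Proof.
move=> h; rewrite instE count_qvars_subst; last first.
  by move=> [|i] hi; rewrite /inst_sub /= ?nth_nil // h.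
congr (_ + _); elim: (lfv M) => [|[|i] l IH] /=; rewrite ?big_nil // big_cons IH.
  by rewrite /inst_sub /= mulnDl mul1n.
by rewrite /inst_sub /= nth_nil.
Qed.

Lemma count_qvars_instq r rs M : all (linocc ^~ M) (iota 0 (size rs)) ->
  count_mem r (qvars (inst (map QVar rs) M)) =
  count_mem r (qvars M) + count_mem r rs.
Proof.
move=> /allP h; rewrite instE count_qvars_subst; last first.
  move=> i hi; case: (ltnP i (size rs)) => ir; last by rewrite inst_subq_ge.
  have /h/andP[_] : i \in iota 0 (size rs) by rewrite mem_iota.
  by rewrite hi.
congr (_ + _).
have e i : count_mem r (qvars (inst_sub (map QVar rs) i)) =
    if i < size rs then nat_of_bool (nth 0 rs i == r) else 0.
  by case: ltnP => ir; rewrite ?(inst_subq_lt ir) ?(inst_subq_ge ir) //= addn0.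
rewrite (eq_bigr _ (fun i _ => e i)) -big_mkcond -big_filter /=.
(* Linearity makes the bound occurrences in [M] a rearrangement of [0, ..., size rs - 1], so every
   qubit is inserted exactly once. *)
rewrite (perm_big (iota 0 (size rs))) /=; last first.
  apply/allP => i; rewrite mem_cat mem_iota add0n /= => hi.
  have ir : i < size rs by move: hi; rewrite mem_filter => /orP[/andP[]|].
  have /h/andP[/eqP c _] : i \in iota 0 (size rs) by rewrite mem_iota.
  have -> : count_mem i (iota 0 (size rs)) = 1.
    by rewrite count_uniq_mem ?iota_uniq // mem_iota ir.
  rewrite count_filter -c; apply/eqP/eq_count => j /=.
  by case: eqP => // ->; rewrite ir.
rewrite -[rs in RHS](mkseq_nth 0) /mkseq count_map.
by elim: (iota _ _) => [|i l IH] /=; rewrite ?big_nil ?big_cons ?IH.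
Qed.

Lemma lin_inst1 N M : lin M -> lin N -> (0 \in bfv M -> qvars N = [::]) -> lin (inst [:: N] M).
Proof.
move=> lM lN h; apply: lin_subst => // -[|i] hi; rewrite /inst_sub /= ?nth_nil //; exact: h.
Qed.

Lemma lin_instq rs M : lin M -> all (linocc ^~ M) (iota 0 (size rs)) ->
  lin (inst (map QVar rs) M).
Proof.
move=> lM /allP h; apply: lin_subst => // i hi; case: (ltnP i (size rs)) => ir;
  rewrite -/(inst_sub (map QVar rs) i) ?(inst_subq_lt ir) ?(inst_subq_ge ir) //=.
have /h/andP[_] : i \in iota 0 (size rs) by rewrite mem_iota.
by rewrite hi.
Qed.

(** * Labelled reduction of terms *)

(** [Var] is excluded because a substitution may turn it into an application. An unevaluated [New]
    does count: what matters is only that the argument neither is nor becomes an application, the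
    form to which a commutative rule applies. *)
Definition isval (M : term) : bool :=
  match M with App _ _ | Var _ => false | _ => true end.

(** The effect on the register is split off as a label, so that the critical pairs of terms can be
    studied without amplitudes. *)
Inductive label :=
| LTau
| LNew of bool & nat
| LGate of nat & seq nat.

(* [cm] allows the commutative rules and the linear beta rule for arguments
   that may still become redexes of a commutative rule; [dp] allows reduction in
   the two contexts that [step] excludes: the body of a lambda-! and the argument of
   new.  Without the latter, substituting an unevaluated new(c) under a
   lambda-! would block it for ever and the diamond property would fail. *)
Inductive tstep (ar : nat -> nat) (cm dp : bool) : label -> term -> term -> Prop :=
| ts_gate i rs : size rs = ar i ->
    tstep ar cm dp (LGate i rs) (App (Gate i) (qtuple rs)) (qtuple rs)
| ts_new c r : tstep ar cm dp (LNew c r) (New (Bit c)) (QVar r)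
| ts_lin M N : cm || isval N -> tstep ar cm dp LTau (App (Lam PVar M) N) (inst [:: N] M)
| ts_tup M rs :
    tstep ar cm dp LTau (App (Lam (PTup (size rs)) M) (Tup (map QVar rs)))
      (inst (map QVar rs) M)
| ts_bang M N : tstep ar cm dp LTau (App (LamB M) (Bang N)) (inst [:: N] M)
| ts_comm_l L p M N : cm ->
    tstep ar cm dp LTau (App L (App (Lam p M) N))
      (App (Lam p (App (lift (pat_arity p) L) M)) N)
| ts_comm_r L p M N : cm ->
    tstep ar cm dp LTau (App (App (Lam p M) N) L)
      (App (Lam p (App M (lift (pat_arity p) L))) N)
| ts_in_tup l M M' Ms1 Ms2 :
    tstep ar cm dp l M M' -> tstep ar cm dp l (Tup (Ms1 ++ M :: Ms2)) (Tup (Ms1 ++ M' :: Ms2))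
| ts_in_appl l M M' N : tstep ar cm dp l M M' -> tstep ar cm dp l (App M N) (App M' N)
| ts_in_appr l M M' N : tstep ar cm dp l M M' -> tstep ar cm dp l (App N M) (App N M')
| ts_in_lam l p M M' : tstep ar cm dp l M M' -> tstep ar cm dp l (Lam p M) (Lam p M')
| ts_in_lamB l M M' : dp -> tstep ar cm dp l M M' -> tstep ar cm dp l (LamB M) (LamB M')
| ts_in_new l M M' : dp -> tstep ar cm dp l M M' -> tstep ar cm dp l (New M) (New M').

Lemma tstep_weaken ar (cm dp cm' dp' : bool) l M M' : (cm -> cm') -> (dp -> dp') ->
  tstep ar cm dp l M M' -> tstep ar cm' dp' l M M'.
Proof. by move=> h1 h2; elim; constructor; auto; move: H; case: cm h1 => [->|_ /= ->]; rewrite ?orbT. Qed.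

Definition new_count (l : label) (r : nat) : nat := if l is LNew _ r' then r == r' else 0.

Ltac count_lia :=
  repeat match goal with |- context [count ?p ?s] => let c := fresh in set c := (count p s); clearbody c end; lia.

(** Subject reduction in terms of counts. Boxes may be copied, so the number of occurrences is
    invariant only for variables that occur in no box; the variables of a linear pattern are of this
    kind, and hence the binders above the redex stay linear. No rule duplicates a qubit, because
    boxes contain none. *)
Lemma tstep_pres ar cm dp l M M' : tstep ar cm dp l M M' -> lin M ->
  [/\ lin M',
      forall x : nat, x \notin bfv M ->
        x \notin bfv M' /\ count_mem x (lfv M') = count_mem x (lfv M),
      forall x : nat, x \in fv M' -> x \in fv M &
      forall r : nat, count_mem r (qvars M') = count_mem r (qvars M) + new_count l r].
Proof.
elim=> {l M M'}.
- by move=> i [|r [|r' rs]] _ /= h; split=> //= r0; rewrite [RHS]addn0.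
- move=> c r _; split=> //= r'; by rewrite addn0 eq_sym.
- move=> M N _ /= /andP[/and3P[lM /andP[/eqP c b] _] lN].
  have hb : 0 \in bfv M -> qvars N = [::] by rewrite (negbTE b).
  split; first exact: lin_inst1.
  + move=> x; rewrite mem_cat negb_or mem_unbind => /andP[bM bN]; split.
      apply/negP => /bfv_inst1[h|[_ h]|[h _]]; [exact: (negP bM)|exact: (negP bN)|exact: (negP b)].
    by rewrite count_lfv_inst1 c mul1n count_cat count_unbind.
  + move=> x /fv_inst1; rewrite /fv /= !mem_cat !mem_unbind add1n.
    by case=> [|[_]] /orP[] ->; rewrite ?orbT.
  + by move=> r; rewrite count_qvars_inst1 // c mul1n count_cat addn0.
- move=> M rs /= /andP[/and3P[lM _ oc] _].
  have q0 : flatten (map lfv (map QVar rs)) = [::] by elim: rs {oc}.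
  have q1 : flatten (map bfv (map QVar rs)) = [::] by elim: rs {oc q0}.
  have q2 : flatten (map qvars (map QVar rs)) = rs by elim: rs {oc q0 q1} => //= r rs ->.
  split; first exact: lin_instq.
  + move=> x; rewrite q0 q1 !cats0 mem_unbind count_unbind => bM; split; last exact: count_lfv_instq.
    by apply: contra bM => /bfv_instq.
  + by move=> x /fv_instq; rewrite /fv /= q0 q1 !cats0 !mem_cat !mem_unbind.
  + by move=> r; rewrite count_qvars_instq // q2 count_cat addn0.
- move=> M N /= /andP[lM /andP[lN /nilP qN]].
  split; first exact: lin_inst1.
  + move=> x; rewrite !mem_cat !negb_or mem_unbind => /andP[bM /andP[x1 x2]]; split.
      apply/negP => /bfv_inst1[h|[_ h]|[_ h]]; [exact: (negP bM)|exact: (negP x2)|].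
      by move: h; rewrite mem_cat (negbTE x1) (negbTE x2).
    by rewrite count_lfv_inst1 (count_memPn x1) muln0 addn0 cats0 count_unbind.
  + move=> x /fv_inst1; rewrite /fv /= !mem_cat !mem_unbind add1n.
    by case=> [|[_]] /orP[] ->; rewrite ?orbT.
  + by move=> r; rewrite count_qvars_inst1 // qN muln0 count_cat !addn0.
- move=> L p M N _ /= /and3P[lL /and3P[lM po /allP oc] lN].
  have ub k l : unbind k (map (addn k) l) = l.
    by rewrite /unbind; elim: l => //= x l IH; rewrite leq_addr /= addKn IH.
  rewrite /lift lin_rename qvars_rename /fv /= lfv_rename bfv_rename.
  rewrite !unbind_cat !ub; split.
  + rewrite lL lM lN po /= andbT; apply/allP => i hi; have /andP[/eqP c b] := oc i hi.
    move: hi; rewrite mem_iota add0n => /andP[_ ip].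
    rewrite /linocc /= lfv_rename bfv_rename count_cat c mem_cat (negbTE b) orbF.
    rewrite (count_memPn _) ?add0n ?eqxx /=; first by apply/mapP => -[y _ e]; lia.
    by apply/mapP => -[y _ e]; lia.
  + by move=> x; rewrite !mem_cat !negb_or !count_cat => /and3P[-> -> ->]; split=> //; count_lia.
  + by move=> x; rewrite !mem_cat; do !case: (_ \in _).
  + by move=> r; rewrite !count_cat; count_lia.
- move=> L p M N _ /= /andP[/andP[/and3P[lM po /allP oc] lN] lL].
  have ub k l : unbind k (map (addn k) l) = l.
    by rewrite /unbind; elim: l => //= x l IH; rewrite leq_addr /= addKn IH.
  rewrite /lift lin_rename qvars_rename /fv /= lfv_rename bfv_rename.
  rewrite !unbind_cat !ub; split.
  + rewrite lL lM lN po /= andbT; apply/allP => i hi; have /andP[/eqP c b] := oc i hi.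
    move: hi; rewrite mem_iota add0n => /andP[_ ip].
    rewrite /linocc /= lfv_rename bfv_rename count_cat c mem_cat (negbTE b) /=.
    rewrite (count_memPn _) ?addn0 ?eqxx /=; first by apply/mapP => -[y _ e]; lia.
    by apply/mapP => -[y _ e]; lia.
  + by move=> x; rewrite !mem_cat !negb_or !count_cat => /andP[/andP[-> ->] ->]; split=> //; count_lia.
  + by move=> x; rewrite !mem_cat; do !case: (_ \in _).
  + by move=> r; rewrite !count_cat; count_lia.
- move=> l M M' Ms1 Ms2 _ IH /=; rewrite !size_cat /= !all_cat /=.
  move=> /and3P[sz l1 /andP[lM l2]]; have [lM' h1 h2 h3] := IH lM.
  rewrite /fv /= !map_cat /= !flatten_cat /=; split.
  + by rewrite sz l1 lM' l2.
  + move=> x; rewrite !mem_cat !negb_or !count_cat => /and3P[-> /h1[-> ->] ->].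
    by split.
  + move=> x; have := h2 x; rewrite /fv !mem_cat; do !case: (_ \in _) => //=; by move=> h; apply: h.
  + by move=> r; rewrite !count_cat h3; count_lia.
- move=> l M M' N _ IH /= /andP[lM lN]; have [lM' h1 h2 h3] := IH lM; split.
  + by rewrite lM'.
  + by move=> x; rewrite !mem_cat !negb_or !count_cat => /andP[/h1[-> ->] ->].
  + move=> x; have := h2 x; rewrite /fv /= !mem_cat; do !case: (_ \in _) => //=; by move=> h; apply: h.
  + by move=> r; rewrite !count_cat h3; count_lia.
- move=> l M M' N _ IH /= /andP[lN lM]; have [lM' h1 h2 h3] := IH lM; split.
  + by rewrite lM' lN.
  + by move=> x; rewrite !mem_cat !negb_or !count_cat => /andP[-> /h1[-> ->]].
  + move=> x; have := h2 x; rewrite /fv /= !mem_cat; do !case: (_ \in _) => //=; by move=> h; apply: h.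
  + by move=> r; rewrite !count_cat h3; count_lia.
- move=> l p M M' _ IH /= /and3P[lM po /allP oc]; have [lM' h1 h2 h3] := IH lM; split=> //.
  + rewrite lM' po /=; apply/allP => i /oc/andP[/eqP c /h1[b' c']].
    by rewrite /linocc c' c b'.
  + by move=> x; rewrite !mem_unbind !count_unbind => /h1.
  + by move=> x; have := h2 (pat_arity p + x); rewrite /fv /= !mem_cat !mem_unbind.
- move=> l M M' _ _ IH /= lM; have [lM' h1 h2 h3] := IH lM; split=> //.
  + by move=> x; rewrite !mem_unbind !count_unbind => /h1.
  + by move=> x; have := h2 (1 + x); rewrite /fv /= !mem_cat !mem_unbind.
- by move=> l M M' _ _ IH /= lM; apply: IH.
Qed.

Lemma subst_qtuple s rs : subst s (qtuple rs) = qtuple rs.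
Proof. by case: rs => [|r [|r' rs]] //=; do 3 congr cons || congr Tup; elim: rs => //= x rs ->. Qed.

Lemma map_subst_QVar s rs : map (subst s) (map QVar rs) = map QVar rs.
Proof. by rewrite -map_comp. Qed.

Lemma isval_subst s N : isval N -> isval (subst s N).
Proof. by case: N. Qed.

Lemma tstep_subst ar cm dp l M M' s :
  tstep ar cm dp l M M' -> tstep ar cm dp l (subst s M) (subst s M').
Proof.
move=> st; elim: st s => {l M M'} /=.
- by move=> i rs h s; rewrite !subst_qtuple; constructor.
- by constructor.
- move=> M N h s; rewrite subst_inst /=; constructor.
  by case/orP: h => [->|/isval_subst ->]; rewrite ?orbT.
- by move=> M rs s; rewrite subst_inst !map_subst_QVar size_map; constructor.
- by move=> M N s; rewrite subst_inst /=; constructor.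
- by move=> L p M N h s; rewrite up_sub_lift; constructor.
- by move=> L p M N h s; rewrite up_sub_lift; constructor.
- by move=> l M M' Ms1 Ms2 _ IH s; rewrite !map_cat /=; constructor.
- by constructor.
- by constructor.
- by constructor.
- by constructor.
- by constructor.
Qed.

Lemma tstep_lift ar cm dp l M M' k :
  tstep ar cm dp l M M' -> tstep ar cm dp l (lift k M) (lift k M').
Proof. by rewrite /lift !rename_subst; apply: tstep_subst. Qed.

Lemma flatten_count1 (A : Type) (f : A -> seq nat) (i : nat) (s : seq A) :
  count_mem i (flatten (map f s)) = 1 -> exists s1 x s2,
  [/\ s = s1 ++ x :: s2, count_mem i (f x) = 1,
      i \notin flatten (map f s1) & i \notin flatten (map f s2)].
Proof.
elim: s => //= x s IH; rewrite count_cat => e.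
case c: (count_mem i (f x)) e => [|n] e.
  have [s1 [y [s2 [-> cy h1 h2]]]] := IH e; exists (x :: s1), y, s2; split=> //=.
  by rewrite mem_cat negb_or h1 andbT; apply/count_memPn.
have [n0 e0] : n = 0 /\ count_mem i (flatten (map f s)) = 0.
  by move: e; rewrite addSn => -[] /eqP; rewrite addn_eq0 => /andP[/eqP -> /eqP ->].
by exists [::], x, s; rewrite c n0; split=> //; apply/count_memPn.
Qed.

Lemma up_sub_off k s t i : (forall j, j != i -> s j = t j) ->
  forall j, j != k + i -> up_sub k s j = up_sub k t j.
Proof.
move=> h j ji; rewrite /up_sub; case: ltnP => // kj; rewrite h //.
by apply: contra ji => /eqP <-; rewrite subnKC.
Qed.

Lemma subst_off s t i M : (forall j, j != i -> s j = t j) -> i \notin fv M ->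
  subst s M = subst t M.
Proof. by move=> h iM; apply: subst_ext_fv => j jM; apply: h; apply: contraNneq iM => <-. Qed.

(* Both lambda-! and new are crossed here, whence the deep relation. *)
Lemma tstep_subst_arg ar cm l s t (i : nat) M :
  (forall j, j != i -> s j = t j) -> linocc i M -> tstep ar cm true l (s i) (t i) ->
  tstep ar cm true l (subst s M) (subst t M).
Proof.
move=> + /andP[/eqP]; elim/term_nested_ind: M s t i => //=.
- move=> x s t i _; rewrite addn0 /=; case: eqP => // -> _ _; exact.
- by move=> M IH s t i *; constructor => //; apply: IH; eauto.
- move=> M N IHM IHN s t i off; rewrite count_cat mem_cat negb_or => c /andP[bM bN] st.
  case cM: (count_mem i (lfv M)) c => [|n] c.
    rewrite (@subst_off s t i M) //; last by rewrite mem_cat negb_or bM andbT; apply/count_memPn.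
    by constructor; apply: IHN; eauto.
  have [n0 cN] : n = 0 /\ count_mem i (lfv N) = 0.
    by move: c; rewrite addSn => -[] /eqP; rewrite addn_eq0 => /andP[/eqP -> /eqP ->].
  rewrite (@subst_off s t i N) //; last by rewrite mem_cat negb_or bN andbT; apply/count_memPn.
  by constructor; apply: IHM; eauto; rewrite cM n0.
- move=> Ms IH s t i off /flatten_count1[Ms1 [M [Ms2 [e c n1 n2]]]] b st.
  move: IH b; rewrite e => /List.Forall_app[_ /List.Forall_cons_iff[IH _]].
  rewrite !map_cat !flatten_cat /= !mem_cat !negb_or => /and3P[b1 bM b2].
  have off' Ns : i \notin flatten (map lfv Ns) -> i \notin flatten (map bfv Ns) ->
      map (subst s) Ns = map (subst t) Ns.
    elim: Ns => //= N Ns IHN; rewrite !mem_cat !negb_or => /andP[u1 u2] /andP[u3 u4].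
    by rewrite IHN // (@subst_off s t i N) // mem_cat negb_or u1.
  by rewrite !off' //; constructor; apply: IH; eauto.
- move=> M IH s t i off c b st; constructor => //; apply: (IH _ _ (1 + i)).
  + exact: up_sub_off.
  + by rewrite -count_unbind.
  + by rewrite -mem_unbind.
  + by rewrite !up_sub_ge ?leq_addr // addKn; apply: tstep_lift.
- move=> p M IH s t i off c b st; constructor => //; apply: (IH _ _ (pat_arity p + i)).
  + exact: up_sub_off.
  + by rewrite -count_unbind.
  + by rewrite -mem_unbind.
  + by rewrite !up_sub_ge ?leq_addr // addKn; apply: tstep_lift.
Qed.

Lemma tstep_inst1 ar cm l N N' M : linocc 0 M -> tstep ar cm true l N N' ->
  tstep ar cm true l (inst [:: N] M) (inst [:: N'] M).
Proof. by move=> o st; rewrite !instE; apply: (@tstep_subst_arg _ _ _ _ _ 0) => // -[|j]. Qed.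

Lemma map_QVar_inj : injective (map QVar).
Proof. by apply: inj_map => x y []. Qed.

Lemma qtuple_inj rs rs' : size rs = size rs' -> qtuple rs = qtuple rs' -> rs = rs'.
Proof.
by case: rs rs' => [|r [|r1 rs]] [|r' [|r1' rs']] //= _ []; [move=> -> | move=> -> -> /map_QVar_inj ->].
Qed.

Lemma tstep_Tup_QVar ar cm dp l rs M : ~ tstep ar cm dp l (Tup (map QVar rs)) M.
Proof.
move=> st; inversion st as [| | | | | | |l' M1 M2 Ms1 Ms2 st1 e1 e2| | | | |]; subst.
have {e2}: exists r, M1 = QVar r.
  elim: Ms1 rs e2 {st} => [|N Ms1 IH] [|r rs] //=; last by case=> _ /IH.
  by case=> -> _; exists r.
by case=> r e; rewrite e in st1; inversion st1.
Qed.

Lemma tstep_qtuple ar cm dp l rs M : ~ tstep ar cm dp l (qtuple rs) M.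
Proof.
case: rs => [|r [|r' rs]]; try exact: tstep_Tup_QVar; move=> st; inversion st.
Qed.

Lemma cat_cons_split (A : Type) (s1 t1 s2 t2 : seq A) x y :
  s1 ++ x :: s2 = t1 ++ y :: t2 ->
  [\/ [/\ s1 = t1, x = y & s2 = t2],
      exists u, t1 = s1 ++ x :: u /\ s2 = u ++ y :: t2 |
      exists u, s1 = t1 ++ y :: u /\ t2 = u ++ x :: s2].
Proof.
elim: s1 t1 => [|a s1 IH] [|b t1] /=.
- by case=> -> ->; apply: Or31.
- by case=> -> ->; apply: Or32; exists t1.
- by case=> -> <-; apply: Or33; exists s1.
- by case=> -> /IH[[-> -> ->]|[u [-> ->]]|[u [-> ->]]]; [apply: Or31|apply: Or32; exists u|apply: Or33; exists u].
Qed.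

Definition label_qvars (l : label) : seq nat := if l is LGate _ rs then rs else [::].

Lemma qvars_qtuple rs : qvars (qtuple rs) = rs.
Proof. by case: rs => [|r [|r' rs]] //=; do 2 congr cons; elim: rs => //= x rs ->. Qed.

Lemma tstep_label_qvars ar cm dp l M M' : tstep ar cm dp l M M' ->
  {subset label_qvars l <= qvars M}.
Proof.
elim=> {l M M'} //=.
- by move=> i rs _ x; rewrite qvars_qtuple.
- by move=> l M M' Ms1 Ms2 _ IH x /IH; rewrite map_cat flatten_cat /= !mem_cat => ->; rewrite orbT.
- by move=> l M M' N _ IH x /IH; rewrite mem_cat => ->.
- by move=> l M M' N _ IH x /IH; rewrite mem_cat => ->; rewrite orbT.
Qed.

Lemma label_qvars_disjoint (l1 l2 : label) (s t : seq nat) :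
  {subset label_qvars l1 <= s} -> {subset label_qvars l2 <= t} -> ~~ has (mem t) s ->
  ~~ has (mem (label_qvars l1)) (label_qvars l2).
Proof.
move=> h1 h2 st; apply/hasPn => x /h2 xt; apply/negP => /h1 xs.
by move/hasPn: st => /(_ _ xs); rewrite /= xt.
Qed.

Lemma rename_qvars_id s M : {in qvars M, s =1 id} -> rename_qvars s M = M.
Proof.
elim/term_nested_ind: M => //=.
- by move=> r ->; rewrite // inE.
- by move=> M IH h; rewrite IH.
- by move=> M IH h; rewrite IH.
- by move=> M N IHM IHN h; rewrite IHM ?IHN // => x hx; apply: h; rewrite mem_cat hx ?orbT.
- move=> Ms IH h; congr Tup; elim: IH h => //= M {}Ms IHM _ IHMs h.
  by rewrite IHM ?IHMs // => x hx; apply: h; rewrite mem_cat hx ?orbT.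
- by move=> M IH h; rewrite IH.
- by move=> p M IH h; rewrite IH.
Qed.

(* The same new(c) contracted with two different fresh names. *)
Definition same_new (l1 l2 : label) (M M1 M2 : term) : Prop :=
  exists c r1 r2, [/\ l1 = LNew c r1, l2 = LNew c r2 &
    forall s, {in qvars M, s =1 id} -> s r1 = r2 -> M2 = rename_qvars s M1].

(** The residual of the restricted step is again restricted, while the other side may use any step;
    this asymmetry lets one restricted path be compared with arbitrary reductions. A silent step may
    have nothing left to do, as when a commutative step is overtaken by the contraction of the redex
    that it moves. The condition on the labels makes two gates act on disjoint qubits, so that they
    commute. *)
Definition joins ar (l1 l2 : label) (M1 M2 : term) : Prop :=
  ~~ has (mem (label_qvars l1)) (label_qvars l2) /\
  exists M3, (tstep ar false true l1 M2 M3 \/ l1 = LTau /\ M2 = M3) /\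
             (tstep ar true true l2 M1 M3 \/ l2 = LTau /\ M1 = M3).

Definition diamond_ok ar l1 l2 M M1 M2 : Prop :=
  [\/ l1 = l2 /\ M1 = M2, same_new l1 l2 M M1 M2 | joins ar l1 l2 M1 M2].

(** Covers the congruence cases at once. The list [s] holds the qubits of the context [C], which a
    renaming between two fresh names has to fix. *)
Lemma diamond_context ar l1 l2 M M1 M2 (C : term -> term) (s : seq nat) :
  (forall l N N' cm, tstep ar cm true l N N' -> tstep ar cm true l (C N) (C N')) ->
  (forall u N, {in s, u =1 id} -> rename_qvars u (C N) = C (rename_qvars u N)) ->
  (forall N x, x \in qvars (C N) = (x \in s) || (x \in qvars N)) ->
  diamond_ok ar l1 l2 M M1 M2 -> diamond_ok ar l1 l2 (C M) (C M1) (C M2).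
Proof.
move=> hC hr hq [[-> ->]|[c [r1 [r2 [-> -> h]]]]|[dj [M3 [h1 h2]]]]; first by apply: Or31.
  apply: Or32; exists c, r1, r2; split=> // u hu ur; rewrite hr ?(h u) //.
    by move=> x xM; apply: hu; rewrite hq xM orbT.
  by move=> x xs; apply: hu; rewrite hq xs.
apply: Or33; split=> //; exists (C M3); split.
  by case: h1 => [|[-> ->]]; [left; apply: hC|right].
by case: h2 => [|[-> ->]]; [left; apply: hC|right].
Qed.

Lemma diamond_parallel ar l1 l2 M1 M2 M3 (s t : seq nat) :
  tstep ar false true l1 M2 M3 -> tstep ar true true l2 M1 M3 ->
  {subset label_qvars l1 <= s} -> {subset label_qvars l2 <= t} -> ~~ has (mem t) s ->
  joins ar l1 l2 M1 M2.
Proof. by move=> h1 h2 s1 s2 st; split; [exact: (label_qvars_disjoint s1 s2)|exists M3; split; left]. Qed.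

Lemma joins_tau_l ar l2 M1 M2 M3 :
  tstep ar false true LTau M2 M3 \/ M2 = M3 ->
  tstep ar true true l2 M1 M3 \/ l2 = LTau /\ M1 = M3 -> joins ar LTau l2 M1 M2.
Proof.
move=> h1 h2; split; first by apply/hasPn.
by exists M3; split=> //; case: h1; [left|right].
Qed.

Lemma joins_tau_r ar l1 M1 M2 M3 :
  tstep ar false true l1 M2 M3 \/ l1 = LTau /\ M2 = M3 ->
  tstep ar true true LTau M1 M3 \/ M1 = M3 -> joins ar l1 LTau M1 M2.
Proof.
move=> h1 h2; split; first by apply/hasPn.
by exists M3; split=> //; case: h2; [left|right].
Qed.

Lemma isval_tstep ar cm dp l N N' : tstep ar cm dp l N N' -> isval N -> isval N'.
Proof. by case=> // i [|r [|r' rs]]. Qed.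

Lemma qtuple_App rs M N : qtuple rs <> App M N.
Proof. by case: rs => [|r [|r' rs]]. Qed.

Ltac inv H := inversion H; subst; clear H.
Ltac inv_tstep t := match goal with H : tstep _ _ _ _ t _ |- _ => inv H end.

Lemma lin_App M N : lin (App M N) -> lin M /\ lin N.
Proof. by move=> /= /andP[]. Qed.

(** Besides disjoint positions, the overlaps are steps inside a redex and commutative rules around
    one. [uniq (qvars M)] makes gates at disjoint positions act on disjoint qubits, and [lin M]
    leaves a single residual of a step in a linear argument. *)
Lemma tstep_diamond ar l1 l2 M M1 M2 :
  tstep ar false true l1 M M1 -> tstep ar true true l2 M M2 ->
  lin M -> uniq (qvars M) -> diamond_ok ar l1 l2 M M1 M2.
Proof.
move=> st1; elim: st1 l2 M2 => {l1 M M1}.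
- move=> i rs hs l2 M2 st2 _ _; inv st2.
  + match goal with H : qtuple ?a = qtuple ?b |- _ =>
      have e : a = b by apply: qtuple_inj => //; congruence end.
    by rewrite e; apply: Or31.
  + by exfalso; match goal with H : _ = qtuple _ |- _ => move/esym: H => /qtuple_App end.
  + by inv_tstep (Gate i).
  + by exfalso; match goal with H : tstep _ _ _ _ (qtuple _) _ |- _ => exact: tstep_qtuple H end.
- move=> c r l2 M2 st2 _ _; inv st2.
  + by apply: Or32; exists c, r, r0; split=> // s _ <-.
  + by inv_tstep (Bit c).
(* A commutative step at the root would need an application as argument, which [vN] excludes. *)
- move=> M N /= vN l2 M2 st2 /= /andP[/and3P[lM oM _] lN] _; inv st2 => //.
  + by apply: Or31.
  + inv_tstep (Lam PVar M); apply: Or33; apply: (@joins_tau_l _ _ _ _ (inst [:: N] M'0)).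
      by left; constructor.
    by left; apply: tstep_subst.
  (* The linear variable occurs once, so the step in the argument has exactly one residual, possibly
     under a lambda-! or a new. *)
  + apply: Or33; apply: (@joins_tau_l _ _ _ _ (inst [:: M'] M)).
      by left; constructor; rewrite /= (isval_tstep H3).
    by left; apply: tstep_inst1.
- move=> M rs l2 M2 st2 _ _; inv st2 => //.
  + by apply: Or31; split=> //; congr inst; symmetry; congr map; apply: map_QVar_inj.
  + inv_tstep (Lam (PTup (size rs)) M); apply: Or33.
    apply: (@joins_tau_l _ _ _ _ (inst (map QVar rs) M'0)); first by left; constructor.
    by left; apply: tstep_subst.
  + by exfalso; apply: tstep_Tup_QVar H3.
- move=> M N l2 M2 st2 _ _; inv st2 => //.
  + by apply: Or31.
  + inv_tstep (LamB M); apply: Or33.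
    apply: (@joins_tau_l _ _ _ _ (inst [:: N] M'0)); first by left; constructor.
    by left; apply: tstep_subst.
  + by inv_tstep (Bang N).
- by [].
- by [].
- move=> l M M' Ms1 Ms2 st1 IH l2 M2 st2 lT uT; inv st2; rename H into e, H1 into H3.
  move: lT uT => /= /andP[_ lT]; rewrite map_cat flatten_cat /= => uT.
  have [[e1 e2 e3]|[u [e1 e2]]|[u [e1 e2]]] := cat_cons_split e; subst.
  + have lM : lin M by move: lT; rewrite all_cat /= => /and3P[].
    have uM : uniq (qvars M) by move: uT; rewrite !cat_uniq => /and3P[_ _ /and3P[]].
    apply: (@diamond_context _ _ _ _ _ _ (fun A => Tup (Ms1 ++ A :: Ms2))
      (flatten (map qvars Ms1) ++ flatten (map qvars Ms2))); last exact: IH.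
    * by move=> *; constructor.
    * move=> v A h /=; rewrite map_cat /=.
      have fixed Ns : {subset flatten (map qvars Ns) <=
          flatten (map qvars Ms1) ++ flatten (map qvars Ms2)} -> map (rename_qvars v) Ns = Ns.
        elim: Ns => //= B Ns IHN sub; rewrite IHN ?rename_qvars_id // => x hx.
          by apply/h/sub; rewrite mem_cat hx.
        by apply: sub; rewrite mem_cat hx orbT.
      by rewrite !fixed // => x hx; rewrite mem_cat hx ?orbT.
    * by move=> A x /=; rewrite map_cat flatten_cat /= !mem_cat orbA -orbA orbCA orbC.
  + apply: Or33; apply: (@diamond_parallel _ _ _ _ _ (Tup (Ms0 ++ M'0 :: u ++ M' :: Ms2)) (qvars M) (qvars M0)).
    * by have := @ts_in_tup ar false true l M M' (Ms0 ++ M'0 :: u) Ms2 st1; rewrite -!catA.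
    * by rewrite -catA /=; constructor; apply: tstep_weaken H3.
    * exact: tstep_label_qvars st1.
    * exact: tstep_label_qvars H3.
    * move: uT; rewrite cat_uniq => /and3P[_ /hasPn h _]; apply/hasPn => x xM.
      have := h x; rewrite mem_cat xM => /(_ isT).
      by rewrite /= map_cat flatten_cat /= !mem_cat !negb_or => /and3P[].
  + apply: Or33; apply: (@diamond_parallel _ _ _ _ _ (Tup (Ms1 ++ M' :: u ++ M'0 :: Ms3)) (qvars M) (qvars M0)).
    * by rewrite -catA /=; constructor.
    * by have := @ts_in_tup ar true true l2 M0 M'0 (Ms1 ++ M' :: u) Ms3 H3; rewrite -!catA.
    * exact: tstep_label_qvars st1.
    * exact: tstep_label_qvars H3.
    * move: uT; rewrite cat_uniq => /and3P[_ _]; rewrite cat_uniq => /and3P[_ /hasPn h _].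
      apply/hasPn => x xM; apply/negP => xM0; have := h x.
      by rewrite map_cat flatten_cat /= !mem_cat; rewrite /= in xM0; rewrite xM0 orbT /= xM => /(_ isT).
- move=> l M M' N st1 IH l2 M2 st2 lMN uMN; have [lM lN] := lin_App lMN.
  move: (uMN); rewrite /= cat_uniq => /and3P[uM dj uN]; inv st2.
  + by inv_tstep (Gate i).
  + inv_tstep (Lam PVar M0); apply: Or33.
    apply: (@joins_tau_r _ _ _ _ (inst [:: N] M'0)); first by left; apply: tstep_subst.
    by left; constructor.
  + inv_tstep (Lam (PTup (size rs)) M0); apply: Or33.
    apply: (@joins_tau_r _ _ _ _ (inst (map QVar rs) M'0)); first by left; apply: tstep_subst.
    by left; constructor.
  + inv_tstep (LamB M0); apply: Or33.
    apply: (@joins_tau_r _ _ _ _ (inst [:: N0] M'0)); first by left; apply: tstep_subst.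
    by left; constructor.
  + apply: Or33; apply: (@joins_tau_r _ _ _ _ (App (Lam p (App (lift (pat_arity p) M') M0)) N0)).
      by left; do 3 constructor; apply: tstep_lift.
    by left; constructor.
  (* A commutative rule against a step of the redex that it moves. If the restricted step contracts
     this redex, the moved copy contracts to the very same term, because [lift] protects [N] from
     the substitution, and the other side needs no step. *)
  + apply: Or33; inv_tstep (App (Lam p M0) N0).
    * apply: (@joins_tau_r _ _ _ _ (App (inst [:: N0] M0) N)); last by right.
      left; have <- : inst [:: N0] (App M0 (lift 1 N)) = App (inst [:: N0] M0) N.
        by rewrite -[in RHS](inst_lift [:: N0] N).
      by constructor.
    * apply: (@joins_tau_r _ _ _ _ (App (inst (map QVar rs) M0) N)); last by right.
      left; have <- : inst (map QVar rs) (App M0 (lift (size rs) N)) = App (inst (map QVar rs) M0) N.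
        by rewrite -[in RHS](inst_lift (map QVar rs) N) size_map.
      by constructor.
    * by [].
    * inv_tstep (Lam p M0).
      match goal with H : tstep _ _ _ l M0 ?P |- _ =>
        apply: (@joins_tau_r _ _ _ _ (App (Lam p (App P (lift (pat_arity p) N))) N0)) end.
        by left; do 3 constructor.
      by left; constructor.
    * apply: (@joins_tau_r _ _ _ _ (App (Lam p (App M0 (lift (pat_arity p) N))) M'0)).
        by left; constructor.
      by left; constructor.
  + apply: (@diamond_context _ _ _ _ _ _ (App^~ N) (qvars N)).
    * by move=> *; constructor.
    * by move=> u A h /=; rewrite (rename_qvars_id h).
    * by move=> A x; rewrite mem_cat orbC.
    * exact: IH.
  + apply: Or33; apply: (@diamond_parallel _ _ _ _ _ (App M' M'0) (qvars M) (qvars N)).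
    * by constructor.
    * by constructor; apply: tstep_weaken H3.
    * exact: tstep_label_qvars st1.
    * exact: tstep_label_qvars H3.
    * by rewrite has_sym.
- move=> l M M' N st1 IH l2 M2 st2 lMN uMN; have [lN lM] := lin_App lMN.
  move: (uMN); rewrite /= cat_uniq => /and3P[uN dj uM]; inv st2.
  + by exfalso; apply: tstep_qtuple st1.
  + apply: Or33; apply: (@joins_tau_r _ _ _ _ (inst [:: M'] M0)).
      left; apply: tstep_inst1 => //; by move: lN => /= /and3P[].
    by left; constructor.
  + by exfalso; apply: tstep_Tup_QVar st1.
  + by inv_tstep (Bang N0).
  + apply: Or33; inv_tstep (App (Lam p M0) N0).
    * apply: (@joins_tau_r _ _ _ _ (App N (inst [:: N0] M0))); last by right.
      left; have <- : inst [:: N0] (App (lift 1 N) M0) = App N (inst [:: N0] M0).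
        by rewrite -[in RHS](inst_lift [:: N0] N).
      by constructor.
    * apply: (@joins_tau_r _ _ _ _ (App N (inst (map QVar rs) M0))); last by right.
      left; have <- : inst (map QVar rs) (App (lift (size rs) N) M0) = App N (inst (map QVar rs) M0).
        by rewrite -[in RHS](inst_lift (map QVar rs) N) size_map.
      by constructor.
    * by [].
    * inv_tstep (Lam p M0).
      match goal with H : tstep _ _ _ l M0 ?P |- _ =>
        apply: (@joins_tau_r _ _ _ _ (App (Lam p (App (lift (pat_arity p) N) P)) N0)) end.
        by left; do 3 constructor.
      by left; constructor.
    * apply: (@joins_tau_r _ _ _ _ (App (Lam p (App (lift (pat_arity p) N) M0)) M'0)).
        by left; constructor.
      by left; constructor.
  + apply: Or33; apply: (@joins_tau_r _ _ _ _ (App (Lam p (App M0 (lift (pat_arity p) M'))) N0)).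
      by left; do 3 constructor; apply: tstep_lift.
    by left; constructor.
  + apply: Or33; apply: (@diamond_parallel _ _ _ _ _ (App M'0 M') (qvars M) (qvars N)).
    * by constructor.
    * by constructor; apply: tstep_weaken H3.
    * exact: tstep_label_qvars st1.
    * exact: tstep_label_qvars H3.
    * by [].
  + apply: (@diamond_context _ _ _ _ _ _ (App N) (qvars N)).
    * by move=> *; constructor.
    * by move=> u A h /=; rewrite (rename_qvars_id h).
    * by move=> A x; rewrite mem_cat.
    * exact: IH.
- move=> l p M M' st1 IH l2 M2 st2 /= /and3P[lM _ _] uM; inv st2.
  apply: (@diamond_context _ _ _ _ _ _ (Lam p) [::]) => //; last exact: IH.
  by move=> *; constructor.
- move=> l M M' _ st1 IH l2 M2 st2 lM uM; inv st2.
  apply: (@diamond_context _ _ _ _ _ _ LamB [::]) => //; last exact: IH.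
  by move=> *; constructor.
- move=> l M M' _ st1 IH l2 M2 st2 lM uM; inv st2; first by inv_tstep (Bit c).
  apply: (@diamond_context _ _ _ _ _ _ New [::]) => //; last exact: IH.
  by move=> *; constructor.
Qed.

Local Open Scope fset_scope.

(** * Registers as functions of total assignments *)

Definition amp (R : realType) : Type := (nat -> bool) -> R[i].

Definition upd (b : nat -> bool) (rs : seq nat) (bs : seq bool) : nat -> bool :=
  fun v => nth (b v) bs (index v rs).

Definition agate (R : realType) (u : qgate R) (rs : seq nat) (q : amp R) : amp R :=
  fun b => (\sum_(bs : (arity u).-tuple bool)
     gmat u (bits_ord [tuple b (nth 0%N rs l) | l < arity u]) (bits_ord bs) * q (upd b rs bs))%R.

Definition atens (R : realType) (r : nat) (c : bool) (q : amp R) : amp R :=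
  fun b => if b r == c then q b else 0%R.

Definition supported (R : realType) (V : {fset nat}) (q : amp R) : Prop :=
  forall b b', {in V, b =1 b'} -> q b = q b'.

Lemma upd_notin b rs bs v : size bs = size rs -> v \notin rs -> upd b rs bs v = b v.
Proof. by move=> sz vr; rewrite /upd nth_default // sz leqNgt index_mem. Qed.

Lemma upd_in b b' rs bs v : size bs = size rs -> v \in rs -> upd b rs bs v = upd b' rs bs v.
Proof. by move=> sz vr; rewrite /upd; apply: set_nth_default; rewrite sz index_mem. Qed.

Lemma upd_comm b rs1 bs1 rs2 bs2 : size bs1 = size rs1 -> size bs2 = size rs2 ->
  ~~ has (mem rs1) rs2 ->
  upd (upd b rs1 bs1) rs2 bs2 = upd (upd b rs2 bs2) rs1 bs1.
Proof.
move=> s1 s2 /hasPn dj; apply: functional_extensionality => v.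
case: (boolP (v \in rs2)) => v2.
  by rewrite [RHS]upd_notin // ?dj //; apply: upd_in.
rewrite [LHS]upd_notin //; case: (boolP (v \in rs1)) => v1; first exact: upd_in.
by rewrite !upd_notin.
Qed.

Lemma agate_comm (R : realType) (u1 u2 : qgate R) rs1 rs2 (q : amp R) :
  size rs1 = arity u1 -> size rs2 = arity u2 -> ~~ has (mem rs1) rs2 ->
  agate u1 rs1 (agate u2 rs2 q) = agate u2 rs2 (agate u1 rs1 q).
Proof.
move=> s1 s2 dj; apply: functional_extensionality => b; rewrite /agate.
under eq_bigr do rewrite big_distrr /=.
under [RHS]eq_bigr do rewrite big_distrr /=.
rewrite exchange_big /=; apply: eq_bigr => bs2 _; apply: eq_bigr => bs1 _.
have sb1 : size bs1 = size rs1 by rewrite size_tuple.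
have sb2 : size bs2 = size rs2 by rewrite size_tuple.
have dj' : ~~ has (mem rs2) rs1 by rewrite has_sym.
have -> : [tuple upd b rs1 bs1 (nth 0%N rs2 l) | l < arity u2] = [tuple b (nth 0%N rs2 l) | l < arity u2].
  apply: eq_from_tnth => l; rewrite !tnth_mktuple upd_notin //.
  by move/hasPn: dj; apply; rewrite mem_nth // s2.
have -> : [tuple upd b rs2 bs2 (nth 0%N rs1 l) | l < arity u1] = [tuple b (nth 0%N rs1 l) | l < arity u1].
  apply: eq_from_tnth => l; rewrite !tnth_mktuple upd_notin //.
  by move/hasPn: dj'; apply; rewrite mem_nth // s1.
by rewrite upd_comm // mulrCA.
Qed.

Lemma atens_gate (R : realType) (u : qgate R) rs r c (q : amp R) :
  size rs = arity u -> r \notin rs ->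
  atens r c (agate u rs q) = agate u rs (atens r c q).
Proof.
move=> sz rr; apply: functional_extensionality => b; rewrite /atens /agate.
have e bs : size bs = size rs -> upd b rs bs r = b r by move=> h; apply: upd_notin.
case: ifP => brc.
  by apply: eq_bigr => bs _; rewrite e ?brc // size_tuple.
by rewrite big1 // => bs _; rewrite e ?brc ?mulr0 // size_tuple.
Qed.

Lemma atens_comm (R : realType) r1 c1 r2 c2 (q : amp R) :
  atens r1 c1 (atens r2 c2 q) = atens r2 c2 (atens r1 c1 q).
Proof.
by apply: functional_extensionality => b; rewrite /atens; case: (b r1 == c1); case: (b r2 == c2).
Qed.

Lemma supported_tens (R : realType) V r c (q : amp R) :
  supported V q -> supported (r |` V) (atens r c q).
Proof.
move=> h b b' e; rewrite /atens e ?inE ?eqxx // (h b b') // => v vV.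
by apply: e; rewrite !inE vV orbT.
Qed.

Lemma supported_gate (R : realType) V (u : qgate R) rs (q : amp R) :
  size rs = arity u -> {subset rs <= V} -> supported V q -> supported V (agate u rs q).
Proof.
move=> sz sub h b b' e; rewrite /agate; apply: eq_bigr => bs _; congr (_ * _)%R.
  congr (gmat _ (bits_ord _) _); apply: eq_from_tnth => l; rewrite !tnth_mktuple e //.
  by apply/sub/mem_nth; rewrite sz.
by apply: h => v vV; rewrite /upd e.
Qed.

(** * Abstract configurations *)

Record acfg (R : realType) := ACfg { aV : {fset nat}; aq : amp R; atm : term }.

Inductive act (R : realType) (U : nat -> qgate R) :
  label -> {fset nat} -> amp R -> {fset nat} -> amp R -> Prop :=
| act_tau V q : act U LTau V q V q
| act_new V q c r : r \notin V -> act U (LNew c r) V q (r |` V) (atens r c q)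
| act_gate V q i rs : size rs = arity (U i) -> act U (LGate i rs) V q V (agate (U i) rs q).

Definition ar (R : realType) (U : nat -> qgate R) (i : nat) : nat := arity (U i).

Definition astep (R : realType) (U : nat -> qgate R) (cm dp : bool) (C D : acfg R) : Prop :=
  exists2 l, tstep (ar U) cm dp l (atm C) (atm D) & act U l (aV C) (aq C) (aV D) (aq D).

Definition aequiv (R : realType) (C D : acfg R) : Prop :=
  exists s : nat -> nat, [/\ bijective s, aV D = s @` aV C,
    atm D = rename_qvars s (atm C) & forall b, aq D b = aq C (b \o s)].

Definition ainv (R : realType) (C : acfg R) : Prop :=
  [/\ lin (atm C), uniq (qvars (atm C)), {subset qvars (atm C) <= aV C} & supported (aV C) (aq C)].

Lemma rename_qvars_comp s t M : rename_qvars s (rename_qvars t M) = rename_qvars (s \o t) M.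
Proof.
elim/term_nested_ind: M => //=.
- by move=> M ->.
- by move=> M ->.
- by move=> M N -> ->.
- by move=> Ms IH; congr Tup; rewrite -map_comp; apply: map_ext_Forall.
- by move=> M ->.
- by move=> p M ->.
Qed.

Lemma aequiv_refl (R : realType) (C : acfg R) : aequiv C C.
Proof.
exists id; split=> //; first by exists id.
  by apply/fsetP => x; apply/idP/imfsetP => [h|[y /= h ->]] //; exists x.
by rewrite rename_qvars_id.
Qed.

Lemma aequiv_trans (R : realType) (C D E : acfg R) : aequiv C D -> aequiv D E -> aequiv C E.
Proof.
move=> [s [bs Vs ts qs]] [t [bt Vt tt qt]]; exists (t \o s); split.
- exact: bij_comp.
- by rewrite Vt Vs -imfset_comp.
- by rewrite tt ts rename_qvars_comp.
- by move=> b; rewrite qt qs.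
Qed.

Lemma aequiv_sym (R : realType) (C D : acfg R) : aequiv C D -> aequiv D C.
Proof.
move=> [s [[t st ts] Vs tms qs]]; exists t; split.
- by exists s.
- rewrite Vs -imfset_comp; apply/fsetP => x; apply/idP/imfsetP => [h|[y /= h ->]].
    by exists x => //=; rewrite st.
  by rewrite st.
- by rewrite tms rename_qvars_comp rename_qvars_id // => x _; apply: st.
- move=> b; rewrite qs; congr (aq C _); apply: functional_extensionality => x /=.
  by rewrite st.
Qed.

Lemma rename_qvars_rename s t M : rename_qvars s (rename t M) = rename t (rename_qvars s M).
Proof.
elim/term_nested_ind: M t => //=.
- by move=> M IH t; rewrite IH.
- by move=> M IH t; rewrite IH.
- by move=> M N IHM IHN t; rewrite IHM IHN.
- move=> Ms IH t; congr Tup; rewrite -!map_comp; apply: map_ext_Forall.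
  by apply: List.Forall_impl IH => M /= ->.
- by move=> M IH t; rewrite IH.
- by move=> p M IH t; rewrite IH.
Qed.

Lemma rename_qvars_up s k t :
  rename_qvars s \o up_sub k t = up_sub k (rename_qvars s \o t).
Proof.
apply: functional_extensionality => i /=; rewrite /up_sub; case: ifP => //= _.
exact: rename_qvars_rename.
Qed.

Lemma rename_qvars_subst s t M :
  rename_qvars s (subst t M) = subst (rename_qvars s \o t) (rename_qvars s M).
Proof.
elim/term_nested_ind: M t => //=.
- by move=> M IH t; rewrite IH.
- by move=> M IH t; rewrite IH.
- by move=> M N IHM IHN t; rewrite IHM IHN.
- move=> Ms IH t; congr Tup; rewrite -!map_comp; apply: map_ext_Forall.
  by apply: List.Forall_impl IH => M /= ->.
- by move=> M IH t; rewrite IH rename_qvars_up.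
- by move=> p M IH t; rewrite IH rename_qvars_up.
Qed.

Lemma rename_qvars_inst s Ns M :
  rename_qvars s (inst Ns M) = inst (map (rename_qvars s) Ns) (rename_qvars s M).
Proof.
rewrite !instE rename_qvars_subst; congr subst.
apply: functional_extensionality => i /=; rewrite /inst_sub size_map.
case: (ltnP i (size Ns)) => h; first by rewrite (nth_map (Var (i - size Ns))).
by rewrite !nth_default ?size_map.
Qed.

Definition rename_label (s : nat -> nat) (l : label) : label :=
  match l with
  | LTau => LTau
  | LNew c r => LNew c (s r)
  | LGate i rs => LGate i (map s rs)
  end.

Lemma rename_qtuple s rs : rename_qvars s (qtuple rs) = qtuple (map s rs).
Proof. by case: rs => [|r [|r' rs]] //=; rewrite -!map_comp. Qed.

Lemma tstep_rename_qvars ar cm dp l M M' s :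
  tstep ar cm dp l M M' ->
  tstep ar cm dp (rename_label s l) (rename_qvars s M) (rename_qvars s M').
Proof.
elim=> {l M M'} /=.
- by move=> i rs h; rewrite rename_qtuple; constructor; rewrite size_map.
- by constructor.
- move=> M N h; rewrite rename_qvars_inst; constructor.
  by case/orP: h => [->//|]; case: N => //= *; rewrite orbT.
- move=> M rs; rewrite rename_qvars_inst.
  have -> : map (rename_qvars s) (map QVar rs) = map QVar (map s rs) by rewrite -!map_comp.
  by rewrite -[size rs](size_map s); constructor.
- by move=> M N; rewrite rename_qvars_inst; constructor.
- by move=> L p M N h; rewrite rename_qvars_rename; constructor.
- by move=> L p M N h; rewrite rename_qvars_rename; constructor.
- by move=> l M M' Ms1 Ms2 _ IH; rewrite !map_cat /=; constructor.
- by constructor.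
- by constructor.
- by constructor.
- by constructor.
- by constructor.
Qed.

Lemma agate_rename (R : realType) (u : qgate R) rs (q : amp R) s b : injective s ->
  size rs = arity u ->
  agate u (map s rs) (fun b => q (b \o s)) b = agate u rs q (b \o s).
Proof.
move=> sI sz; rewrite /agate; apply: eq_bigr => bs _; congr (_ * q _)%R.
  congr (gmat _ (bits_ord _) _); apply: eq_from_tnth => l.
  by rewrite !tnth_mktuple /= (nth_map 0%N) // sz.
by apply: functional_extensionality => v; rewrite /upd /= index_map.
Qed.

Lemma astep_equiv (R : realType) (U : nat -> qgate R) cm dp (C C' D : acfg R) :
  aequiv C C' -> astep U cm dp C D -> exists2 D', astep U cm dp C' D' & aequiv D D'.
Proof.
case: C C' D => [V q M] [V' q' M'] [W p N] [s [/= bs Vs ts qs]] [l /= st ac].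
have sI := bij_inj bs.
have st' := tstep_rename_qvars s st; rewrite -ts in st'.
have eq' : q' = fun b => q (b \o s) by apply: functional_extensionality.
subst V' M' q'; inversion ac; subst.
- exists (ACfg (s @` W) (fun b => p (b \o s)) (rename_qvars s N)); last by exists s.
  by exists LTau; last by constructor.
- exists (ACfg (s r |` s @` V) (atens (s r) c (fun b => q (b \o s))) (rename_qvars s N)).
    exists (LNew c (s r)) => //=; constructor.
    by apply/imfsetP => -[x /= xV /sI e]; rewrite -e (negbTE H) in xV.
  by exists s; split=> //=; rewrite imfsetU1.
- exists (ACfg (s @` W) (agate (U i) (map s rs) (fun b => q (b \o s))) (rename_qvars s N)).
    by exists (LGate i (map s rs)) => //=; constructor; rewrite size_map.
  by exists s; split=> //= b; apply: agate_rename.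
Qed.

Lemma uniq_countP (s : seq nat) : (forall r, count_mem r s <= 1) -> uniq s.
Proof.
elim: s => //= x s IH h; rewrite IH ?andbT => [|r]; last by have := h r; rewrite /=; lia.
by apply/count_memPn; have := h x; rewrite /= eqxx; lia.
Qed.

Lemma ainv_step (R : realType) (U : nat -> qgate R) cm dp (C D : acfg R) :
  astep U cm dp C D -> ainv C -> ainv D.
Proof.
case: C D => [V q M] [W p N] [l /= st ac] [/= lM uM sub sup].
have [lN _ _ cnt] := tstep_pres st lM.
have lq := tstep_label_qvars st.
have mem r : (r \in qvars N) = (r \in qvars M) || (0 < new_count l r).
  by rewrite -!has_pred1 !has_count cnt; case: (count _ _) (new_count _ _) => [|n] [|k].
have uN : uniq (qvars N).
  apply: uniq_countP => r; rewrite cnt (count_uniq_mem _ uM).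
  case: l ac {st cnt lq mem} => [|c r'|i rs] ac /=; rewrite ?addn0 ?leq_b1 //.
  have rV : r' \notin V by inversion ac.
  case: eqP => [->|_]; last by rewrite addn0 leq_b1.
  by case: (boolP (r' \in qvars M)) => // /sub h; rewrite h in rV.
split=> //=.
  move=> r; rewrite mem; inversion ac; subst; rewrite /= ?orbF; try exact: sub.
  by rewrite in_fset1U; case/orP => [/sub ->|]; rewrite ?orbT //; case: (_ == _).
inversion ac; subst => //; first exact: supported_tens.
by apply: supported_gate => // x /lq /sub.
Qed.

(* [act] leaves new names to be chosen; two reductions of the same
   configuration commute only if they choose different ones. *)
Definition names_differ (l1 l2 : label) : bool :=
  if (l1, l2) is (LNew _ r1, LNew _ r2) then r1 != r2 else true.

(** Gates on disjoint wires commute, and a fresh qubit lies outside the wires of every gate on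
    [V]. *)
Lemma act_comm (R : realType) (U : nat -> qgate R) l1 l2 V q V1 q1 V2 q2 :
  act U l1 V q V1 q1 -> act U l2 V q V2 q2 ->
  {subset label_qvars l1 <= V} -> {subset label_qvars l2 <= V} ->
  ~~ has (mem (label_qvars l1)) (label_qvars l2) -> names_differ l1 l2 ->
  exists V3 q3, act U l2 V1 q1 V3 q3 /\ act U l1 V2 q2 V3 q3.
Proof.
move=> a1 a2; inversion a1; subst; inversion a2; subst => /= sub1 sub2 dj nd.
- by exists V2, q2; split; constructor.
- by eexists; eexists; split; constructor.
- by eexists; eexists; split; constructor.
- by eexists; eexists; split; constructor.
- exists (r |` (r0 |` V)), (atens r c (atens r0 c0 q)); split; last first.
    by apply: act_new; rewrite in_fset1U negb_or H andbT; exact: nd.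
  rewrite fsetUCA atens_comm; apply: act_new.
  by rewrite in_fset1U negb_or H0 andbT eq_sym; exact: nd.
- do 2 eexists; split; last by apply: act_new.
  rewrite atens_gate //; first by constructor.
  by apply/negP => /sub2; rewrite (negbTE H).
- by eexists; eexists; split; constructor.
- do 2 eexists; split; first by apply: act_new.
  rewrite atens_gate //; first by constructor.
  by apply/negP => /sub1; rewrite (negbTE H0).
- do 2 eexists; split; first by apply: act_gate.
  by rewrite -agate_comm //; apply: act_gate.
Qed.

(** A step is parametric in the name that it creates. Nothing is asked of [s] beyond the qubits of
    [M] and [r], so that a transposition of the two names can be used. *)
Lemma tstep_relabel ar cm dp c r l M M' : tstep ar cm dp l M M' -> l = LNew c r ->
  forall r', exists2 M2, tstep ar cm dp (LNew c r') M M2 &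
    forall s, {in qvars M, s =1 id} -> s r = r' -> M2 = rename_qvars s M'.
Proof.
elim=> {l M M'} //=.
- by move=> c' r0 [-> ->] r'; exists (QVar r'); [constructor|move=> s _ /= ->].
- move=> l M M' Ms1 Ms2 _ IH e r'; have [M2 st h] := IH e r'.
  exists (Tup (Ms1 ++ M2 :: Ms2)); first by constructor.
  move=> s; rewrite map_cat flatten_cat /= map_cat => hs sr /=; rewrite (h s) //; last first.
    by move=> x hx; apply: hs; rewrite !mem_cat hx orbT.
  have fixed Ns : {in flatten (map qvars Ns), s =1 id} -> map (rename_qvars s) Ns = Ns.
    elim: Ns => //= B Ns IHN sub; rewrite IHN ?rename_qvars_id // => x hx;
      by apply: sub; rewrite mem_cat hx ?orbT.
  by rewrite !fixed // => x hx; apply: hs; rewrite !mem_cat hx ?orbT.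
- move=> l M M' N _ IH e r'; have [M2 st h] := IH e r'; exists (App M2 N); first by constructor.
  move=> s hs sr /=; rewrite (h s) ?(@rename_qvars_id s N) // => x hx;
    by apply: hs; rewrite mem_cat hx ?orbT.
- move=> l M M' N _ IH e r'; have [M2 st h] := IH e r'; exists (App N M2); first by constructor.
  move=> s hs sr /=; rewrite (h s) ?(@rename_qvars_id s N) // => x hx;
    by apply: hs; rewrite mem_cat hx ?orbT.
- move=> l p M M' _ IH e r'; have [M2 st h] := IH e r'; exists (Lam p M2); first by constructor.
  by move=> s hs sr /=; rewrite (h s).
- move=> l M M' d _ IH e r'; have [M2 st h] := IH e r'; exists (LamB M2); first by constructor.
  by move=> s hs sr /=; rewrite (h s).
- move=> l M M' d _ IH e r'; have [M2 st h] := IH e r'; exists (New M2); first by constructor.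
  by move=> s hs sr /=; rewrite (h s).
Qed.

Definition swap (r1 r2 x : nat) : nat := if x == r1 then r2 else if x == r2 then r1 else x.

Lemma swapK r1 r2 : involutive (swap r1 r2).
Proof.
move=> x; rewrite /swap; case: (x =P r1) => [->|n1].
  by rewrite eqxx; case: (r2 =P r1) => [->|].
case: (x =P r2) => [->|n2]; first by rewrite eqxx.
by rewrite (introF eqP n1) (introF eqP n2).
Qed.

(** The transposition of [r1] and [r2] fixes [V], on which alone [q] depends. *)
Lemma aequiv_new (R : realType) V (q : amp R) M1 M2 c r1 r2 :
  supported V q -> r1 \notin V -> r2 \notin V ->
  (forall s, {in V, s =1 id} -> s r1 = r2 -> M2 = rename_qvars s M1) ->
  aequiv (ACfg (r1 |` V) (atens r1 c q) M1) (ACfg (r2 |` V) (atens r2 c q) M2).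
Proof.
move=> sup h1 h2 h; exists (swap r1 r2).
have fx : {in V, swap r1 r2 =1 id}.
  move=> x xV; rewrite /swap; case: eqP => [e|_]; first by rewrite -e xV in h1.
  by case: eqP => [e|_] //; rewrite -e xV in h2.
have sr : swap r1 r2 r1 = r2 by rewrite /swap eqxx.
split=> /=.
- by exists (swap r1 r2); apply: swapK.
- rewrite imfsetU1 sr; congr (_ |` _); apply/fsetP => x; apply/idP/imfsetP.
    by move=> xV; exists x; rewrite //= fx.
  by case=> y /= yV ->; rewrite fx.
- exact: h.
- move=> b; rewrite /atens /= sr (sup b (b \o swap r1 r2)) // => v vV /=.
  by rewrite fx.
Qed.

Lemma act_inj (R : realType) (U : nat -> qgate R) l V q V1 q1 V2 q2 :
  act U l V q V1 q1 -> act U l V q V2 q2 -> V1 = V2 /\ q1 = q2.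
Proof. by move=> a1 a2; inversion a1; subst; inversion a2; subst. Qed.

Lemma fresh_name (V : {fset nat}) r1 : exists2 r, r \notin V & r1 != r.
Proof.
have bnd (s : seq nat) x : x \in s -> x <= sumn s.
  elim: s => //= y s IH; rewrite inE => /orP[/eqP ->|/IH]; lia.
(* Every member of a set is at most the sum of its members, so a number above the sum is fresh. *)
exists (sumn V + r1).+1; last by rewrite neq_ltn; apply/orP; left; lia.
by apply/negP => /bnd; lia.
Qed.

(** Replacing the second result within its class avoids a clash of fresh names: if both steps create
    a qubit, [act_comm] needs different names. *)
Lemma astep_relabel (R : realType) (U : nat -> qgate R) cm dp l1 (C E : acfg R) :
  ainv C -> astep U cm dp C E -> exists l2 E',
  [/\ tstep (ar U) cm dp l2 (atm C) (atm E'), act U l2 (aV C) (aq C) (aV E') (aq E'),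
      names_differ l1 l2 & aequiv E E'].
Proof.
case: C E => [V q M] [W p N] [/= lM uM sub sup] [l /= st ac].
case: l st ac => [|c r|i rs] st ac.
- by exists LTau, (ACfg W p N); split=> //; [case: l1|exact: aequiv_refl].
- have [r' r'V nd] : exists2 r', r' \notin V & names_differ l1 (LNew c r').
    by case: l1 => [|c1 r1|i rs]; [|exact: fresh_name|]; have [x ? _] := fresh_name V 0; exists x.
  have [N2 st2 h] := tstep_relabel st erefl r'.
  exists (LNew c r'), (ACfg (r' |` V) (atens r' c q) N2); split=> //=; first by constructor.
  inversion ac; subst; apply: aequiv_new => // s hs.
  by apply: h => x /sub /hs.
- by exists (LGate i rs), (ACfg W p N); split=> //; [case: l1|exact: aequiv_refl].
Qed.

Lemma astep_diamond (R : realType) (U : nat -> qgate R) (C D E : acfg R) :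
  ainv C -> astep U false true C D -> astep U true true C E ->
  aequiv D E \/
  exists E' F, [/\ aequiv E E', astep U false true E' F \/ E' = F & astep U true true D F \/ D = F].
Proof.
move=> invC [l1 st1 a1] stE; have [l2 [E' [st2 a2 nd eqE]]] := astep_relabel l1 invC stE.
case: C D E' invC st1 a1 st2 a2 eqE {stE} => [V q M] [V1 q1 M1] [V2 q2 M2] /=.
move=> [/= lM uM sub sup] st1 a1 st2 a2 eqE.
have [[el eM]|[c [r1 [r2 [e1 e2 h]]]]|[dj [M3 [h1 h2]]]] := tstep_diamond st1 st2 lM uM.
- left; apply: aequiv_trans (aequiv_sym eqE); subst.
  by have [-> ->] := act_inj a1 a2; apply: aequiv_refl.
- left; apply: aequiv_trans (aequiv_sym eqE); subst.
  inversion a1; subst; inversion a2; subst; apply: aequiv_new => // s hs.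
  by apply: h => x /sub /hs.
- right; have sub1 : {subset label_qvars l1 <= V} by move=> x /(tstep_label_qvars st1)/sub.
  have sub2 : {subset label_qvars l2 <= V} by move=> x /(tstep_label_qvars st2)/sub.
  have [V3 [q3 [b2 b1]]] := act_comm a1 a2 sub1 sub2 dj nd.
  exists (ACfg V2 q2 M2), (ACfg V3 q3 M3); split=> //.
    case: h1 => [h1|[e ->]]; first by left; exists l1.
    by right; subst; inversion b1.
  case: h2 => [h2|[e ->]]; first by left; exists l2.
  by right; subst; inversion b2.
Qed.

(** * Uniqueness of normal forms *)

Inductive areds (R : realType) (U : nat -> qgate R) (cm dp : bool) : nat -> acfg R -> acfg R -> Prop :=
| areds0 C D : aequiv C D -> areds U cm dp 0 C D
| aredsS n C D E : astep U cm dp C D -> areds U cm dp n D E -> areds U cm dp n.+1 C E.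

Lemma areds_equiv (R : realType) (U : nat -> qgate R) cm dp n (C C' D : acfg R) :
  aequiv C C' -> areds U cm dp n C D -> areds U cm dp n C' D.
Proof.
move=> e r; elim: r C' e => {n C D} [C D eCD|n C D E st _ IH] C' e.
  by constructor; apply: aequiv_trans eCD; apply: aequiv_sym.
have [D' st' e'] := astep_equiv e st.
exact: aredsS st' (IH _ e').
Qed.

(** The restricted step at [C] survives each step of the reduction to [E] until an equivalent step
    consumes it. As [E] admits no restricted step, this must happen, and from there [D] follows the
    given reduction. The length [k] is left uncontrolled, since [areds_unique] recurs on the
    restricted path. *)
Lemma areds_strip (R : realType) (U : nat -> qgate R) n (C D E : acfg R) :
  ainv C -> areds U true true n C E -> (forall F, ~ astep U false true E F) ->
  astep U false true C D -> exists k, areds U true true k D E.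
Proof.
move=> inv r; elim: r D inv => {n C E} [C E eCE|n C C1 E st r IH] D inv irr stD.
  by have [D' /irr] := astep_equiv eCE stD.
have [e|[C1' [F [e h1 h2]]]] := astep_diamond inv stD st.
  by exists n; apply: areds_equiv r; apply: aequiv_sym.
have [k rF] : exists k, areds U true true k F E.
  case: h1 => [h1|<-]; last by exists n; apply: areds_equiv r.
  have [C2 st2 e2] := astep_equiv (aequiv_sym e) h1.
  have [k rk] := IH _ (ainv_step st inv) irr st2.
  by exists k; apply: areds_equiv rk; apply: aequiv_sym.
by case: h2 => [h2|->]; [exists k.+1; apply: aredsS rF|exists k].
Qed.

Lemma astep_weaken (R : realType) (U : nat -> qgate R) (cm dp cm' dp' : bool) (C D : acfg R) :
  (cm -> cm') -> (dp -> dp') -> astep U cm dp C D -> astep U cm' dp' C D.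
Proof. by move=> h1 h2 [l st a]; exists l => //; apply: tstep_weaken st. Qed.

(** The arbitrary reduction is stripped along the restricted path. When that path is used up, what
    remains of the reduction starts at a configuration without steps and is therefore empty. *)
Lemma areds_unique (R : realType) (U : nat -> qgate R) m n (C D E : acfg R) :
  ainv C -> areds U false false m C D -> areds U true true n C E ->
  (forall F, ~ astep U true true D F) -> (forall F, ~ astep U true true E F) -> aequiv D E.
Proof.
move=> inv r; elim: r n inv => {m C D} [C D e|m C C1 D st r IH] n inv rE irrD irrE.
  have rE' := areds_equiv e rE.
  by inversion rE'; subst=> //; case: (irrD _ H).
have irrE' F : ~ astep U false true E F by move=> /astep_weaken h; apply: (irrE F); apply: h.
have st1 : astep U false true C C1 by apply: astep_weaken st.
have [k rk] := areds_strip inv rE irrE' st1.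
exact: IH (ainv_step st inv) rk irrD irrE.
Qed.

(** * Concrete and abstract configurations *)

Definition abs (R : realType) (C : config R) : acfg R :=
  ACfg (cqv C) (fun b => creg C [ffun v : cqv C => b (val v)]) (ctm C).

(** [qget f] extends an assignment by [false] outside the register, which makes no difference for a
    supported amplitude. *)
Definition conc (R : realType) (C : acfg R) : config R :=
  @Config R (aV C) [ffun f : {ffun aV C -> bool} => aq C (qget f)] (atm C).

Lemma qget_in (V : {fset nat}) (f : asg V) (v : V) : qget f (val v) = f v.
Proof. by rewrite /qget valK. Qed.

Lemma qgetE (V : {fset nat}) (f : asg V) v (vV : v \in V) : qget f v = f [` vV].
Proof. exact: (qget_in f [` vV]). Qed.

Lemma qget_ffun (V : {fset nat}) (b : nat -> bool) v :
  v \in V -> qget ([ffun x : V => b (val x)] : asg V) v = b v.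
Proof. by move=> vV; rewrite qgetE ffunE. Qed.

Lemma abs_gate (R : realType) n (u : 'M[R[i]]_(2 ^ n)) (rs : n.-tuple nat) V (Q : hilb R V) b :
  {subset rs <= V} ->
  gate_act u rs Q [ffun v : V => b (val v)] =
  agate (Tagged (fun n : nat => 'M[R[i]]_(2 ^ n)) u) rs
    (fun b => Q [ffun v : V => b (val v)]) b.
Proof.
move=> sub; rewrite /gate_act ffunE /agate /=; apply: eq_bigr => bs _; congr (_ * Q _)%R.
  congr (u (bits_ord _) _); apply: eq_from_tnth => l; rewrite tnth_map tnth_mktuple.
  by rewrite qget_ffun ?sub ?mem_tnth // (tnth_nth 0%N).
by apply/ffunP => v; rewrite !ffunE /upd.
Qed.

Lemma abs_new (R : realType) V (Q : hilb R V) r c b :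
  tensor_ket r c Q [ffun v : r |` V => b (val v)] =
  atens r c (fun b => Q [ffun v : V => b (val v)]) b.
Proof.
rewrite /tensor_ket ffunE /atens qget_ffun ?in_fset1U ?eqxx //; case: ifP => // _; congr (Q _).
by apply/ffunP => v; rewrite !ffunE qget_ffun // in_fset1U (valP v) orbT.
Qed.

Lemma step_abs (R : realType) (U : nat -> qgate R) (C D : config R) :
  step U C D -> {subset qvars (ctm C) <= cqv C} -> astep U true false (abs C) (abs D).
Proof.
have tau V (Q : hilb R V) M N : tstep (ar U) true false LTau M N ->
    astep U true false (abs (Config Q M)) (abs (Config Q N)).
  by move=> st; exists LTau => //; constructor.
have ctx V V' (Q : hilb R V) (Q' : hilb R V') M M' (X : term -> term) :
    (forall l, tstep (ar U) true false l M M' -> tstep (ar U) true false l (X M) (X M')) ->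
    astep U true false (abs (Config Q M)) (abs (Config Q' M')) ->
    astep U true false (abs (Config Q (X M))) (abs (Config Q' (X M'))).
  by move=> h [l st a]; exists l => //; apply: h.
elim=> {C D} /=.
- move=> V Q i rs sub; exists (LGate i rs) => /=; first by constructor; rewrite size_tuple.
  have -> : (fun b => gate_act (gmat (U i)) rs Q [ffun v : V => b (val v)]) =
      agate (U i) rs (fun b => Q [ffun v : V => b (val v)]).
    apply: functional_extensionality => b; rewrite abs_gate; first by case: (U i) rs {sub}.
    by move=> x xs; apply: sub; rewrite qvars_qtuple.
  by constructor; rewrite size_tuple.
- move=> V Q c r rV _; exists (LNew c r) => /=; first by constructor.
  have -> : (fun b => tensor_ket r c Q [ffun v : r |` V => b (val v)]) =
      atens r c (fun b => Q [ffun v : V => b (val v)]).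
    by apply: functional_extensionality => b; rewrite abs_new.
  by constructor.
- by move=> V Q M N _; apply: tau; constructor.
- by move=> V Q M rs _; apply: tau; constructor.
- by move=> V Q M N _; apply: tau; constructor.
- by move=> V Q L p M N _; apply: tau; constructor.
- by move=> V Q L p M N _; apply: tau; constructor.
- move=> V V' Q Q' M M' Ms1 Ms2 _ IH sub.
  apply: (ctx _ _ _ _ _ _ (fun A => Tup (Ms1 ++ A :: Ms2))); first by move=> *; constructor.
  by apply: IH => x hx; apply: sub; rewrite map_cat flatten_cat /= !mem_cat hx orbT.
- move=> V V' Q Q' M M' N _ IH sub.
  apply: (ctx _ _ _ _ _ _ (App^~ N)); first by move=> *; constructor.
  by apply: IH => x hx; apply: sub; rewrite mem_cat hx.
- move=> V V' Q Q' M M' N _ IH sub.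
  apply: (ctx _ _ _ _ _ _ (App N)); first by move=> *; constructor.
  by apply: IH => x hx; apply: sub; rewrite mem_cat hx orbT.
- move=> V V' Q Q' p M M' _ IH sub.
  by apply: (ctx _ _ _ _ _ _ (Lam p)); [move=> *; constructor|apply: IH].
Qed.

Lemma config_equiv_abs (R : realType) (C D : config R) :
  config_equiv C D -> aequiv (abs C) (abs D).
Proof.
move=> [s [bs Vs ts qs]]; exists s; split=> //= b; rewrite qs; congr (creg C _).
apply/ffunP => v; rewrite !ffunE qget_ffun // Vs; apply/imfsetP.
by exists (val v) => //; apply: valP.
Qed.

Lemma qfvP M x : (x \in qfv M) = (x \in qvars M).
Proof. by rewrite /qfv; apply/imfsetP/idP => [[y /= h ->]|h] //; exists x. Qed.

Lemma red_abs (R : realType) (U : nat -> qgate R) (C D : config R) : red U C D ->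
  exists2 D', astep U true false (abs C) D' & aequiv D' (abs D).
Proof.
move=> [C' [D' [[/fsubsetP sub _] _ /config_equiv_abs e1 st /config_equiv_abs e2]]].
have {}st : astep U true false (abs C') (abs D').
  by apply: step_abs st _ => x; rewrite -qfvP; apply: sub.
have [D1 st1 e3] := astep_equiv (aequiv_sym e1) st.
by exists D1 => //; apply: aequiv_trans e2; apply: aequiv_sym.
Qed.

Lemma reds_abs (R : realType) (U : nat -> qgate R) (C D : config R) : reds U C D ->
  exists n, areds U true true n (abs C) (abs D).
Proof.
elim=> {C D} [C D /config_equiv_abs e|C D E /red_abs[D' st e] _ [n r]].
  by exists 0; constructor.
exists n.+1; apply: aredsS (areds_equiv (aequiv_sym e) r).
exact: astep_weaken st.
Qed.

Lemma conc_gate (R : realType) (u : qgate R) (rs : (arity u).-tuple nat) V (q : amp R) :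
  {subset rs <= V} -> supported V q ->
  gate_act (gmat u) rs ([ffun f : {ffun V -> bool} => q (qget f)] : hilb R V) =
  [ffun f : {ffun V -> bool} => agate u rs q (qget f)].
Proof.
move=> sub sup; apply/ffunP => f; rewrite !ffunE /agate; apply: eq_bigr => bs _.
rewrite ffunE; congr (_ * _)%R.
  congr (gmat _ (bits_ord _) _); apply: eq_from_tnth => l.
  by rewrite tnth_map tnth_mktuple (tnth_nth 0%N).
by apply: sup => v vV; rewrite !qgetE ffunE /upd qgetE.
Qed.

Lemma conc_new (R : realType) V (q : amp R) r c :
  supported V q ->
  tensor_ket r c ([ffun f : {ffun V -> bool} => q (qget f)] : hilb R V) =
  [ffun f : {ffun r |` V -> bool} => atens r c q (qget f)].
Proof.
move=> sup; apply/ffunP => f; rewrite !ffunE /atens; case: ifP => // _.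
by apply: sup => v vV; rewrite qgetE ffunE.
Qed.

Lemma step_conc (R : realType) (U : nat -> qgate R) (C D : acfg R) :
  astep U true false C D -> {subset qvars (atm C) <= aV C} -> supported (aV C) (aq C) ->
  step U (conc C) (conc D).
Proof.
case: C D => [V q M] [V' q' M'] [l /= st ac]; rewrite /conc /=.
elim: st ac => {l M M'}.
- move=> i rs sz a sub sup; inversion a; subst; rewrite /=.
  have sz' : size rs == arity (U i) by apply/eqP.
  rewrite -(@conc_gate _ (U i) (Tuple sz')) //; last by move=> x xs; apply: sub; rewrite /= qvars_qtuple.
  exact: (@step_gate R U V' _ i (Tuple sz')).
- move=> c r a sub sup; inversion a; subst; rewrite -conc_new //; exact: step_new.
- move=> M N _ a _ _; inversion a; subst; exact: step_lin.
- move=> M rs a _ _; inversion a; subst; exact: step_tup.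
- move=> M N a _ _; inversion a; subst; exact: step_bang.
- move=> L p M N _ a _ _; inversion a; subst; exact: step_comm_l.
- move=> L p M N _ a _ _; inversion a; subst; exact: step_comm_r.
- move=> l M M' Ms1 Ms2 _ IH a sub sup; apply: step_in_tup; apply: IH => // x hx.
  by apply: sub; rewrite /= map_cat flatten_cat /= !mem_cat hx orbT.
- move=> l M M' N _ IH a sub sup; apply: step_in_appl; apply: IH => // x hx.
  by apply: sub; rewrite /= mem_cat hx.
- move=> l M M' N _ IH a sub sup; apply: step_in_appr; apply: IH => // x hx.
  by apply: sub; rewrite /= mem_cat hx orbT.
- by move=> l p M M' _ IH a sub sup; apply: step_in_lam; apply: IH.
- by [].
- by [].
Qed.

Lemma config_equiv_refl (R : realType) (C : config R) : config_equiv C C.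
Proof.
exists id; split=> //; first by exists id.
- by apply/fsetP => x; apply/idP/imfsetP => [h|[y /= h ->]] //; exists x.
- by rewrite rename_qvars_id.
- move=> f; congr (creg C _); apply/ffunP => v; by rewrite ffunE qget_in.
Qed.

Local Close Scope fset_scope.

(** * A sufficient condition for well-formedness *)

Lemma perm_eq_Permutation (A : Type) (f : nat -> A) (s t : seq nat) :
  perm_eq s t -> Permutation.Permutation (map f s) (map f t).
Proof.
elim: s t => [|x s IH] t pst.
  by move: pst; rewrite perm_sym => /perm_nilP ->.
have xt : x \in t by rewrite -(perm_mem pst) mem_head.
case/splitPr: xt pst => t1 t2; rewrite perm_sym perm_catC /= perm_cons perm_catC perm_sym => /IH h.
rewrite map_cat /=; apply: Permutation.Permutation_cons_app.
by move: h; rewrite map_cat.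
Qed.

Lemma Permutation_cat (A : Type) (s s' t t' : seq A) :
  Permutation.Permutation s s' -> Permutation.Permutation t t' ->
  Permutation.Permutation (s ++ t) (s' ++ t').
Proof. exact: Permutation.Permutation_app. Qed.

Lemma Permutation_catCA (A : Type) (s t u : seq A) :
  Permutation.Permutation (s ++ t ++ u) (t ++ s ++ u).
Proof. exact: Permutation.Permutation_app_swap_app. Qed.

Definition mkenv (bs ls qs : seq nat) : env := map EBang bs ++ map ELin ls ++ map EQVar qs.

Lemma mkenv_perm bs ls qs bs' ls' qs' M :
  perm_eq bs bs' -> perm_eq ls ls' -> perm_eq qs qs' ->
  wf (mkenv bs ls qs) M -> wf (mkenv bs' ls' qs') M.
Proof.
move=> h1 h2 h3; apply: wf_exch; apply: Permutation_cat; first exact: perm_eq_Permutation.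
by apply: Permutation_cat; apply: perm_eq_Permutation.
Qed.

Lemma env_vars_mkenv bs ls qs : env_vars (mkenv bs ls qs) = bs ++ ls.
Proof.
rewrite /env_vars /mkenv !map_cat !flatten_cat.
have e1 (s : seq nat) : flatten (map entry_vars (map EBang s)) = s by elim: s => //= x s ->.
have e2 (s : seq nat) : flatten (map entry_vars (map ELin s)) = s by elim: s => //= x s ->.
have e3 (s : seq nat) : flatten (map entry_vars (map EQVar s)) = [::] by elim: s => //= x s ->.
by rewrite e1 e2 e3 cats0.
Qed.

Lemma env_qvars_mkenv bs ls qs : env_qvars (mkenv bs ls qs) = qs.
Proof.
rewrite /env_qvars /mkenv !map_cat !flatten_cat.
have e1 (s : seq nat) : flatten (map entry_qvars (map EBang s)) = [::] by elim: s => //= x s ->.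
have e2 (s : seq nat) : flatten (map entry_qvars (map ELin s)) = [::] by elim: s => //= x s ->.
have e3 (s : seq nat) : flatten (map entry_qvars (map EQVar s)) = s by elim: s => //= x s ->.
by rewrite e1 e2 e3.
Qed.

Lemma Permutation_perm (f : entry -> seq nat) (G G' : env) : Permutation.Permutation G G' ->
  perm_eq (flatten (map f G)) (flatten (map f G')).
Proof.
elim=> {G G'} //=.
- by move=> x G G' _; rewrite perm_cat2l.
- by move=> x y G; rewrite !catA perm_cat2r perm_catC.
- by move=> G1 G2 G3 _ h _; apply: perm_trans.
Qed.

Lemma env_ok_perm (G G' : env) : Permutation.Permutation G G' -> env_ok G' -> env_ok G.
Proof.
move=> p /andP[h1 h2]; apply/andP; split; first by rewrite (perm_uniq (Permutation_perm entry_vars p)).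
by rewrite (perm_uniq (Permutation_perm entry_qvars p)).
Qed.

Lemma env_vars_bang bs G : env_vars (map EBang bs ++ G) = bs ++ env_vars G.
Proof. by rewrite /env_vars; elim: bs => //= b bs ->. Qed.

Lemma wf_weaken bs G M : uniq (bs ++ env_vars G) -> wf G M -> wf (map EBang bs ++ G) M.
Proof.
elim: bs => //= b bs IH /andP[nb u] w; constructor; last exact: IH.
by rewrite env_vars_bang.
Qed.

(** Contracts one copy at a time. The merged variable may keep the name of the original, so
    [merge_vars (s y) y (s y)] renames the copy [y] and nothing else. *)
Lemma wf_contract (s : nat -> nat) ys bs G M :
  uniq (ys ++ bs ++ env_vars G) -> {in ys, forall y, s y \in bs} ->
  wf (map EBang (ys ++ bs) ++ G) M ->
  wf (map EBang bs ++ G) (rename (fun i => if i \in ys then s i else i) M).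
Proof.
elim: ys M => [|y ys IH] M u sb w.
  by rewrite rename_subst (@subst_ext_fv _ Var) ?subst_Var.
have u' : uniq (ys ++ bs ++ env_vars G) by move: u => /= /andP[].
have yb : s y \in bs by apply: sb; rewrite mem_head.
have ub : uniq bs by move: u'; rewrite !cat_uniq => /and3P[_ _ /and3P[]].
have pb : perm_eq bs (s y :: rem (s y) bs) by apply: perm_to_rem.
have w1 : wf (EBang (s y) :: EBang y :: (map EBang (ys ++ rem (s y) bs) ++ G)) M.
  apply: wf_exch w; rewrite -[EBang (s y) :: _]/(map EBang (s y :: y :: ys ++ rem (s y) bs) ++ G).
  apply: Permutation_cat => //; apply: perm_eq_Permutation.
  by apply/permP => f; have /permP/(_ f) := pb; rewrite /= !count_cat => -> /=; lia.
have w2 : wf (EBang (s y) :: (map EBang (ys ++ rem (s y) bs) ++ G)) (rename (merge_vars (s y) y (s y)) M).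
  apply: wf_contr w1; rewrite env_vars_bang -catA.
  have : uniq ((ys ++ bs) ++ env_vars G) by rewrite -catA.
  rewrite -catA !mem_cat !negb_or mem_rem_uniq // inE eqxx /=.
  rewrite !cat_uniq => /and3P[_ /hasPn h1 /and3P[_ /hasPn h2 _]].
  have {}h1 := h1 (s y); rewrite mem_cat yb /= in h1; rewrite h1 //=.
  by apply/negP => /h2; rewrite /= yb.
have w3 : wf (map EBang (ys ++ bs) ++ G) (rename (merge_vars (s y) y (s y)) M).
  apply: wf_exch w2; rewrite -[EBang (s y) :: _]/(map EBang (s y :: ys ++ rem (s y) bs) ++ G).
  apply: Permutation_cat => //; apply: perm_eq_Permutation.
  by apply/permP => f; have /permP/(_ f) := pb; rewrite /= !count_cat => -> /=; lia.
have := IH _ u' _ w3; rewrite rename_rename => /(_ _) h.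
have ysb : s y \notin ys.
  by move: u'; rewrite cat_uniq => /and3P[_ /hasPn h1 _]; apply: h1; rewrite mem_cat yb.
have -> : (fun i => if i \in y :: ys then s i else i) =
    (fun i => if i \in ys then s i else i) \o merge_vars (s y) y (s y).
  apply: functional_extensionality => i /=; rewrite /merge_vars inE.
  case: (i =P y) => [->|_]; first by rewrite orbT (negbTE ysb).
  by case: (i =P s y) => [->|] //=; rewrite (negbTE ysb).
by apply: h => z hz; apply: sb; rewrite inE hz orbT.
Qed.

Lemma Permutation_flatten_mkenv (I : Type) (B L Q : I -> seq nat) (s : seq I) :
  Permutation.Permutation (mkenv (flatten (map B s)) (flatten (map L s)) (flatten (map Q s)))
    (flatten [seq mkenv (B i) (L i) (Q i) | i <- s]).
Proof.
have aux (a1 a2 b1 b2 c1 c2 : env) : Permutation.Permutation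
    ((a1 ++ a2) ++ (b1 ++ b2) ++ (c1 ++ c2)) ((a1 ++ b1 ++ c1) ++ (a2 ++ b2 ++ c2)).
  rewrite -!catA; apply: Permutation_cat => //.
  apply: (Permutation.Permutation_trans (l' := b1 ++ a2 ++ b2 ++ c1 ++ c2)); first exact: Permutation_catCA.
  apply: Permutation_cat => //; have := Permutation_catCA (a2 ++ b2) c1 c2.
  by rewrite -!catA.
elim: s => //= i s IH; rewrite /mkenv !map_cat.
apply: (Permutation.Permutation_trans (aux _ _ _ _ _ _)).
exact: Permutation_cat.
Qed.

Lemma rename_id_fv s M : {in fv M, s =1 id} -> rename s M = M.
Proof.
move=> h; rewrite rename_subst -[RHS]subst_Var; apply: subst_ext_fv => x xM.
by rewrite /= h.
Qed.

Lemma leq_count_flatten (A : Type) (f : A -> seq nat) a x0 (x : nat) s i : a = nth x0 s i ->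
  i < size s -> count_mem x (f a) <= count_mem x (flatten (map f s)).
Proof.
move=> ->; elim: s i => //= y s IH [|i] h; rewrite count_cat ?leq_addr //.
by apply: leq_trans (IH i h) _; rewrite leq_addl.
Qed.

Lemma mem_flatten_nth (A : Type) (f : A -> seq nat) x0 (x : nat) s i :
  i < size s -> x \in f (nth x0 s i) -> x \in flatten (map f s).
Proof.
by elim: s i => //= y s IH [|i] h xi; rewrite mem_cat ?xi // (IH i) ?orbT.
Qed.

(* Each component gets its own fresh copies of the duplicable variables, which
   are contracted at the end. *)
Lemma wf_nary (C : seq term -> term) (Ms : seq term) (bs ls : seq nat) :
  (forall s Ns, size Ns = size Ms -> rename s (C Ns) = C (map (rename s) Ns)) ->
  (forall (Gs : seq env) Ns, size Ns = size Ms -> size Gs = size Ms -> env_ok (flatten Gs) ->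
     (forall i, i < size Ms -> wf (nth [::] Gs i) (nth (Var 0) Ns i)) -> wf (flatten Gs) (C Ns)) ->
  (forall i, i < size Ms -> forall s bs' ls', let N := rename s (nth (Var 0) Ms i) in
     lin N -> uniq (qvars N) -> uniq (bs' ++ ls') -> {subset fv N <= bs' ++ ls'} ->
     {in ls', forall x, linocc x N} -> wf (mkenv bs' ls' (qvars N)) N) ->
  all lin Ms -> uniq (flatten (map qvars Ms)) -> uniq (bs ++ ls) ->
  {subset flatten (map fv Ms) <= bs ++ ls} ->
  {in ls, forall x, count_mem x (flatten (map lfv Ms)) = 1 /\ x \notin flatten (map bfv Ms)} ->
  wf (mkenv bs ls (flatten (map qvars Ms))) (C Ms).
Proof.
move=> renC wfC IH linMs uq ubl sub lo.
(* [K] exceeds every variable. The copy of [x] for component [i] is [x + i.+1 * K]: copies are at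
   least [K], distinct from one another, and give back [x] modulo [K]. *)
set n := size Ms; pose K := (sumn (bs ++ ls)).+1.
have ltK x : x \in bs ++ ls -> x < K.
  rewrite /K; elim: (bs ++ ls) => //= y s IHs; rewrite inE => /orP[/eqP ->|/IHs]; lia.
have /and3P[ub djbl ul] : [&& uniq bs, ~~ has (mem bs) ls & uniq ls] by rewrite -cat_uniq.
have modK i x : (x + i * K) %% K = x %% K by rewrite addnC modnMDl.
have geK x i : K <= x + i.+1 * K by rewrite mulSn addnCA leq_addr.
pose rho i x := if x \in bs then x + i.+1 * K else x.
pose N i := nth (Var 0) Ms i.
pose B i := [seq x + i.+1 * K | x <- bs].
pose L i := [seq x <- ls | x \in lfv (N i)].
pose Q i := qvars (N i).
pose Y := flatten (map B (iota 0 n)).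
have MsE : Ms = [seq N i | i <- iota 0 n] by rewrite /N -/(mkseq _ _) mkseq_nth.
have QE : flatten (map qvars Ms) = flatten (map Q (iota 0 n)).
  by rewrite [in LHS]MsE -map_comp.
have lsb x : x \in ls -> x \notin bs by move/hasPn: djbl => /(_ x).
have fvN i x : i < n -> x \in fv (N i) -> x \in bs \/ x \in ls /\ x \in lfv (N i).
  move=> iN xN; have : x \in flatten (map fv Ms) by apply: mem_flatten_nth iN xN.
  move/sub; rewrite mem_cat => /orP[|xl]; [by left|right; split=> //].
  have [_ xb] := lo x xl; move: xN; rewrite mem_cat => /orP[//|xbN].
  by case/negP: xb; apply: mem_flatten_nth iN xbN.
have cntN i x : i < n -> x \in ls -> count_mem x (lfv (N i)) = (x \in lfv (N i)).
  move=> iN xl; have [c _] := lo x xl.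
  have := @leq_count_flatten _ lfv (N i) (Var 0) x Ms i erefl iN.
  by rewrite c -has_pred1 has_count; case: (count _ _) => [|[|]].
have occN i x : i < n -> x \in ls -> x \in lfv (N i) -> linocc x (N i).
  move=> iN xl xN; have [_ xb] := lo x xl; rewrite /linocc cntN // xN eqxx /=.
  by apply: contra xb => xb; apply: mem_flatten_nth iN xb.
have memB i y : y \in B i -> exists2 x, x \in bs & y = x + i.+1 * K by case/mapP => x xb ->; exists x.
have memY y : y \in Y -> K <= y /\ y %% K \in bs.
  move=> /flatten_mapP[i _ /memB[x xb ->]]; split; first by rewrite mulSn addnCA leq_addr.
  by rewrite modK modn_small ?ltK // mem_cat xb.
have uY : uniq Y.
  rewrite /Y; have -> : flatten (map B (iota 0 n)) = [seq x + i.+1 * K | i <- iota 0 n, x <- bs] by [].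
  apply: allpairs_uniq => //; first exact: iota_uniq.
  move=> [i x] [j y] /allpairsP[[i1 x1] [/= _ x1b [-> ->]]] /allpairsP[[i2 x2] [/= _ x2b [-> ->]]] /= e.
  have x1K : x1 < K by apply: ltK; rewrite mem_cat x1b.
  have x2K : x2 < K by apply: ltK; rewrite mem_cat x2b.
  have ex : x1 = x2.
    by have := congr1 (modn^~ K) e; rewrite !modK !modn_small.
  move: e; rewrite ex => /addnI /eqP; rewrite eqn_pmul2r // => /eqP [->] //.
have uYbl : uniq (Y ++ bs ++ ls).
  rewrite cat_uniq uY ubl andbT /=; apply/hasPn => x /ltK xK.
  by apply/negP => /memY[]; rewrite leqNgt xK.
pose Gs := [seq mkenv (B i) (L i) (Q i) | i <- iota 0 n].
pose Ns := [seq rename (rho i) (N i) | i <- iota 0 n].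
have sNs : size Ns = size Ms by rewrite size_map size_iota.
(* A linear variable occurs exactly once in all the components together, so it is assigned to
   exactly one of them. *)
have pL : perm_eq (flatten (map L (iota 0 n))) ls.
  apply/allP => x _ /=; apply/eqP; case: (boolP (x \in ls)) => xl; last first.
    rewrite !(count_memPn _) //; apply: contra xl => /flatten_mapP[i _].
    by rewrite mem_filter => /andP[].
  rewrite (count_uniq_mem _ ul) xl; have [c _] := lo x xl; rewrite -[RHS]/1 -c.
  rewrite MsE -map_comp; have : {subset iota 0 n <= gtn n} by move=> i; rewrite mem_iota.
  elim: (iota 0 n) => //= i s IHs si; rewrite !count_cat IHs => [|j js]; last by apply: si; rewrite inE js orbT.
  congr (_ + _); rewrite (count_uniq_mem _ (filter_uniq _ ul)) mem_filter xl andbT.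
  by symmetry; apply: cntN => //; apply: si; rewrite mem_head.
have perm := Permutation_flatten_mkenv B L Q (iota 0 n).
have wfT : wf (flatten Gs) (C Ns).
  apply: wfC => //; first by rewrite size_map size_iota.
    apply: env_ok_perm (Permutation.Permutation_sym perm) _.
    rewrite /env_ok env_vars_mkenv env_qvars_mkenv -QE uq andbT.
    have -> : uniq (Y ++ flatten (map L (iota 0 n))) = uniq (Y ++ ls).
      by apply: perm_uniq; rewrite perm_cat2l.
    rewrite cat_uniq uY ul andbT /=; apply/hasPn => x xl.
    move: uYbl; rewrite cat_uniq => /and3P[_ /hasPn h _]; apply: h.
    by rewrite mem_cat xl orbT.
  move=> i iN; have iNi : i < size (iota 0 n) by rewrite size_iota.
  rewrite /Gs /Ns (nth_map 0) // (nth_map 0) // nth_iota // add0n.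
  rewrite -[Q i](qvars_rename (rho i)); apply: IH => //.
  - by rewrite lin_rename; move/all_nthP: linMs => /(_ (Var 0) i iN).
  - rewrite qvars_rename; move: uq; rewrite -[X in map _ X](cat_take_drop i Ms) map_cat flatten_cat cat_uniq.
    by rewrite (drop_nth (Var 0)) //= cat_uniq => /and3P[_ _ /and3P[]].
  - rewrite cat_uniq filter_uniq // map_inj_uniq ?ub ?andbT /=; last by move=> x y; apply: addIn.
    apply/hasPn => x; rewrite mem_filter => /andP[_ xl]; apply/negP => /memB[y yb e].
    by have := geK y i; rewrite -e leqNgt ltK // mem_cat xl orbT.
  - move=> y; rewrite fv_rename => /mapP[x xN ->]; rewrite /rho mem_cat.
    have [xb|[xl xlN]] := fvN i x iN xN.
      by rewrite xb; apply/orP; left; apply/mapP; exists x.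
    by rewrite (negbTE (lsb _ xl)) mem_filter xl xlN orbT.
  - move=> x; rewrite mem_filter => /andP[xN xl].
    have fx y : y \in fv (N i) -> (rho i y == x) = (y == x).
      move=> yN; rewrite /rho; case: ifP => // yb; apply/eqP/eqP => e.
        by have := geK y i; rewrite e leqNgt ltK // mem_cat xl orbT.
      by case/negP: (lsb _ xl); rewrite -e.
    have /andP[/eqP c b] := occN i x iN xl xN; rewrite /linocc lfv_rename bfv_rename count_map.
    rewrite (eq_in_count (a2 := pred1 x)) ?c ?eqxx /=; last first.
      by move=> y yN /=; apply: fx; rewrite mem_cat yN.
    apply/mapP => -[y yN e]; have := fx y; rewrite mem_cat yN orbT -e eqxx => /(_ isT) /esym/eqP ey.
    by rewrite ey (negbTE b) in yN.
have wf1 : wf (mkenv Y ls (flatten (map qvars Ms))) (C Ns).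
  apply: (@mkenv_perm Y (flatten (map L (iota 0 n))) (flatten (map Q (iota 0 n)))) => //; first by rewrite QE.
  exact: wf_exch (Permutation.Permutation_sym perm) wfT.
have wf2 : wf (map EBang (Y ++ bs) ++ mkenv [::] ls (flatten (map qvars Ms))) (C Ns).
  have : wf (map EBang bs ++ mkenv Y ls (flatten (map qvars Ms))) (C Ns).
    apply: wf_weaken wf1; rewrite env_vars_mkenv.
    by rewrite (perm_uniq (s2 := Y ++ bs ++ ls)) // perm_catCA.
  by apply: wf_exch; rewrite map_cat -catA; apply: Permutation_catCA.
(* Contracting the copies modulo [K] undoes the renamings [rho i]. *)
have := wf_contract (s := modn^~ K) _ _ wf2; rewrite env_vars_mkenv.
move=> /(_ uYbl (fun y h => (memY y h).2)); rewrite renC //.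
suff -> : map (rename (fun i => if i \in Y then i %% K else i)) Ns = Ms by [].
rewrite [RHS]MsE /Ns -map_comp; apply/eq_in_map => i; rewrite mem_iota => iN.
rewrite /= rename_rename; apply: rename_id_fv => x xN /=; rewrite /rho.
have [xb|[xl xlN]] := fvN i x iN xN.
  rewrite xb; have -> : x + i.+1 * K \in Y.
    by apply/flatten_mapP; exists i; rewrite ?mem_iota //; apply/mapP; exists x.
  by rewrite modK modn_small ?ltK // mem_cat xb.
rewrite (negbTE (lsb _ xl)); case: ifP => // /memY[].
by rewrite leqNgt ltK // mem_cat xl orbT.
Qed.

(** [wf_nary] asks for the induction hypothesis on renamed subterms, so the induction of
    [wf_complete] runs on a size that renaming preserves. *)
Fixpoint tsize (M : term) : nat :=
  match M with
  | Bang M | New M | LamB M | Lam _ M => (tsize M).+1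
  | App M N => (tsize M + tsize N).+1
  | Tup Ms => (sumn (map tsize Ms)).+1
  | _ => 0
  end.

Lemma tsize_rename s M : tsize (rename s M) = tsize M.
Proof.
elim/term_nested_ind: M s => //=.
- by move=> M IH s; rewrite IH.
- by move=> M IH s; rewrite IH.
- by move=> M N IHM IHN s; rewrite IHM IHN.
- by move=> Ms IH s; congr _.+1; elim: IH => //= M {}Ms -> _ ->.
- by move=> M IH s; rewrite IH.
- by move=> p M IH s; rewrite IH.
Qed.

Lemma leq_sumn_nth (As : seq term) i :
  i < size As -> tsize (nth (Var 0) As i) <= sumn (map tsize As).
Proof.
elim: As i => //= B As IH [|i] h; first exact: leq_addr.
by apply: leq_trans (IH i h) (leq_addl _ _).
Qed.

Lemma shift_mkenv k bs ls qs :
  shift_env k (mkenv bs ls qs) = mkenv (map (addn k) bs) (map (addn k) ls) qs.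
Proof. by rewrite /shift_env /mkenv !map_cat -!map_comp. Qed.

Lemma mem_fv_Tup x Ms : x \in flatten (map fv Ms) -> x \in fv (Tup Ms).
Proof.
rewrite /fv /= mem_cat; elim: Ms => //= M Ms IH; rewrite !mem_cat.
by case/orP => [/orP[]|/IH/orP[]] ->; rewrite ?orbT.
Qed.

Lemma wf_complete M bs ls : lin M -> uniq (qvars M) -> uniq (bs ++ ls) ->
  {subset fv M <= bs ++ ls} -> {in ls, forall x, linocc x M} ->
  wf (mkenv bs ls (qvars M)) M.
Proof.
move: {2}(tsize M).+1 (ltnSn (tsize M)) => n; elim: n M bs ls => // n IH M bs ls.
have nil_ls (A : term) (l : seq nat) : lfv A = [::] -> {in l, forall x, linocc x A} -> l = [::].
  by case: l => // x l e /(_ x (mem_head _ _)); rewrite /linocc e.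
have under k (l : seq nat) : uniq l -> uniq (iota 0 k ++ map (addn k) l).
  move=> u; rewrite cat_uniq iota_uniq map_inj_uniq ?u ?andbT /=; last by move=> x y; apply: addnI.
  by apply/hasPn => x /mapP[y _ ->]; rewrite /= mem_iota; lia.
have sub_under k (l b c : seq nat) : {subset unbind k b <= l} -> {subset unbind k c <= l} ->
    {subset b ++ c <= iota 0 k ++ map (addn k) l}.
  move=> h1 h2 x hx; rewrite mem_cat mem_iota /=; case: (ltnP x k) => //= kx.
  apply/mapP; exists (x - k); last by rewrite subnKC.
  by move: hx; rewrite mem_cat => /orP[hx|hx]; [apply: h1|apply: h2]; rewrite mem_unbind subnKC.
have occ_under k A (l : seq nat) : {in l, forall x, linocc x (Lam (PTup k) A)} ->
    {in map (addn k) l, forall x, linocc x A}.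
  by move=> h x /mapP[y /h /andP[/= c b] ->]; rewrite /linocc -count_unbind -mem_unbind c b.
case: M => [x|r|A|c|i|A|A1 A2|As|A|p A] /= sz.
- move=> _ _ u sub occ; have ls_x y : y \in ls -> y = x.
    by move=> /occ; rewrite /linocc /= addn0 andbT; case: (x =P y) => //.
  move: (u); rewrite cat_uniq => /and3P[ub _ ul].
  case: (boolP (x \in ls)) => xl.
    have pl : perm_eq [:: x] ls.
      by apply: uniq_perm => // y; rewrite inE; apply/eqP/idP => [->|/ls_x].
    apply: (@mkenv_perm bs [:: x] [::]) => //; apply: wf_weaken; last exact: wf_var.
    rewrite /env_vars /=; move: u; rewrite (perm_uniq (s2 := bs ++ [:: x])) //.
    by rewrite perm_cat2l perm_sym.
  have els : ls = [::] by case: (ls) ls_x xl => // y l h; rewrite (h y) mem_head.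
  rewrite els cats0 in u sub *; have xb : x \in bs by apply: sub; rewrite mem_head.
  have pb := perm_to_rem xb; apply: (@mkenv_perm (x :: rem x bs) [::] [::]) => //.
    by rewrite perm_sym.
  rewrite /mkenv /= cats0; apply: (@wf_exch (map EBang (rem x bs) ++ [:: EBang x])).
    exact: Permutation.Permutation_sym (Permutation.Permutation_cons_append _ _).
  apply: wf_weaken; last by apply/wf_der/wf_var.
  by rewrite /env_vars /= -(perm_uniq (s1 := x :: rem x bs)) -?(perm_uniq pb) // perm_sym cats1 perm_rcons.
- move=> _ _ u sub /(nil_ls (QVar r) _ erefl) e; rewrite e cats0 in u *.
  by apply: wf_weaken; [rewrite cats0|exact: wf_qvar].
- move=> /andP[lA /nilP qA] _ u sub /(nil_ls (Bang A) _ erefl) e; rewrite e cats0 in u sub *.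
  have := IH A bs [::] sz lA; rewrite qA cats0 => /(_ isT u sub) w.
  apply: wf_prom; last exact: w.
  by rewrite /mkenv /= cats0 all_map; apply/allP.
- move=> _ _ u sub /(nil_ls (Bit c) _ erefl) e; rewrite e cats0 in u *.
  by apply: wf_weaken; [rewrite cats0|exact: wf_bit].
- move=> _ _ u sub /(nil_ls (Gate i) _ erefl) e; rewrite e cats0 in u *.
  by apply: wf_weaken; [rewrite cats0|exact: wf_gate].
- by move=> lA uA u sub occ; apply: wf_new; apply: IH.
- move=> /andP[l1 l2] uA u sub occ.
  have := @wf_nary (fun Ns => App (nth (Var 0) Ns 0) (nth (Var 0) Ns 1)) [:: A1; A2] bs ls.
  rewrite /= cats0; apply.
  + by move=> s [|M1 [|M2 []]].
  + by move=> [|G1 [|G2 []]] //= [|M1 [|M2 []]] // _ _; rewrite cats0 => ok h; apply: wf_app => //; [apply: (h 0)|apply: (h 1)].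
  + by move=> [|[|i]] // _ s bs' ls' /= *; apply: IH => //; rewrite tsize_rename; lia.
  + by rewrite l1 l2.
  + by [].
  + by [].
  + move=> x hx; apply: sub; move: hx; rewrite /fv /= cats0 !mem_cat.
    by do !case: (_ \in _).
  + by move=> x /occ /andP[/= /eqP c hb]; rewrite !cats0; split.
- move=> /andP[s2 lA] uA u sub occ; apply: (@wf_nary Tup As) => //.
  + by move=> Gs Ns e1 e2 ok h; apply: wf_tup; rewrite ?e1 ?e2.
  + move=> i iA s bs' ls' /= *; apply: IH => //; rewrite tsize_rename.
    suff : tsize (nth (Var 0) As i) <= sumn (map tsize As) by lia.
    by apply: leq_sumn_nth.
  + by move=> x /mem_fv_Tup/sub.
  + by move=> x /occ /andP[/= /eqP].
- move=> lA uA u sub occ; apply: wf_lamB; rewrite shift_mkenv.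
  apply: (IH A (0 :: map S bs) (map S ls)) => //.
  + by have := under 1 _ u; rewrite map_cat.
  + by have := sub_under 1 (bs ++ ls) (lfv A) (bfv A); rewrite map_cat; apply=> x hx; apply: sub; rewrite /fv /= mem_cat hx ?orbT.
  + exact: (occ_under 1).
- move=> /and3P[lA po oc] uA u sub occ; apply: wf_lam; rewrite shift_mkenv; set k := pat_arity p.
  have w : wf (mkenv (map (addn k) bs) (iota 0 k ++ map (addn k) ls) (qvars A)) A.
    apply: IH => //.
    + by have := under k _ u; rewrite map_cat; rewrite -(perm_uniq (s1 := map (addn k) bs ++ iota 0 k ++ map (addn k) ls)) // perm_catCA.
    + move=> x hx; have := sub_under k (bs ++ ls) (lfv A) (bfv A).
      rewrite map_cat => /(_ _ _ x hx) h; rewrite mem_cat orbC -mem_cat -catA.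
      by have : x \in iota 0 k ++ [seq k + i | i <- bs] ++ [seq k + i | i <- ls];
        [apply: h => y hy; apply: sub; rewrite /fv /= mem_cat hy ?orbT|rewrite !mem_cat; do !case: (_ \in _)].
    + move=> x; rewrite mem_cat => /orP[|]; first by move/allP: oc; apply.
      exact: (occ_under k).
  have {}w : wf (map ELin (iota 0 k) ++ mkenv (map (addn k) bs) (map (addn k) ls) (qvars A)) A.
    apply: wf_exch w; rewrite /mkenv map_cat -catA.
    exact: Permutation_catCA.
  case: p @k po oc w {sub occ sz} => [|m] //= po oc w.
  by apply: wf_pat; rewrite ?size_iota.
Qed.

Lemma wf_term_complete M : lin M -> uniq (qvars M) -> fv M = [::] -> wf_term M.
Proof.
move=> lM uM cM; have := @wf_complete M [::] [::] lM uM isT.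
rewrite cM => /(_ (fun x h => h) (fun x h => match notF (h : false) with end)).
apply: (@mkenv_perm [::] [::] (qvars M) [::] [::] (qfv M)) => //.
by apply: uniq_perm; rewrite ?fset_uniq // => x; rewrite qfvP.
Qed.

Local Open Scope fset_scope.

(** * Evaluation to lists of qubits *)

Lemma fv_nil M : fv M = [::] -> lfv M = [::] /\ bfv M = [::].
Proof. by rewrite /fv; case: (lfv M) => //= ->. Qed.

Lemma fv_App M N : fv M = [::] -> fv N = [::] -> fv (App M N) = [::].
Proof. by move=> /fv_nil[h1 h2] /fv_nil[h3 h4]; rewrite /fv /= h1 h2 h3 h4. Qed.

Lemma fv_tlist Ms : List.Forall (fun M => fv M = [::]) Ms -> fv (tlist Ms) = [::].
Proof.
elim=> //= M {}Ms hM _ IH; rewrite /fv /= !lift_closed //.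
by have [-> ->] := fv_nil hM; have [-> ->] := fv_nil IH.
Qed.

Lemma tlist_cons M Ms : fv M = [::] -> List.Forall (fun M => fv M = [::]) Ms ->
  tlist (M :: Ms) = LamB (LamB (App (App (Var 1) M) (tlist Ms))).
Proof. by move=> h1 h2; rewrite /= !lift_closed // fv_tlist. Qed.

Lemma closed_QVars rs : List.Forall (fun M => fv M = [::]) (map QVar rs).
Proof. by elim: rs => //= r rs IH; constructor. Qed.

Lemma qvars_list rs : qvars (qvar_list rs) = rs.
Proof.
elim: rs => // r rs IH; rewrite /qvar_list map_cons tlist_cons //=; last exact: closed_QVars.
by rewrite -/(qvar_list rs) IH.
Qed.

(** Irreducibility is required in the deep relation, in which uniqueness is proved. Under its two
    binders a nonempty list is a variable applied to a qubit and a shorter list, which leaves no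
    redex. *)
Lemma tstep_qvar_list ar cm dp l rs N : ~ tstep ar cm dp l (qvar_list rs) N.
Proof.
elim: rs l N => [|r rs IH] l N.
  by move=> st; inv st; inv_tstep (LamB (Var 0)); inv_tstep (Var 0).
rewrite /qvar_list map_cons tlist_cons //; last exact: closed_QVars.
rewrite -/(qvar_list rs) => st; inv st.
inv_tstep (LamB (App (App (Var 1) (QVar r)) (qvar_list rs))).
inv_tstep (App (App (Var 1) (QVar r)) (qvar_list rs)).
- by exfalso; match goal with H : _ = qvar_list _ |- _ => move: H end; case: (rs).
- by inv_tstep (App (Var 1) (QVar r)); [inv_tstep (Var 1)|inv_tstep (QVar r)].
- by match goal with H : tstep _ _ _ _ _ _ |- _ => exact: IH H end.
Qed.

(** Restricted paths with literal endpoints. Renaming enters only with [areds], so these paths can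
    be composed and placed in contexts. *)
Inductive gsteps (R : realType) (U : nat -> qgate R) : acfg R -> acfg R -> Prop :=
| gs_refl C : gsteps U C C
| gs_step C D E : astep U false false C D -> gsteps U D E -> gsteps U C E.

Lemma gsteps_trans (R : realType) (U : nat -> qgate R) C D E :
  gsteps U C D -> gsteps U D E -> gsteps U C E.
Proof. by elim=> // {}C C1 {}D st _ IH /IH; apply: gs_step. Qed.

Lemma gsteps_appl (R : realType) (U : nat -> qgate R) V q M V' q' M' N :
  gsteps U (ACfg V q M) (ACfg V' q' M') -> gsteps U (ACfg V q (App M N)) (ACfg V' q' (App M' N)).
Proof.
suff h C D : gsteps U C D -> gsteps U (ACfg (aV C) (aq C) (App (atm C) N)) (ACfg (aV D) (aq D) (App (atm D) N)).
  exact: h.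
elim=> {C D} [C|C D E [l st a] _ IH]; first exact: gs_refl.
by apply: gs_step IH; exists l => //; constructor.
Qed.

Lemma gsteps_appr (R : realType) (U : nat -> qgate R) V q M V' q' M' N :
  gsteps U (ACfg V q M) (ACfg V' q' M') -> gsteps U (ACfg V q (App N M)) (ACfg V' q' (App N M')).
Proof.
suff h C D : gsteps U C D -> gsteps U (ACfg (aV C) (aq C) (App N (atm C))) (ACfg (aV D) (aq D) (App N (atm D))).
  exact: h.
elim=> {C D} [C|C D E [l st a] _ IH]; first exact: gs_refl.
by apply: gs_step IH; exists l => //; constructor.
Qed.

Lemma gsteps_areds (R : realType) (U : nat -> qgate R) C D :
  gsteps U C D -> exists n, areds U false false n C D.
Proof.
elim=> {C D} [C|C D E st _ [n r]]; first by exists 0; constructor; apply: aequiv_refl.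
by exists n.+1; apply: aredsS r.
Qed.

Definition aok (R : realType) (C : acfg R) : Prop := ainv C /\ fv (atm C) = [::].

Lemma aok_wf (R : realType) (C : acfg R) : aok C -> wf_config (conc C).
Proof.
move=> [[lC uC sub _] cC]; split; last exact: wf_term_complete.
by apply/fsubsetP => x; rewrite qfvP; apply: sub.
Qed.

Lemma aok_step (R : realType) (U : nat -> qgate R) cm dp (C D : acfg R) :
  astep U cm dp C D -> aok C -> aok D.
Proof.
move=> st [inv cl]; split; first exact: ainv_step st inv.
case: st inv => l st _ [lC _ _ _]; have [_ _ h _] := tstep_pres st lC.
by case: (fv (atm D)) h => // x s /(_ x (mem_head _ _)); rewrite cl.
Qed.

Lemma gsteps_reds (R : realType) (U : nat -> qgate R) C D :
  gsteps U C D -> aok C -> reds U (conc C) (conc D).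
Proof.
elim=> {C D} [C|C D E st _ IH] okC; first by apply: reds_refl; apply: config_equiv_refl.
have okD := aok_step st okC; apply: reds_step (IH okD).
exists (conc C), (conc D); split; try exact: config_equiv_refl; try exact: aok_wf.
have [[_ _ sub sup] _] := okC; apply: step_conc => //.
exact: astep_weaken st.
Qed.

Lemma closed_bits cs : List.Forall (fun M => fv M = [::]) [seq Bang (Bit c) | c <- cs].
Proof. by elim: cs => //= c cs IH; constructor. Qed.

Lemma fv_bit_list cs : fv (bit_list cs) = [::].
Proof. by rewrite /bit_list /fv /= -/(fv _) fv_tlist //; apply: closed_bits. Qed.

Lemma lin_bit_list cs : lin (bit_list cs) /\ qvars (bit_list cs) = [::].
Proof.
suff [h1 h2] : lin (tlist [seq Bang (Bit c) | c <- cs]) /\ qvars (tlist [seq Bang (Bit c) | c <- cs]) = [::].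
  by rewrite /= h1 h2.
elim: cs => // c cs [IH1 IH2]; rewrite map_cons tlist_cons; last exact: closed_bits.
  by rewrite /= IH1 IH2.
by [].
Qed.

Lemma irreducible_list (R : realType) (U : nat -> qgate R) cm dp V q rs F :
  ~ astep U cm dp (ACfg V q (qvar_list rs)) F.
Proof. by case=> l /= /tstep_qvar_list. Qed.

Lemma qvar_list_rename s rs : rename_qvars s (qvar_list rs) = qvar_list (map s rs).
Proof.
elim: rs => // r rs IH; rewrite map_cons /qvar_list !map_cons !tlist_cons //=; try exact: closed_QVars.
by rewrite -/(qvar_list rs) IH.
Qed.

Lemma qvar_list_inj rs rs' : qvar_list rs = qvar_list rs' -> rs = rs'.
Proof. by move=> e; rewrite -(qvars_list rs) e qvars_list. Qed.

(** One explicit restricted path settles both directions: it is itself an evaluation, and by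
    uniqueness every other evaluation ends in an equivalent configuration. *)
Lemma evaluates_spec (R : realType) (U : nat -> qgate R) M cs m0 V q :
  lin M -> qvars M = [::] -> fv M = [::] ->
  gsteps U (ACfg fset0 (fun=> 1%R) (App M (bit_list cs))) (ACfg V q (qvar_list (iota 1 m0))) ->
  V = qfv (qvar_list (iota 1 m0)) ->
  forall m (Q : hilb R (qfv (qvar_list (iota 1 m)))),
  evaluates U (init_conf R M cs) (conf Q) <->
  m = m0 /\ forall b, Q [ffun v : qfv (qvar_list (iota 1 m)) => b (val v)] = q b.
Proof.
move=> lM qM cM gs eV m Q; subst V.
have [lb qb] := lin_bit_list cs.
have ok0 : aok (ACfg fset0 (fun=> 1%R) (App M (bit_list cs)) : acfg R).
  split; last exact: fv_App cM (fv_bit_list cs).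
  have q0 : qvars (App M (bit_list cs)) = [::].
    by rewrite -[LHS]/(qvars M ++ qvars (bit_list cs)) qM qb.
  split; rewrite -?[lin _]/(lin M && lin (bit_list cs)) ?lM ?lb //.
    by rewrite [qvars _]q0.
  by move=> x; rewrite [qvars _]q0.
have e0 : conc (ACfg fset0 (fun=> 1%R) (App M (bit_list cs))) = init_conf R M cs by [].
have a0 : abs (init_conf R M cs) = ACfg fset0 (fun=> 1%R) (App M (bit_list cs)).
  by rewrite /abs /=; congr ACfg; apply: functional_extensionality => b; rewrite ffunE.
have irr V' q' rs F : ~ astep U true true (ACfg V' q' (qvar_list rs) : acfg R) F.
  exact: (@irreducible_list R U true true V' q' rs F).
have [n ar] := gsteps_areds gs.
have sup : supported (qfv (qvar_list (iota 1 m0))) q.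
  suff h C D : gsteps U C D -> aok C -> aok D by have [[]] := h _ _ gs ok0.
  by elim=> // {}C {}D E st _ IH okC; apply/IH/(aok_step st).
split.
- move=> [rd _]; have [k rk] := reds_abs rd; rewrite a0 in rk.
  have [inv0 _] := ok0.
  have [s [/= bs Vs ts qs]] := areds_unique inv0 ar rk (@irr _ _ _) (@irr _ _ _).
  (* Both results list consecutive qubits from 1 on, so the renaming [s] between them preserves the
     length and fixes every qubit of the register. *)
  move: ts; rewrite qvar_list_rename => /qvar_list_inj e.
  have em : m = m0 by rewrite -(size_iota 1 m) e size_map size_iota.
  subst m; split=> // b; rewrite qs; apply: sup => v; rewrite qfvP qvars_list => vi /=.
  have [i im ->] : exists2 i, i < size (iota 1 m0) & v = nth 0 (iota 1 m0) i.
    by exists (index v (iota 1 m0)); rewrite ?index_mem ?nth_index.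
  by rewrite -[in LHS](nth_map 0 0) // -e.
- move=> [em hQ]; subst m; split; last first.
    by move=> [E rE]; have [D' [l /= /tstep_qvar_list]] := red_abs rE.
  have := gsteps_reds gs ok0; rewrite e0.
  have -> : conc (ACfg (qfv (qvar_list (iota 1 m0))) q (qvar_list (iota 1 m0))) = conf Q => //.
  rewrite /conc /conf /=; congr Config; apply/ffunP => f; rewrite ffunE -hQ.
  by congr (Q _); apply/ffunP => v; rewrite ffunE qget_in.
Qed.

Local Close Scope fset_scope.

(** * Call-by-name programs *)

Fixpoint csub (k : nat) (N M : term) : term :=
  match M with
  | Var x => if Nat.eqb x k then N else Var (if Nat.ltb k x then x.-1 else x)
  | QVar r => QVar r
  | Bit c => Bit c
  | Gate i => Gate i
  | Bang M => Bang (csub k N M)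
  | New M => New (csub k N M)
  | App M1 M2 => App (csub k N M1) (csub k N M2)
  | Tup Ms => Tup (map (csub k N) Ms)
  | LamB M => LamB (csub k.+1 N M)
  | Lam p M => Lam p (csub (Nat.add (pat_arity p) k) N M)
  end.

Definition closed (M : term) : Prop := fv M = [::].

Lemma csub_subst k N M : closed N ->
  csub k N M = subst (fun i => if i == k then N else Var (if k < i then i.-1 else i)) M.
Proof.
move=> cN; have e j k' : up_sub j (fun i => if i == k' then N else Var (if k' < i then i.-1 else i)) =
    (fun i => if i == j + k' then N else Var (if j + k' < i then i.-1 else i)).
  apply: functional_extensionality => i; rewrite /up_sub; case: ltnP => ij.
    have -> : (i == j + k') = false by apply/eqP; lia.
    by have -> : (j + k' < i) = false by lia.
  have -> : (i - j == k') = (i == j + k') by apply/eqP/eqP; lia.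
  case: (i == j + k'); first exact: lift_closed.
  have -> : (k' < i - j) = (j + k' < i) by lia.
  by rewrite /lift /=; case: (ltnP (j + k') i) => h; congr Var; lia.
elim/term_nested_ind: M k => //=.
- move=> x k; have -> : Nat.eqb x k = (x == k) by apply/idP/eqP => /PeanoNat.Nat.eqb_spec.
  by have -> : Nat.ltb k x = (k < x) by apply/idP/idP => [/PeanoNat.Nat.ltb_lt/ssrnat.ltP//|/ssrnat.ltP/PeanoNat.Nat.ltb_lt].
- by move=> M IH k; rewrite IH.
- by move=> M IH k; rewrite IH.
- by move=> M1 M2 IH1 IH2 k; rewrite IH1 IH2.
- move=> Ms IH k; congr Tup; apply: map_ext_Forall.
  by apply: List.Forall_impl IH => M /=.
- by move=> M IH k; rewrite e IH.
- by move=> p M IH k; rewrite e -IH.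
Qed.

Lemma inst_csub N M : closed N -> inst [:: N] M = csub 0 N M.
Proof.
move=> cN; rewrite csub_subst // instE; congr subst.
by apply: functional_extensionality => -[|i] //; rewrite /inst_sub /= nth_nil subn1.
Qed.

Lemma csub_closed k N M : closed M -> csub k N M = M.
Proof.
suff h : {in fv M, forall x, x < k} -> csub k N M = M by move=> cM; apply: h => x; rewrite cM.
have up (j l : nat) (s : seq nat) : {in unbind j s, forall x, x < l} -> {in s, forall x, x < j + l}.
  move=> h x xs; case: (ltnP x j) => jx; first lia.
  by have := h (x - j); rewrite mem_unbind subnKC // => /(_ xs); lia.
elim/term_nested_ind: M k => //=.
- move=> x k /(_ x (mem_head _ _)) xk.
  have -> : Nat.eqb x k = false by apply/PeanoNat.Nat.eqb_neq; lia.
  by have -> : Nat.ltb k x = false by apply/PeanoNat.Nat.ltb_ge; lia.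
- by move=> M IH k h; rewrite IH // => x hx; apply: h; rewrite /fv /= .
- by move=> M IH k h; rewrite IH.
- by move=> M1 M2 IH1 IH2 k h; rewrite IH1 ?IH2 // => x hx; apply: h; move: hx;
    rewrite /fv /= !mem_cat => /orP[] ->; rewrite ?orbT.
- move=> Ms IH k h; congr Tup; move: h; rewrite /fv /=; elim: IH => //= M {}Ms IHM _ IHMs h.
  rewrite IHM ?IHMs // => x hx; apply: h; move: hx; rewrite /fv !mem_cat => /orP[] ->; by rewrite ?orbT.
- move=> M IH k h; rewrite IH // => x; rewrite /fv mem_cat => /orP[] hx; apply: (up 1 k _ _ x hx) => y hy;
    by apply: h; rewrite /fv /= mem_cat hy ?orbT.
- move=> p M IH k h; rewrite IH // => x; rewrite /fv mem_cat => /orP[] hx;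
    apply: (up (pat_arity p) k _ _ x hx) => y hy; by apply: h; rewrite /fv /= mem_cat hy ?orbT.
Qed.

Notation "M @! N" := (App M (Bang N)) (at level 40, left associativity).

(** Silent steps that are available whatever the arities of the gates, so a classical run is proved
    once and holds over every register. *)
Inductive hreds : term -> term -> Prop :=
| hr_refl M : hreds M M
| hr_step M N P : (forall ar, tstep ar false false LTau M N) -> hreds N P -> hreds M P.

Notation "M ==>* N" := (hreds M N) (at level 70).

Lemma hr_trans M N P : M ==>* N -> N ==>* P -> M ==>* P.
Proof. by elim=> // {}M N' {}N st _ IH /IH; apply: hr_step. Qed.

Lemma hr_appl M M' N : M ==>* M' -> App M N ==>* App M' N.
Proof.
elim=> [P|P Q S st _ IH]; first exact: hr_refl.
by apply: hr_step IH => ar; constructor.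
Qed.

Lemma hr_appr M N N' : N ==>* N' -> App M N ==>* App M N'.
Proof.
elim=> [P|P Q S st _ IH]; first exact: hr_refl.
by apply: hr_step IH => ar; constructor.
Qed.

Lemma hr_bang M N : closed N -> LamB M @! N ==>* csub 0 N M.
Proof.
move=> cN; apply: hr_step (hr_refl _) => ar; rewrite -inst_csub //; exact: ts_bang.
Qed.

Lemma hr_lin M N : closed N -> isval N -> App (Lam PVar M) N ==>* csub 0 N M.
Proof.
move=> cN vN; apply: hr_step (hr_refl _) => ar; rewrite -inst_csub //; exact: ts_lin.
Qed.

Lemma hreds_gsteps (R : realType) (U : nat -> qgate R) V q M N :
  M ==>* N -> gsteps U (ACfg V q M) (ACfg V q N).
Proof.
elim=> {M N} [M|M N P st _ IH]; first exact: gs_refl.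
by apply: gs_step IH; exists LTau; [apply: st|constructor].
Qed.

(** * Purity *)

(** A pure term may be put into a box at any depth and is unaffected by substitution. *)
Definition pure (M : term) : Prop :=
  [/\ lfv M = [::], bfv M = [::], lin M & qvars M = [::]].

Lemma pure_closed M : pure M -> closed M.
Proof. by rewrite /closed /fv; case=> -> ->. Qed.

Lemma closed_App M N : closed M -> closed N -> closed (App M N).
Proof. exact: fv_App. Qed.

Lemma closed_Bang M : closed M -> closed (Bang M).
Proof. by move=> h; rewrite /closed /fv /= -/(fv M). Qed.

Lemma closed_New M : closed M -> closed (New M).
Proof. by []. Qed.

Create HintDb closed discriminated.
#[export] Hint Constants Opaque : closed.
#[export] Hint Resolve pure_closed : closed.

Definition below (k : nat) (M : term) : Prop := {in fv M, forall x, x < k}.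

Lemma below_closed M : below 0 M -> closed M.
Proof. by rewrite /below /closed; case: (fv M) => // x s /(_ x (mem_head _ _)). Qed.

Lemma closed_below k M : closed M -> below k M.
Proof. by move=> cM x; rewrite cM. Qed.

Lemma below_Var k x : x < k -> below k (Var x).
Proof. by move=> h y; rewrite /fv inE => /eqP ->. Qed.

Lemma below_App k M N : below k M -> below k N -> below k (App M N).
Proof.
move=> hM hN x; rewrite /fv /= !mem_cat => /orP[]/orP[] h;
  by [apply: hM; rewrite mem_cat h ?orbT | apply: hN; rewrite mem_cat h ?orbT].
Qed.

Lemma below_Bang k M : below k M -> below k (Bang M).
Proof. exact. Qed.

Lemma below_New k M : below k M -> below k (New M).
Proof. exact. Qed.

Lemma below_binder k l (s : seq nat) : {in s, forall x, x < l + k} -> {in unbind l s, forall x, x < k}.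
Proof. by move=> h x; rewrite mem_unbind => /h; rewrite ltn_add2l. Qed.

Lemma below_LamB k M : below k.+1 M -> below k (LamB M).
Proof. by move=> h; rewrite /below /fv /= -unbind_cat; apply: (@below_binder k 1). Qed.

Lemma below_Lam k M : below k.+1 M -> below k (Lam PVar M).
Proof. by move=> h; rewrite /below /fv /= -unbind_cat; apply: (@below_binder k 1). Qed.

Ltac solve_closed :=
  lazymatch goal with
  | |- closed (App _ _) => apply: closed_App; solve_closed
  | |- closed (Bang _) => apply: closed_Bang; solve_closed
  | |- closed (New _) => apply: closed_New; solve_closed
  | |- closed (Bit _) => reflexivity
  | |- closed (QVar _) => reflexivity
  | |- closed (LamB _) => apply: below_closed; solve_below
  | |- closed (Lam _ _) => apply: below_closed; solve_below
  | |- closed _ => solve [auto 6 with closed]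
  end
with solve_below :=
  lazymatch goal with
  | |- below _ (Var _) => apply: below_Var; reflexivity
  | |- below _ (App _ _) => apply: below_App; solve_below
  | |- below _ (Bang _) => apply: below_Bang; solve_below
  | |- below _ (New _) => apply: below_New; solve_below
  | |- below _ (LamB _) => apply: below_LamB; solve_below
  | |- below _ (Lam PVar _) => apply: below_Lam; solve_below
  | |- below _ _ => apply: closed_below; solve_closed
  end.

(* [pure_tac] reduces the purity of an explicit term to that of the closed
   constants in it. *)
Ltac pure_tac :=
  repeat match goal with H : pure _ |- _ =>
    let h1 := fresh in let h2 := fresh in let h3 := fresh in let h4 := fresh in
    destruct H as [h1 h2 h3 h4] end;
  rewrite /pure /= /linocc /=;
  repeat match goal with
    | H : lfv ?M = _ |- _ => rewrite ?H; clear H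
    | H : bfv ?M = _ |- _ => rewrite ?H; clear H
    | H : is_true (lin ?M) |- _ => rewrite ?H; clear H
    | H : qvars ?M = _ |- _ => rewrite ?H; clear H end;
  by [].

Ltac csimpl := cbn [csub Nat.eqb Nat.ltb Nat.leb pat_arity addn Nat.pred predn plus Nat.add];
  repeat (rewrite csub_closed; [|solve_closed]).

Ltac head_step :=
  first [apply: hr_bang; solve_closed
        |apply: hr_lin; [solve_closed|by []]
        |apply: hr_appl; head_step].

Ltac hstep := apply: hr_trans; [head_step|]; csimpl.

(** * Scott numerals, classical lists and the fixed point combinator *)

Definition ZERO : term := LamB (LamB (Var 1)).
Definition SUCC : term := LamB (LamB (LamB (Var 0 @! Var 2))).
Definition CONS : term := LamB (LamB (LamB (LamB (Var 0 @! Var 3 @! Var 2)))).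
(** [ZERO] is also the empty list. The default [ZERO] for the head of an empty list matches the
    convention that missing arguments of a recursive function read as 0. *)
Definition HEAD : term := LamB (Var 0 @! ZERO @! LamB (LamB (Var 1))).
Definition TAIL : term := LamB (Var 0 @! ZERO @! LamB (LamB (Var 0))).

Lemma pure_ZERO : pure ZERO. Proof. by []. Qed.
Lemma pure_SUCC : pure SUCC. Proof. by []. Qed.
Lemma pure_CONS : pure CONS. Proof. by []. Qed.
Lemma pure_HEAD : pure HEAD. Proof. by []. Qed.
Lemma pure_TAIL : pure TAIL. Proof. by []. Qed.
#[export] Hint Resolve pure_ZERO pure_SUCC pure_CONS pure_HEAD pure_TAIL : closed.

(** Curry's combinator. The self-application is boxed and the programs are run without entering
    boxes, so each unfolding waits until [F] calls for it. *)
Definition FIX (F : term) : term :=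
  LamB (F @! (Var 0 @! Var 0)) @! LamB (F @! (Var 0 @! Var 0)).

Lemma pure_FIX F : pure F -> pure (FIX F).
Proof. by move=> h; pure_tac. Qed.
#[export] Hint Resolve pure_FIX : closed.

Lemma hr_FIX F : closed F -> FIX F ==>* F @! FIX F.
Proof.
move=> cF; have cW : closed (LamB (F @! (Var 0 @! Var 0))).
  by have [h1 h2] := fv_nil cF; rewrite /closed /fv /= h1 h2.
apply: hr_trans; first by apply: hr_bang.
csimpl; exact: hr_refl.
Qed.

(** Representation is by behaviour and not by normal form: a suspended computation represents its
    value. Arguments can thus be passed on unevaluated, and a program is correct as soon as it
    reduces to a representative, by [rep_expand]. *)
Fixpoint rep (n : nat) (t : term) : Prop :=
  closed t /\
  match n with
  | 0 => forall a b, closed a -> closed b -> t @! a @! b ==>* a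
  | n'.+1 => exists2 t', rep n' t' & forall a b, closed a -> closed b -> t @! a @! b ==>* b @! t'
  end.

Lemma rep_closed n t : rep n t -> closed t.
Proof. by case: n => [|n] []. Qed.
#[export] Hint Extern 2 (closed _) => (eapply rep_closed; eassumption) : closed.

Lemma rep_expand n t t' : closed t -> t ==>* t' -> rep n t' -> rep n t.
Proof.
move=> ct tt'; case: n => [|n] [ct' h]; split=> //.
  by move=> a b ca cb; apply: hr_trans (h a b ca cb); do 2 apply: hr_appl.
case: h => u ru h; exists u => // a b ca cb.
by apply: hr_trans (h a b ca cb); do 2 apply: hr_appl.
Qed.

Lemma rep_ZERO : rep 0 ZERO.
Proof. by split=> // a b ca cb; do 2 hstep; exact: hr_refl. Qed.

Lemma rep_SUCC n t : rep n t -> rep n.+1 (SUCC @! t).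
Proof.
move=> rt; split; first solve_closed.
by exists t => // a b ca cb; do 3 hstep; exact: hr_refl.
Qed.

(** * Compilation of recursive functions *)

Fixpoint rep_list (xs : seq nat) (t : term) : Prop :=
  closed t /\
  match xs with
  | [::] => forall a b, closed a -> closed b -> t @! a @! b ==>* a
  | x :: xs' => exists u t', [/\ rep x u, rep_list xs' t' &
      forall a b, closed a -> closed b -> t @! a @! b ==>* b @! u @! t']
  end.

Lemma rep_list_closed xs t : rep_list xs t -> closed t.
Proof. by case: xs => [|x xs] []. Qed.
#[export] Hint Extern 2 (closed _) => (eapply rep_list_closed; eassumption) : closed.

Lemma rep_list_nil_elim t a b : rep_list [::] t -> closed a -> closed b -> t @! a @! b ==>* a.
Proof. by case=> _; apply. Qed.

Lemma rep_list_cons_elim x xs t : rep_list (x :: xs) t -> exists u t', [/\ rep x u, rep_list xs t' &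
  forall a b, closed a -> closed b -> t @! a @! b ==>* b @! u @! t'].
Proof. by case. Qed.

Lemma rep_0_elim t a b : rep 0 t -> closed a -> closed b -> t @! a @! b ==>* a.
Proof. by case=> _; apply. Qed.

Lemma rep_S_elim n t : rep n.+1 t -> exists2 t', rep n t' &
  forall a b, closed a -> closed b -> t @! a @! b ==>* b @! t'.
Proof. by case. Qed.

Lemma rep_list_expand xs t t' : closed t -> t ==>* t' -> rep_list xs t' -> rep_list xs t.
Proof.
move=> ct tt'; case: xs => [|x xs] [ct' h]; split=> //.
  by move=> a b ca cb; apply: hr_trans (h a b ca cb); do 2 apply: hr_appl.
case: h => u [s [ru rs h]]; exists u, s; split=> // a b ca cb.
by apply: hr_trans (h a b ca cb); do 2 apply: hr_appl.
Qed.

Lemma rep_list_nil : rep_list [::] ZERO.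
Proof. exact: rep_ZERO. Qed.

Lemma rep_list_cons x xs u t : rep x u -> rep_list xs t -> rep_list (x :: xs) (CONS @! u @! t).
Proof.
move=> ru rt; split; first solve_closed.
by exists u, t; split=> // a b ca cb; do 4 hstep; exact: hr_refl.
Qed.

Lemma rep_list_HEAD xs t : rep_list xs t -> rep (head 0 xs) (HEAD @! t).
Proof.
case: xs => [|x xs] rt.
  apply: rep_expand rep_ZERO; first solve_closed.
  by hstep; apply: rep_list_nil_elim rt _ _; solve_closed.
have [u [t' [ru rt' h]]] := rep_list_cons_elim rt.
apply: rep_expand (ru); first solve_closed.
by hstep; apply: hr_trans; [apply: h; solve_closed|]; do 2 hstep; exact: hr_refl.
Qed.

Lemma rep_list_TAIL xs t : rep_list xs t -> rep_list (behead xs) (TAIL @! t).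
Proof.
case: xs => [|x xs] rt.
  apply: rep_list_expand rep_list_nil; first solve_closed.
  by hstep; apply: rep_list_nil_elim rt _ _; solve_closed.
have [u [t' [ru rt' h]]] := rep_list_cons_elim rt.
apply: rep_list_expand (rt'); first solve_closed.
by hstep; apply: hr_trans; [apply: h; solve_closed|]; do 2 hstep; exact: hr_refl.
Qed.

(** The outermost variable stands for the recursive call supplied by [FIX]. It occurs only in the
    box that is selected for a successor. *)
Definition REC1 (T1 T2 : term) : term :=
  LamB (LamB (HEAD @! Var 0 @! (T1 @! (TAIL @! Var 0)) @!
    LamB (T2 @! (CONS @! Var 0 @!
      (CONS @! (Var 2 @! (CONS @! Var 0 @! (TAIL @! Var 1))) @! (TAIL @! Var 1)))))).

Definition MU1 (T : term) : term :=
  LamB (LamB (LamB (T @! (CONS @! Var 1 @! Var 0) @! Var 1 @!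
    LamB (Var 3 @! (SUCC @! Var 2) @! Var 1)))).

Fixpoint comp (e : rec_code) : term :=
  match e with
  | RZero => LamB ZERO
  | RSucc => LamB (SUCC @! (HEAD @! Var 0))
  | RProj i => LamB (HEAD @! iter i (fun t => TAIL @! t) (Var 0))
  | RComp e es =>
      LamB (comp e @! foldr (fun T acc => CONS @! (T @! Var 0) @! acc) ZERO (map comp es))
  | RRec e1 e2 => FIX (REC1 (comp e1) (comp e2))
  | RMu e => LamB (FIX (MU1 (comp e)) @! ZERO @! Var 0)
  end.

Lemma rec_code_nested_ind (P : rec_code -> Prop) :
  P RZero -> P RSucc -> (forall i, P (RProj i)) ->
  (forall e es, P e -> List.Forall P es -> P (RComp e es)) ->
  (forall e1 e2, P e1 -> P e2 -> P (RRec e1 e2)) -> (forall e, P e -> P (RMu e)) ->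
  forall e, P e.
Proof.
move=> h1 h2 h3 h4 h5 h6; fix IH 1 => -[||i|e es|e1 e2|e].
- exact: h1.
- exact: h2.
- exact: h3.
- by apply: h4 => //; elim: es => [|e' es IHes]; constructor.
- exact: h5.
- exact: h6.
Qed.

Lemma pure_REC1 T1 T2 : pure T1 -> pure T2 -> pure (REC1 T1 T2).
Proof. by move=> h1 h2; pure_tac. Qed.

Lemma pure_MU1 T : pure T -> pure (MU1 T).
Proof. by move=> h1; pure_tac. Qed.

Lemma pure_comp e : pure (comp e).
Proof.
elim/rec_code_nested_ind: e => //=.
- move=> i; have [a1 a2 a3 a4] : let A := iter i (fun t => TAIL @! t) (Var 0) in
    [/\ {subset fv A <= [:: 0]}, True, lin A & qvars A = [::]].
    elim: i => [|i [h1 _ h3 h4]] /=; first by split=> //= x; rewrite /fv.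
    by rewrite h3 h4; split=> // x hx; apply: h1; move: hx; rewrite /fv /=.
  have e1 : unbind 1 (fv (iter i (fun t => TAIL @! t) (Var 0))) = [::].
    case E: (unbind 1 _) => [|x s] //; have : x \in unbind 1 (fv (iter i (fun t => TAIL @! t) (Var 0))).
      by rewrite E mem_head.
    by rewrite mem_unbind => /a1; rewrite inE.
  by rewrite /pure /= a3 a4 /= -/(fv _) e1.
- move=> e es pe pes; set A := foldr _ _ _.
  have [a1 a3 a4] : [/\ {subset fv A <= [:: 0]}, lin A & qvars A = [::]].
    rewrite {}/A; elim: pes => [|e' es' [b1 b2 b3 b4] _ [h1 h3 h4]] /=; first by [].
    rewrite b3 b4 h3 h4; split=> // x; rewrite /fv /= b1 b2 /= inE => /orP[/eqP ->|]; first by [].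
    exact: h1.
  have e1 : unbind 1 (fv A) = [::].
    by case E: (unbind 1 _) => [|x s] //; have : x \in unbind 1 (fv A);
      [rewrite E mem_head|rewrite mem_unbind => /a1; rewrite inE].
  case: pe => b1 b2 b3 b4.
  by rewrite /pure /= b1 b2 b3 b4 a3 a4 /= -/(fv _) e1.
- by move=> e1 e2 h1 h2; apply/pure_FIX/pure_REC1.
- move=> e /pure_MU1/pure_FIX; move: (FIX _) => T h; pure_tac.
Qed.
#[export] Hint Resolve pure_comp pure_REC1 pure_MU1 : closed.

Lemma csub_iter_TAIL k N i t : csub k N (iter i (fun t => TAIL @! t) t) = iter i (fun t => TAIL @! t) (csub k N t).
Proof. by elim: i => //= i ->. Qed.

Lemma rep_list_iter_TAIL i xs t : rep_list xs t -> rep_list (drop i xs) (iter i (fun t => TAIL @! t) t).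
Proof.
move=> rt; elim: i => [|i IH] /=; first by rewrite drop0.
have -> : drop i.+1 xs = behead (drop i xs) by rewrite -drop1 drop_drop add1n.
exact: rep_list_TAIL.
Qed.

(** The induction is on the derivation of the evaluation, which bounds the unfoldings of [FIX];
    nothing is claimed where the function is undefined. *)
Lemma comp_correct e xs n : rec_eval e xs n -> forall t, rep_list xs t -> rep n (comp e @! t).
Proof.
elim=> {e xs n}.
- move=> xs t rt; apply: rep_expand rep_ZERO; first solve_closed.
  by hstep; exact: hr_refl.
- move=> x xs t rt; apply: rep_expand (rep_SUCC (rep_list_HEAD rt)); first solve_closed.
  by hstep; exact: hr_refl.
- move=> i xs t rt; have rd := rep_list_iter_TAIL i rt.
  rewrite -[nth 0 xs i]/(nth 0 xs i) -[i in nth 0 xs i]addn0 -nth_drop nth0.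
  apply: rep_expand (rep_list_HEAD rd); first solve_closed.
  rewrite /=; apply: hr_trans; first by apply: hr_bang; solve_closed.
  by cbn [csub]; rewrite csub_iter_TAIL; csimpl; exact: hr_refl.
- move=> e es xs ys z sz _ IHs _ IH t rt.
  have rys : rep_list ys (foldr (fun T acc => CONS @! (T @! t) @! acc) ZERO (map comp es)).
    elim: ys es sz IHs {IH} => [|y ys IHy] [|e' es] //= sz h; first exact: rep_list_nil.
    by apply: rep_list_cons; [apply: (h 0)|apply: IHy => [|i ie]; [case: sz|apply: (h i.+1)]].
  apply: rep_expand (IH _ rys); first solve_closed.
  rewrite /=; apply: hr_trans; first by apply: hr_bang; solve_closed.
  cbn [csub]; rewrite csub_closed; last solve_closed.
  have -> : csub 0 t (foldr (fun T acc => CONS @! (T @! Var 0) @! acc) ZERO (map comp es)) =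
      foldr (fun T acc => CONS @! (T @! t) @! acc) ZERO (map comp es).
    by elim: (es) => //= e' es' ->; rewrite csub_closed //; solve_closed.
  exact: hr_refl.
- move=> e1 e2 xs y _ IH t rt; have := IH _ (rep_list_TAIL rt) => /= ry.
  have h := rep_list_HEAD rt.
  apply: rep_expand ry; first by solve_closed.
  rewrite /=; apply: hr_trans; first by apply: hr_appl; apply: hr_FIX; solve_closed.
  by do 2 hstep; apply: rep_0_elim h _ _; solve_closed.
- move=> e1 e2 n xs y z _ IH1 _ IH2 t rt /=.
  have [u ru h] := rep_S_elim (rep_list_HEAD rt).
  have r1 := IH1 _ (rep_list_cons ru (rep_list_TAIL rt)); rewrite /= in r1.
  have r2 := IH2 _ (rep_list_cons ru (rep_list_cons r1 (rep_list_TAIL rt))).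
  apply: rep_expand r2; first by solve_closed.
  rewrite /=; apply: hr_trans; first by apply: hr_appl; apply: hr_FIX; solve_closed.
  do 2 hstep; apply: hr_trans; first by apply: h; solve_closed.
  by hstep; exact: hr_refl.
- move=> e n xs w _ IH0 _ IHm t rt /=.
  (* Induction on the distance [m] to the minimum: the search started at [n - m] returns [n]. *)
  have main m u : m <= n -> rep (n - m) u -> rep n (FIX (MU1 (comp e)) @! u @! t).
    elim: m u => [|m IHm'] u mn ru.
      rewrite subn0 in ru; have h := IH0 _ (rep_list_cons ru rt).
      apply: rep_expand (ru); first solve_closed.
      apply: hr_trans; first by do 2 apply: hr_appl; apply: hr_FIX; solve_closed.
      by do 3 hstep; apply: rep_0_elim h _ _; solve_closed.
    have lt : n - m.+1 < n by lia.
    have [v rv h] := rep_S_elim (IHm _ lt _ (rep_list_cons ru rt)).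
    have rs : rep (n - m) (SUCC @! u) by have := rep_SUCC ru; rewrite subnSK.
    apply: rep_expand (IHm' _ (ltnW mn) rs); first solve_closed.
    apply: hr_trans; first by do 2 apply: hr_appl; apply: hr_FIX; solve_closed.
    do 3 hstep; apply: hr_trans; first by apply: h; solve_closed.
    by hstep; exact: hr_refl.
  have r0 : rep (n - n) ZERO by rewrite subnn; apply: rep_ZERO.
  apply: rep_expand (main n _ (leqnn n) r0); first solve_closed.
  by hstep; exact: hr_refl.
Qed.

(** * Linear lists *)

(** Closed entries make the lifts in [tlist] trivial, and values may be passed to linear
    abstractions on the restricted path. *)
Definition elt (M : term) : bool := nilp (fv M) && isval M.

Lemma elt_closed M : elt M -> closed M.
Proof. by case/andP=> /nilP. Qed.

Lemma elt_val M : elt M -> isval M.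
Proof. by case/andP. Qed.
#[export] Hint Resolve elt_closed : closed.

Lemma all_elt_Forall Ms : all elt Ms -> List.Forall (fun M => fv M = [::]) Ms.
Proof. by elim: Ms => //= M Ms IH /andP[/elt_closed h /IH]; constructor. Qed.

Lemma closed_tlist Ms : all elt Ms -> closed (tlist Ms).
Proof. by move/all_elt_Forall/fv_tlist. Qed.
#[export] Hint Extern 2 (closed (tlist _)) => (apply: closed_tlist; assumption) : closed.

Lemma isval_tlist Ms : isval (tlist Ms).
Proof. by case: Ms. Qed.

Ltac solve_val := solve [done | apply: isval_tlist | apply: elt_val; assumption].

Ltac head_by tac := first [tac | apply: hr_appl; head_by tac].

Ltac head_redex :=
  first [apply: hr_bang; solve_closed | apply: hr_lin; [solve_closed|solve_val]].

Ltac lstep := apply: hr_trans; [head_by head_redex|]; csimpl.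

(** The empty list of the calculus selects its second argument, whereas the classical empty list
    [ZERO] selects its first. *)
Definition NILL : term := LamB (LamB (Var 0)).
Definition CONSL : term :=
  Lam PVar (Lam PVar (LamB (LamB (App (App (Var 1) (Var 3)) (Var 2))))).
(* Placeholder for a qubit that has been taken out of a list; the ! lets it be
   discarded when the qubit is put back. *)
Definition HOLE : term := Bang (Bit false).

Lemma pure_NILL : pure NILL. Proof. by []. Qed.
Lemma pure_CONSL : pure CONSL. Proof. by []. Qed.
Lemma pure_HOLE : pure HOLE. Proof. by []. Qed.
#[export] Hint Resolve pure_NILL pure_CONSL pure_HOLE : closed.

Lemma hr_CONSL a Ms : elt a -> all elt Ms ->
  App (App CONSL a) (tlist Ms) ==>* tlist (a :: Ms).
Proof.
move=> ea eMs; rewrite tlist_cons; [|exact: elt_closed|exact: all_elt_Forall].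
by do 2 lstep; exact: hr_refl.
Qed.

Lemma hr_list_elim a Ms K Z : elt a -> all elt Ms -> closed K -> closed Z ->
  tlist (a :: Ms) @! K @! Z ==>* App (App K a) (tlist Ms).
Proof.
move=> ea eMs cK cZ; rewrite tlist_cons; [|exact: elt_closed|exact: all_elt_Forall].
by do 2 lstep; exact: hr_refl.
Qed.

Ltac list_elim := apply: hr_trans; [head_by ltac:(apply: hr_list_elim; first [assumption|solve_closed])|].

(** The entry taken out leaves [HOLE] behind, so all other entries keep their relative positions. In
    the successor case the first entry is linear and cannot be captured by the boxed branch, whence
    it is supplied afterwards as a further argument. [NILL] fills the branches for empty lists,
    which are not reached for a position in range. *)
Definition FRONT1 : term :=
  LamB (LamB (Var 0 @!
    Lam PVar (Var 0 @!
      Lam PVar (Lam PVar (App (App CONSL (Var 1)) (App (App CONSL HOLE) (Var 0)))) @! NILL) @!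
    LamB (Lam PVar (Var 0 @!
      Lam PVar (Lam PVar (App (App (Var 5 @! Var 3) (Var 0) @!
        Lam PVar (Lam PVar (Lam PVar
          (App (App CONSL (Var 2)) (App (App CONSL (Var 0)) (Var 1))))) @! NILL) (Var 1))) @! NILL)))).

Definition FRONT : term := FIX FRONT1.

Lemma pure_FRONT1 : pure FRONT1. Proof. by []. Qed.
Lemma pure_FRONT : pure FRONT. Proof. by []. Qed.
#[export] Hint Resolve pure_FRONT1 pure_FRONT : closed.

Lemma all_set_nth (P : pred term) x Ms p : P x -> all P Ms -> p < size Ms -> all P (set_nth HOLE Ms p x).
Proof.
move=> Px; elim: Ms p => // y Ms IH [|p] /= /andP[Py PMs] h; first by rewrite Px.
by rewrite Py IH.
Qed.

Lemma hr_FRONT p u Ms : rep p u -> all elt Ms -> p < size Ms ->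
  App (FRONT @! u) (tlist Ms) ==>* tlist (nth HOLE Ms p :: set_nth HOLE Ms p HOLE).
Proof.
elim: p u Ms => [|p IH] u [|y Ms] // ru eyMs sz; have /andP[ey eMs] := eyMs;
  (apply: hr_trans; [apply: hr_appl; apply: hr_appl; apply: hr_FIX; solve_closed|]; do 2 lstep).
- apply: hr_trans; [head_by ltac:(apply: (rep_0_elim ru); solve_closed)|].
  lstep; list_elim; do 2 lstep.
  apply: hr_trans; first by apply: hr_appr; apply: hr_CONSL.
  exact: hr_CONSL.
- have [u' ru' h] := rep_S_elim ru.
  apply: hr_trans; [head_by ltac:(apply: h; solve_closed)|].
  do 2 lstep; list_elim; do 2 lstep.
  apply: hr_trans; first by do 3 apply: hr_appl; apply: IH.
  have en : elt (nth HOLE Ms p) by apply/all_nthP.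
  have es : all elt (set_nth HOLE Ms p HOLE) by apply: all_set_nth.
  list_elim; do 3 lstep.
  apply: hr_trans; first by apply: hr_appr; apply: hr_CONSL.
  by apply: hr_CONSL => //; rewrite /= ey.
Qed.

(** The entry overwritten must be [HOLE], because only a boxed placeholder can be discarded, here by
    the inner [LamB]. *)
Definition PUT1 : term :=
  LamB (LamB (Var 0 @!
    Lam PVar (Lam PVar (App (Var 0 @!
      Lam PVar (Lam PVar (Lam PVar
        (App (LamB (App (App CONSL (Var 1)) (Var 2))) (Var 2)))) @! NILL) (Var 1))) @!
    LamB (Lam PVar (Lam PVar (App (Var 0 @!
      Lam PVar (Lam PVar (Lam PVar
        (App (App CONSL (Var 2)) (App (App (Var 7 @! Var 5) (Var 0)) (Var 1))))) @! NILL) (Var 1)))))).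

Definition PUT : term := FIX PUT1.

Lemma pure_PUT1 : pure PUT1. Proof. by []. Qed.
Lemma pure_PUT : pure PUT. Proof. by []. Qed.
#[export] Hint Resolve pure_PUT1 pure_PUT : closed.

Lemma hr_PUT p u y Ms : rep p u -> elt y -> all elt Ms -> p < size Ms -> nth HOLE Ms p = HOLE ->
  App (App (PUT @! u) y) (tlist Ms) ==>* tlist (set_nth HOLE Ms p y).
Proof.
elim: p u y Ms => [|p IH] u y [|z Ms] // ru ey ezMs sz hn; have /andP[ez eMs] := ezMs;
  (apply: hr_trans; [do 3 apply: hr_appl; apply: hr_FIX; solve_closed|]; do 2 lstep).
- apply: hr_trans; [head_by ltac:(apply: (rep_0_elim ru); solve_closed)|].
  do 2 lstep; list_elim; do 3 lstep; have -> : z = HOLE := hn; lstep.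
  exact: hr_CONSL.
- have [u' ru' h] := rep_S_elim ru.
  apply: hr_trans; [head_by ltac:(apply: h; solve_closed)|].
  do 3 lstep; list_elim; do 3 lstep.
  apply: hr_trans; first by apply: hr_appr; apply: IH.
  by apply: hr_CONSL => //; apply: all_set_nth.
Qed.

Definition UNFRONT : term :=
  LamB (Lam PVar (Var 0 @!
    Lam PVar (Lam PVar (App (App (PUT @! Var 3) (Var 1)) (Var 0))) @! NILL)).

Lemma pure_UNFRONT : pure UNFRONT. Proof. by []. Qed.
#[export] Hint Resolve pure_UNFRONT : closed.

Lemma hr_UNFRONT p u y Ms : rep p u -> elt y -> all elt Ms -> p < size Ms -> nth HOLE Ms p = HOLE ->
  App (UNFRONT @! u) (tlist (y :: Ms)) ==>* tlist (set_nth HOLE Ms p y).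
Proof.
move=> ru ey eMs sz hn; have e : all elt (y :: Ms) by rewrite /= ey.
do 2 lstep; list_elim; do 2 lstep; exact: hr_PUT.
Qed.

(** * Gates on lists *)

(** Applies a function to the first [k] entries of a list and then to the remaining list. The
    function may not enter the boxed branch and is carried along as an extra argument. *)
Fixpoint FEED (k : nat) : term :=
  if k is k'.+1 then
    Lam PVar (Lam PVar (App (Var 0 @!
      Lam PVar (Lam PVar (Lam PVar
        (App (App (FEED k') (App (Var 0) (Var 2))) (Var 1)))) @! NILL) (Var 1)))
  else Lam PVar (Lam PVar (App (Var 1) (Var 0))).

Lemma pure_FEED k : pure (FEED k).
Proof. by elim: k => //= k h; pure_tac. Qed.
#[export] Hint Resolve pure_FEED : closed.

Definition lams (n : nat) (B : term) : term := iter n (Lam PVar) B.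

(** The head of [args] belongs to the outermost abstraction of [lams]. Below [d] inner binders its
    index is [d] plus the number of arguments still to come. *)
Fixpoint csubs (d : nat) (args : seq term) (B : term) : term :=
  if args is a :: rest then csubs d rest (csub (d + size rest) a B) else B.

Lemma csub_lams k a n B : csub k a (lams n B) = lams n (csub (n + k) a B).
Proof. by elim: n k => //= n IH k; rewrite IH addnS. Qed.

Lemma closed_csub N M : closed (Lam PVar M) -> closed N -> closed (csub 0 N M).
Proof.
move=> cM cN; rewrite -inst_csub // /closed; case E: (fv _) => [|x s] //.
have : x \in fv (inst [:: N] M) by rewrite E mem_head.
case/fv_inst1 => [h|[_]]; last by rewrite cN.
have : x \in fv (Lam PVar M) by move: h; rewrite /fv /= !mem_cat !mem_unbind add1n.
by rewrite cM.
Qed.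

Lemma hr_FEED0 F Ms : elt F -> all elt Ms -> App (App (FEED 0) F) (tlist Ms) ==>* App F (tlist Ms).
Proof. by move=> eF eMs; rewrite /=; do 2 lstep; exact: hr_refl. Qed.

Lemma hr_FEEDS k F x Ms : elt F -> elt x -> all elt Ms ->
  App (App (FEED k.+1) F) (tlist (x :: Ms)) ==>* App (App (FEED k) (App F x)) (tlist Ms).
Proof.
move=> eF ex eMs; have e : all elt (x :: Ms) by rewrite /= ex.
rewrite [FEED _]/=; do 2 lstep; list_elim; do 3 lstep; exact: hr_refl.
Qed.

Lemma hr_FEED k B xs Ms : all elt xs -> size xs = k -> all elt Ms -> closed (lams k.+1 B) ->
  App (App (FEED k) (lams k.+1 B)) (tlist (xs ++ Ms)) ==>* csubs 0 (rcons xs (tlist Ms)) B.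
Proof.
elim: k B xs => [|k IH] B [|x xs] // h1 h2 h3 h4.
  have e : elt (lams 1 B) by rewrite /elt h4.
  apply: hr_trans; first by apply: hr_FEED0.
  by apply: hr_lin; [exact: closed_tlist|exact: isval_tlist].
have [ex exs] : elt x /\ all elt xs by case/andP: h1.
have {}h2 : size xs = k by case: h2.
have eF : elt (lams k.+2 B) by rewrite /elt h4.
have eL : all elt (xs ++ Ms) by rewrite all_cat exs.
apply: hr_trans; first by apply: hr_FEEDS.
(* The partial application is contracted to a value before it is passed to the linear abstraction of
   [FEED k]. *)
have st : App (lams k.+2 B) x ==>* csub 0 x (lams k.+1 B).
  by apply: hr_lin; [exact: elt_closed|exact: elt_val].
apply: hr_trans; first by apply: hr_appl; apply: hr_appr; apply: st.
rewrite csub_lams.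
apply: hr_trans; first apply: (IH _ xs) => //.
  by rewrite -csub_lams; apply: (closed_csub h4); apply: elt_closed.
by rewrite /= size_rcons h2 add0n addn0; exact: hr_refl.
Qed.

Lemma csubs_App d args M N : csubs d args (App M N) = App (csubs d args M) (csubs d args N).
Proof. by elim: args M N => //= a args IH M N; rewrite IH. Qed.

Lemma csubs_Tup d args Ms : csubs d args (Tup Ms) = Tup (map (csubs d args) Ms).
Proof.
elim: args Ms => [|a args IH] Ms /=; first by rewrite map_id.
by rewrite IH -map_comp.
Qed.

Lemma csubs_Lam d args p M : csubs d args (Lam p M) = Lam p (csubs (pat_arity p + d) args M).
Proof.
elim: args M => //= a args IH M; rewrite IH; congr (Lam _ (csubs _ _ (csub _ _ _))).
exact: addnA.
Qed.

Lemma csubs_closed d args M : closed M -> csubs d args M = M.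
Proof. by move=> cM; elim: args => //= a args IH; rewrite csub_closed. Qed.

Lemma csubs_Var args v : List.Forall closed args -> v < size args ->
  csubs 0 args (Var v) = nth NILL (rev args) v.
Proof.
elim=> //= a {}args ca _ IH h; rewrite rev_cons nth_rcons size_rev add0n.
case: (PeanoNat.Nat.eqb_spec v (size args)) => [->|ne].
  by rewrite ltnn eqxx csubs_closed.
have lt : v < size args by lia.
have -> : Nat.ltb (size args) v = false by apply/PeanoNat.Nat.ltb_ge; lia.
by rewrite lt IH.
Qed.

Definition consb (X : term) (s : seq term) : term :=
  foldr (fun v acc => App (App CONSL v) acc) X s.

Lemma csub_consb j a X s :
  csub j a (consb X (map Var s)) = consb (csub j a X) (map (csub j a) (map Var s)).
Proof. by elim: s => //= v s ->. Qed.

Lemma csub_Var_lt j a v : v < j -> csub j a (Var v) = Var v.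
Proof.
move=> h /=; have -> : Nat.eqb v j = false by apply/PeanoNat.Nat.eqb_neq; lia.
by have -> : Nat.ltb j v = false by apply/PeanoNat.Nat.ltb_ge; lia.
Qed.

(** The indices below [k] are pattern variables and stay. Index [k] is the innermost abstraction of
    [lams], which receives the rest of the list. *)
Lemma csubs_consb k args L :
  csubs k (rcons args L) (consb (Var k) (map Var (iota 0 k))) = consb L (map Var (iota 0 k)).
Proof.
have e j a X : k <= j -> csub j a (consb X (map Var (iota 0 k))) = consb (csub j a X) (map Var (iota 0 k)).
  move=> kj; rewrite csub_consb; congr consb; rewrite -map_comp; apply/eq_in_map => v.
  by rewrite mem_iota => vk /=; apply: csub_Var_lt; lia.
elim: args => [|a args IH] /=; first by rewrite addn0 e //= PeanoNat.Nat.eqb_refl.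
by rewrite e ?leq_addr // csub_Var_lt ?IH // size_rcons addnS ltnS leq_addr.
Qed.

Definition gpat (k : nat) : pattern := if k == 1 then PVar else PTup k.

(** Under the [k.+1] abstractions of [GATE] the entries taken from the list have the indices [k]
    down to 1, and index 0 is the rest of the list. *)
Definition garg (k : nat) : term :=
  if k == 1 then Var 1 else Tup [seq Var (k - j) | j <- iota 0 k].

Definition GBODY (i k : nat) : term :=
  App (Lam (gpat k) (consb (Var k) (map Var (iota 0 k)))) (App (Gate i) (garg k)).

Definition GATE (i k : nat) : term := App (FEED k) (lams k.+1 (GBODY i k)).

Lemma gpat_arity k : pat_arity (gpat k) = k.
Proof. by rewrite /gpat; case: eqP => [->|]. Qed.

Lemma lfv_consb X s : lfv (consb X (map Var s)) = s ++ lfv X.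
Proof. by elim: s => //= v s ->. Qed.

Lemma bfv_consb X s : bfv (consb X (map Var s)) = bfv X.
Proof. by elim: s => //= v s ->. Qed.

Lemma lin_consb X s : lin (consb X (map Var s)) = lin X.
Proof. by elim: s => //= v s ->. Qed.

Lemma qvars_consb X s : qvars (consb X (map Var s)) = qvars X.
Proof. by elim: s => //= v s ->. Qed.

Lemma fv_lams n B : lfv (lams n B) = iter n (unbind 1) (lfv B) /\ bfv (lams n B) = iter n (unbind 1) (bfv B).
Proof. by elim: n => //= n [-> ->]. Qed.

Lemma mem_iter_unbind n s x : (x \in iter n (unbind 1) s) = (n + x \in s).
Proof. by elim: n x => //= n IH x; rewrite mem_unbind IH addnCA addnA. Qed.

Lemma count_iter_unbind n s (x : nat) : count_mem x (iter n (unbind 1) s) = count_mem (n + x) s.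
Proof. by elim: n x => //= n IH x; rewrite count_unbind IH addnCA addnA. Qed.

Lemma lin_lams n B : lin B -> (forall j, j < n -> linocc j B) -> lin (lams n B).
Proof.
move=> lB; elim: n => // n IH h; have [l1 l2] := fv_lams n B.
rewrite -[lin _]/(lin (lams n B) && (linocc 0 (lams n B) && true)) IH => [|j jn]; last by apply: h; lia.
by rewrite andbT /linocc l1 l2 count_iter_unbind mem_iter_unbind addn0; apply: h.
Qed.

Lemma GBODY_facts i k : 0 < k ->
  [/\ lfv (GBODY i k) = 0 :: [seq k - j | j <- iota 0 k], bfv (GBODY i k) = [::],
      lin (GBODY i k) & qvars (GBODY i k) = [::]].
Proof.
move=> k0; have [g1 g2 g3 g4] : [/\ lfv (garg k) = [seq k - j | j <- iota 0 k], bfv (garg k) = [::],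
    lin (garg k) & qvars (garg k) = [::]].
  rewrite /garg; case: (k =P 1) => [->|k1] //; split=> /=.
  - by elim: (iota 0 k) => //= v s ->.
  - by elim: (iota 0 k) => //= v s ->.
  - by rewrite size_map size_iota all_map; apply/andP; split; [lia|apply/allP].
  - by elim: (iota 0 k) => //= v s ->.
rewrite /GBODY /= g1 g2 g3 g4 lfv_consb bfv_consb lin_consb qvars_consb gpat_arity /=; split=> //.
- rewrite unbind_cat; have -> : unbind k (iota 0 k) = [::].
    case E: (unbind k _) => [|x s] //; have : x \in unbind k (iota 0 k) by rewrite E mem_head.
    by rewrite mem_unbind mem_iota; lia.
  by rewrite /unbind /= leqnn /= subnn.
- rewrite andbT; apply/andP; split; first by rewrite /gpat; case: eqP => //= ?; lia.
  apply/allP => j; rewrite mem_iota add0n /= => jk; rewrite /linocc lfv_consb bfv_consb /= andbT.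
  rewrite count_cat /= count_uniq_mem ?iota_uniq // mem_iota jk /=.
  by case: eqP => //; lia.
Qed.

Lemma pure_GATE i k : 0 < k -> pure (GATE i k).
Proof.
move=> k0; have [f1 f2 f3 f4] := pure_FEED k; have [b1 b2 b3 b4] := GBODY_facts i k0.
have [l1 l2] := fv_lams k.+1 (GBODY i k).
have u : uniq (0 :: [seq k - j | j <- iota 0 k]).
  rewrite /= map_inj_in_uniq ?iota_uniq ?andbT; last by move=> x y; rewrite !mem_iota; lia.
  by apply/mapP => -[j]; rewrite mem_iota; lia.
have mem j : (j \in 0 :: [seq k - j | j <- iota 0 k]) = (j < k.+1).
  rewrite inE; apply/orP/idP => [[/eqP ->//|/mapP[x]]|jk]; first by rewrite mem_iota; lia.
  case: j jk => [|j] jk; [by left|right]; apply/mapP; exists (k - j.+1); rewrite ?mem_iota; lia.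
have z : iter k.+1 (unbind 1) (0 :: [seq k - j | j <- iota 0 k]) = [::].
  case E: (iter _ _ _) => [|x s] //.
  have : x \in iter k.+1 (unbind 1) (0 :: [seq k - j | j <- iota 0 k]) by rewrite E mem_head.
  by rewrite mem_iter_unbind mem; lia.
have z0 : iter k.+1 (unbind 1) [::] = [::] by elim: (k.+1) => //= n ->.
rewrite /GATE; split.
- by rewrite -[lfv _]/(lfv (FEED k) ++ lfv (lams k.+1 (GBODY i k))) f1 l1 b1 z.
- by rewrite -[bfv _]/(bfv (FEED k) ++ bfv (lams k.+1 (GBODY i k))) f2 l2 b2 z0.
- rewrite -[lin _]/(lin (FEED k) && lin (lams k.+1 (GBODY i k))) f3 lin_lams // => j jk.
  by rewrite /linocc b1 b2 count_uniq_mem // mem jk.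
- rewrite -[qvars _]/(qvars (FEED k) ++ qvars (lams k.+1 (GBODY i k))) f4.
  suff -> : forall n, qvars (lams n (GBODY i k)) = [::] by [].
  by elim=> //= n ->.
Qed.

Lemma csubs_GBODY i rs L : 0 < size rs -> closed L ->
  csubs 0 (rcons (map QVar rs) L) (GBODY i (size rs)) =
  App (Lam (gpat (size rs)) (consb L (map Var (iota 0 (size rs))))) (App (Gate i) (qtuple rs)).
Proof.
move=> s0 cL; rewrite /GBODY !csubs_App csubs_Lam addn0 gpat_arity csubs_consb.
rewrite (@csubs_closed _ _ (Gate i)) //; congr (App _ (App _ _)).
have call : List.Forall closed (rcons (map QVar rs) L).
  by elim: rs {s0} => [|r rs IH] /=; constructor.
have var v : v < (size rs).+1 -> csubs 0 (rcons (map QVar rs) L) (Var v) = nth NILL (L :: map QVar (rev rs)) v.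
  by move=> h; rewrite csubs_Var ?size_rcons ?size_map // rev_rcons map_rev.
have varQ v : 0 < v <= size rs -> csubs 0 (rcons (map QVar rs) L) (Var v) = QVar (nth 0 rs (size rs - v)).
  case: v => // v /andP[_ h]; rewrite var //= (nth_map 0) ?size_rev // nth_rev //.
rewrite /garg; case: eqP => [s1|s1].
  by rewrite varQ ?s1 //; case: rs s1 {s0 call var varQ} => [|r []].
rewrite csubs_Tup; have -> : qtuple rs = Tup (map QVar rs) by case: rs s0 s1 {call var varQ} => [|r [|]].
congr Tup; rewrite -[in RHS](mkseq_nth 0 rs) /mkseq -!map_comp; apply/eq_in_map => j.
rewrite mem_iota => /andP[_ jk] /=; rewrite varQ; last by lia.
by congr (QVar (nth _ _ _)); lia.
Qed.

Lemma all_elt_QVars rs : all elt (map QVar rs).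
Proof. by elim: rs. Qed.

Lemma hr_consb rs Ms : all elt Ms -> consb (tlist Ms) (map QVar rs) ==>* tlist (map QVar rs ++ Ms).
Proof.
move=> eMs; elim: rs => [|r rs IH]; first exact: hr_refl.
apply: hr_trans; first by apply: hr_appr; apply: IH.
by apply: hr_CONSL => //; rewrite all_cat all_elt_QVars.
Qed.

Lemma subst_consb rs L : closed L ->
  inst (map QVar rs) (consb L (map Var (iota 0 (size rs)))) = consb L (map QVar rs).
Proof.
move=> cL; rewrite instE.
have e s : subst (inst_sub (map QVar rs)) (consb L (map Var s)) =
    consb L (map (inst_sub (map QVar rs)) s).
  elim: s => [|v s IH] /=; first by rewrite subst_closed.
  by rewrite IH.
rewrite e; congr consb; rewrite -[in RHS](mkseq_nth 0 rs) /mkseq -map_comp.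
by apply/eq_in_map => j; rewrite mem_iota => jk /=; rewrite inst_subq_lt.
Qed.

Lemma gs_GATE (R : realType) (U : nat -> qgate R) V q i rs Ms :
  0 < size rs -> size rs = arity (U i) -> all elt Ms ->
  gsteps U (ACfg V q (App (GATE i (size rs)) (tlist (map QVar rs ++ Ms))))
    (ACfg V (agate (U i) rs q) (tlist (map QVar rs ++ Ms))).
Proof.
move=> s0 sz eMs; have cL := closed_tlist eMs.
apply: gsteps_trans.
  apply: hreds_gsteps; apply: hr_FEED => //; first exact: all_elt_QVars.
    by rewrite size_map.
  have [p1 p2 _ _] := pure_GATE i s0; have [f1 f2 _ _] := pure_FEED (size rs).
  set X := lams _ _; have e1 : lfv X = [::].
    by rewrite -p1 -[RHS]/(lfv (FEED (size rs)) ++ lfv X) f1.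
  have e2 : bfv X = [::] by rewrite -p2 -[RHS]/(bfv (FEED (size rs)) ++ bfv X) f2.
  by rewrite /closed /fv e1 e2.
rewrite csubs_GBODY //; set C := Lam _ _.
(* The one step that touches the register; everything around it is silent. *)
apply: (@gs_step _ _ _ (ACfg V (agate (U i) rs q) (App C (qtuple rs)))).
  by exists (LGate i rs); [apply: ts_in_appr; apply: ts_gate|apply: act_gate].
rewrite {}/C.
apply: (hreds_gsteps); apply: hr_trans (hr_consb _ eMs).
rewrite /gpat; case: eqP => [s1|s1].
  case: rs s0 sz s1 => [|r []] // _ _ _.
  by apply: hr_trans; [apply: hr_lin|rewrite /= csub_closed; [exact: hr_refl|]].
have -> : qtuple rs = Tup (map QVar rs) by case: rs s0 s1 {sz} => [|r [|]].
by apply: hr_step (hr_refl _) => ar; rewrite -subst_consb //; apply: ts_tup.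
Qed.

(* Position arguments are programs taking the circuit index and the index of
   the gate. *)
Fixpoint code (G : term) (Ps : seq term) : term :=
  if Ps is P :: Ps' then
    LamB (LamB (Lam PVar (App (UNFRONT @! (P @! Var 2 @! Var 1))
      (App (code G Ps' @! Var 2 @! Var 1) (App (FRONT @! (P @! Var 2 @! Var 1)) (Var 0))))))
  else LamB (LamB G).

Lemma pure_code G Ps : pure G -> List.Forall pure Ps -> pure (code G Ps).
Proof.
move=> pG; elim=> [|P {}Ps pP _ IH] /=; first by pure_tac.
by pure_tac.
Qed.

Lemma set_nth_cat (A : Type) (x0 : A) s t p y : p < size t ->
  set_nth x0 (s ++ t) (size s + p) y = s ++ set_nth x0 t p y.
Proof. by move=> h; elim: s => //= x s ->. Qed.

Lemma nth_cat_size (A : Type) (x0 : A) s t p : nth x0 (s ++ t) (size s + p) = nth x0 t p.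
Proof. by rewrite nth_cat ltnNge leq_addr /= addKn. Qed.

Lemma set_nth_set_nth_id (A : Type) (x0 : A) s p y z : p < size s -> nth x0 s p = z ->
  set_nth x0 (set_nth x0 s p y) p z = s.
Proof. by elim: s p => [|a s IH] [|p] //= h; [move=> ->|move=> e; rewrite IH]. Qed.

(** Each round brings one qubit in front of those already there, which explains both the offset
    [s + size rs0] of the positions and the reversal of the wires. After the gate the same position
    programs return the qubits, the last one first. Distinctness of [ps] ensures that no round meets
    a hole left by another. *)
Lemma gs_code (R : realType) (U : nat -> qgate R) i G Ps ps th tj w V q rs0 L :
  pure G -> List.Forall pure Ps -> closed th -> closed tj ->
  (forall V q rs Ms, size rs = size rs0 + size ps -> all elt Ms ->
    gsteps U (ACfg V q (App G (tlist (map QVar rs ++ Ms))))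
      (ACfg V (agate (U i) rs q) (tlist (map QVar rs ++ Ms)))) ->
  size Ps = size ps ->
  (forall s, s < size ps -> rep (s + size rs0 + nth 0 ps s) (nth ZERO Ps s @! th @! tj)) ->
  uniq ps -> all elt L ->
  {in ps, forall p, p < size L /\ nth HOLE L p = QVar (w p)} ->
  gsteps U (ACfg V q (App (code G Ps @! th @! tj) (tlist (map QVar rs0 ++ L))))
    (ACfg V (agate (U i) (rev (map w ps) ++ rs0) q) (tlist (map QVar rs0 ++ L))).
Proof.
move=> pG pPs cth ctj HG; elim: ps Ps pPs rs0 L HG => [|p ps IH] [|P Ps] // pPs rs0 L HG sz hr u eL hL.
  apply: gsteps_trans; last by apply: HG; rewrite ?addn0.
  by apply: hreds_gsteps; rewrite /=; do 2 lstep; exact: hr_refl.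
have {pPs} [pP pPs] : pure P /\ List.Forall pure Ps by inversion pPs.
have [pL eLp] := hL p (mem_head _ _).
have eall : all elt (map QVar rs0 ++ L) by rewrite all_cat all_elt_QVars.
have pC := pure_code pG pPs.
have rp : rep (size (map QVar rs0) + p) (P @! th @! tj).
  by rewrite size_map; apply: (hr 0).
have [np up] : p \notin ps /\ uniq ps by case/andP: u.
pose L' := set_nth HOLE L p HOLE.
have eL' : all elt L' by apply: all_set_nth.
apply: gsteps_trans.
  apply: hreds_gsteps; rewrite [code _ _]/=; do 3 lstep.
  by do 2 apply: hr_appr; apply: (hr_FRONT rp) => //; rewrite size_cat ltn_add2l.
rewrite nth_cat_size set_nth_cat // eLp -/L'.
apply: gsteps_trans.
  apply: gsteps_appr; rewrite -cat_cons -[QVar (w p) :: _]/(map QVar (w p :: rs0)).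
  apply: (IH Ps pPs (w p :: rs0) L') => //.
  - by move=> V' q' rs Ms e; apply: HG; rewrite e /= addnS addSn.
  - by case: sz.
  - by move=> s h; rewrite /= addnS; exact: (hr s.+1 h).
  - move=> p' hp'; have [h1 h2] := hL p' (mem_behead (s := p :: ps) hp').
    rewrite /L' size_set_nth nth_set_nth /= (maxn_idPr pL); split=> //.
    by case: eqP => // e; rewrite -e hp' in np.
rewrite map_cons rev_cons cat_rcons; apply: hreds_gsteps.
apply: hr_trans; first apply: (hr_UNFRONT rp) => //.
- by rewrite all_cat all_elt_QVars.
- by rewrite size_cat ltn_add2l size_set_nth (maxn_idPr pL).
- by rewrite nth_cat_size /L' nth_set_nth /= eqxx.
rewrite set_nth_cat ?size_set_nth ?(maxn_idPr pL) // /L' set_nth_set_nth_id //.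
exact: hr_refl.
Qed.

Local Open Scope fset_scope.

(** * The program *)

(** The entries are literal bits, because [new] contracts only on a constant. *)
Fixpoint rep_bits (cs : seq bool) (t : term) : Prop :=
  closed t /\
  match cs with
  | [::] => forall a b, closed a -> closed b -> t @! a @! b ==>* a
  | c :: cs' => exists2 t', rep_bits cs' t' &
      forall a b, closed a -> closed b -> t @! a @! b ==>* b @! Bit c @! t'
  end.

Lemma rep_bits_closed cs t : rep_bits cs t -> closed t.
Proof. by case: cs => [|c cs] []. Qed.
#[export] Hint Extern 2 (closed _) => (eapply rep_bits_closed; eassumption) : closed.

Lemma rep_bits_nil_elim t a b : rep_bits [::] t -> closed a -> closed b -> t @! a @! b ==>* a.
Proof. by case=> _; apply. Qed.

Lemma rep_bits_cons_elim c cs t : rep_bits (c :: cs) t -> exists2 t', rep_bits cs t' &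
  forall a b, closed a -> closed b -> t @! a @! b ==>* b @! Bit c @! t'.
Proof. by case. Qed.

Lemma rep_bits_expand cs t t' : closed t -> t ==>* t' -> rep_bits cs t' -> rep_bits cs t.
Proof.
move=> ct tt'; case: cs => [|c cs] [ct' h]; split=> //.
  by move=> a b ca cb; apply: hr_trans (h a b ca cb); do 2 apply: hr_appl.
case: h => u ru h; exists u => // a b ca cb.
by apply: hr_trans (h a b ca cb); do 2 apply: hr_appl.
Qed.

Lemma rep_bits_nil : rep_bits [::] ZERO.
Proof. exact: rep_ZERO. Qed.

Lemma rep_bits_cons c cs t : rep_bits cs t -> rep_bits (c :: cs) (CONS @! Bit c @! t).
Proof.
move=> rt; split; first solve_closed.
by exists t => // a b ca cb; do 4 hstep; exact: hr_refl.
Qed.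

Definition NTH1 : term :=
  LamB (LamB (LamB (Var 0 @! New (Bit true) @!
    LamB (LamB (Var 3 @! New (Var 1) @! LamB (Var 5 @! Var 0 @! Var 1)))))).
Definition NTH : term := FIX NTH1.
Definition LOOK : term :=
  LamB (LamB (Var 1 @! New (Bit false) @! LamB (NTH @! Var 0 @! Var 1))).

Lemma pure_NTH1 : pure NTH1. Proof. by []. Qed.
Lemma pure_NTH : pure NTH. Proof. by []. Qed.
Lemma pure_LOOK : pure LOOK. Proof. by []. Qed.
#[export] Hint Resolve pure_NTH1 pure_NTH pure_LOOK : closed.

Ltac fix_step := apply: hr_trans; [head_by ltac:(apply: hr_FIX; solve_closed)|].
Ltac head_apply H := apply: hr_trans; [head_by ltac:(apply: H; solve_closed)|].

Lemma hr_NTH j u cs t : rep j u -> rep_bits cs t -> NTH @! u @! t ==>* New (Bit (nth true cs j)).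
Proof.
elim: cs j u t => [|c cs IH] j u t ru rt; fix_step; do 3 lstep.
  by rewrite nth_nil; apply: rep_bits_nil_elim rt _ _; solve_closed.
have [t' rt' h] := rep_bits_cons_elim rt; head_apply h; do 2 lstep.
case: j ru => [|j] ru; first by apply: rep_0_elim ru _ _; solve_closed.
have [u' ru' h'] := rep_S_elim ru; head_apply h'; lstep.
exact: IH.
Qed.

Lemma hr_LOOK j u cs t : rep j u -> rep_bits cs t -> LOOK @! u @! t ==>* New (Bit (ext_bit cs j)).
Proof.
move=> ru rt; do 2 lstep; case: j ru => [|j] ru.
  by apply: rep_0_elim ru _ _; solve_closed.
have [u' ru' h'] := rep_S_elim ru; head_apply h'; lstep.
exact: (hr_NTH ru' rt).
Qed.

Definition INIT1 (G : term) : term :=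
  LamB (LamB (LamB (LamB (LamB (Var 0 @! NILL @!
    LamB (App (App CONSL (LOOK @! (G @! Var 4 @! Var 2) @! Var 3))
      (Var 5 @! Var 4 @! Var 3 @! (SUCC @! Var 2) @! Var 0))))))).
Definition INIT (G : term) : term := FIX (INIT1 G).

Lemma pure_INIT1 G : pure G -> pure (INIT1 G).
Proof. by move=> h; pure_tac. Qed.

Lemma pure_INIT G : pure G -> pure (INIT G).
Proof. by move=> h; apply/pure_FIX/pure_INIT1. Qed.
#[export] Hint Resolve pure_INIT1 pure_INIT : closed.

Definition rep_fun2 (g : nat -> nat -> nat) (G : term) : Prop :=
  forall n t i u, rep n t -> rep i u -> rep (g n i) (G @! t @! u).

Definition new_regs (V : {fset nat}) (rs : seq nat) : {fset nat} :=
  foldl (fun V r => r |` V) V rs.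

Definition new_amp (R : realType) (c : nat -> bool) (q : amp R) (rs : seq nat) : amp R :=
  foldl (fun q r => atens r (c r) q) q rs.

(** The name of a new qubit can be chosen among the fresh ones, and the qubit for wire [i] is called
    [i]. Started at 1, the program thus yields literally the variables of the circuit. *)
Lemma gs_INIT (R : realType) (U : nat -> qgate R) g G n tn cs tl rem i ti tr V q :
  pure G -> rep_fun2 g G -> rep n tn -> rep_bits cs tl -> rep i ti -> rep rem tr ->
  {in iota i rem, forall r, r \notin V} ->
  gsteps U (ACfg V q (INIT G @! tn @! tl @! ti @! tr))
    (ACfg (new_regs V (iota i rem)) (new_amp (fun r => ext_bit cs (g n r)) q (iota i rem))
       (qvar_list (iota i rem))).
Proof.
move=> pG hG rn rcs; elim: rem i ti tr V q => [|rem IH] i ti tr V q ri rr hV.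
  apply: hreds_gsteps; fix_step; do 5 lstep.
  by apply: rep_0_elim rr _ _; solve_closed.
have [tr' rr' h] := rep_S_elim rr.
have rg : rep (g n i) (G @! tn @! ti) by apply: hG.
have rs : rep i.+1 (SUCC @! ti) by apply: rep_SUCC.
apply: gsteps_trans.
  apply: hreds_gsteps; fix_step; do 5 lstep; head_apply h; lstep.
  by apply: hr_appl; apply: hr_appr; apply: (hr_LOOK rg rcs).
set c := ext_bit _ _; apply: gsteps_trans.
  apply: gsteps_appl; apply: gsteps_appr.
  apply: (@gs_step _ _ _ (ACfg (i |` V) (atens i c q) (QVar i))); last exact: gs_refl.
  by exists (LNew c i); [constructor|constructor; apply: hV; rewrite inE eqxx].
apply: gsteps_trans.
  apply: gsteps_appr; apply: (IH i.+1) => // r; rewrite mem_iota => ir.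
  rewrite in_fset1U negb_or hV ?andbT ?mem_iota; last by lia.
  by apply/eqP; lia.
apply: hreds_gsteps; apply: hr_CONSL => //; exact: all_elt_QVars.
Qed.

Definition RUN1 (T : term) : term :=
  LamB (LamB (LamB (LamB (Var 0 @! Lam PVar (Var 0) @!
    LamB (Lam PVar (App (Var 5 @! Var 4 @! (SUCC @! Var 3) @! Var 1)
      (App (T @! Var 4 @! Var 3) (Var 0)))))))).
Definition RUN (T : term) : term := FIX (RUN1 T).

Lemma pure_RUN1 T : pure T -> pure (RUN1 T).
Proof. by move=> h; pure_tac. Qed.

Lemma pure_RUN T : pure T -> pure (RUN T).
Proof. by move=> h; apply/pure_FIX/pure_RUN1. Qed.
#[export] Hint Resolve pure_RUN1 pure_RUN : closed.

(** Every gate program returns the list of qubits unchanged, so the loop only has to compose the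
    actions [F k]. *)
Lemma gs_RUN (R : realType) (U : nat -> qgate R) T th (F : nat -> amp R -> amp R) L rem j tj tr V q :
  pure T -> closed th -> all elt L ->
  (forall k u q, j <= k < j + rem -> rep k u ->
     gsteps U (ACfg V q (App (T @! th @! u) (tlist L))) (ACfg V (F k q) (tlist L))) ->
  rep j tj -> rep rem tr ->
  gsteps U (ACfg V q (App (RUN T @! th @! tj @! tr) (tlist L)))
    (ACfg V (foldl (fun q k => F k q) q (iota j rem)) (tlist L)).
Proof.
move=> pT cth eL; elim: rem j tj tr q => [|rem IH] j tj tr q hT rj rr.
  apply: hreds_gsteps; fix_step; do 4 lstep.
  apply: hr_trans; [head_by ltac:(apply: (rep_0_elim rr); solve_closed)|]; lstep; exact: hr_refl.
have [tr' rr' h] := rep_S_elim rr.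
apply: gsteps_trans.
  apply: hreds_gsteps; fix_step; do 4 lstep; head_apply h; do 2 lstep; exact: hr_refl.
apply: gsteps_trans; first by apply: gsteps_appr; apply: (hT j) => //; lia.
apply: (IH j.+1) => //; last exact: rep_SUCC.
by move=> k u q' hk; apply: hT; lia.
Qed.

(** The tail of an input list arrives unboxed and is bound linearly. One traversal counts the bits
    and rebuilds them as a classical list, which can be boxed and consulted anew for every wire. *)
Definition LOOP1 (MAIN : term) : term :=
  LamB (LamB (LamB (Lam PVar (Var 0 @!
    LamB (Lam PVar (App (Var 5 @! (SUCC @! Var 4) @! LamB (Var 4 @! (CONS @! Var 2 @! Var 0))) (Var 0))) @!
    (MAIN @! Var 2 @! (Var 1 @! ZERO)))))).
Definition LOOP (MAIN : term) : term := FIX (LOOP1 MAIN).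

Lemma pure_LOOP1 M : pure M -> pure (LOOP1 M).
Proof. by move=> h; pure_tac. Qed.

Lemma pure_LOOP M : pure M -> pure (LOOP M).
Proof. by move=> h; apply/pure_FIX/pure_LOOP1. Qed.
#[export] Hint Resolve pure_LOOP1 pure_LOOP : closed.

Definition PROG (MAIN : term) : term :=
  LamB (App (LOOP MAIN @! ZERO @! LamB (Var 0)) (Var 0)).

Lemma pure_PROG M : pure M -> pure (PROG M).
Proof. by move=> /pure_LOOP; rewrite /PROG; move: (LOOP M) => T h; pure_tac. Qed.

Lemma all_elt_bits cs : all elt [seq Bang (Bit c) | c <- cs].
Proof. by elim: cs. Qed.

(* The accumulator is a difference list. *)
Lemma hr_LOOP MAIN ds cs n tn acc : pure MAIN -> rep n tn -> closed acc ->
  (forall ts t, rep_bits ts t -> rep_bits (ds ++ ts) (acc @! t)) ->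
  exists2 t', rep (n + size cs) t' & exists2 l, rep_bits (ds ++ cs) l &
    App (LOOP MAIN @! tn @! acc) (tlist [seq Bang (Bit c) | c <- cs]) ==>* MAIN @! t' @! l.
Proof.
move=> pM; elim: cs ds n tn acc => [|c cs IH] ds n tn acc rn ca hacc.
  exists tn; first by rewrite addn0.
  exists (acc @! ZERO); first by apply: hacc; apply: rep_bits_nil.
  fix_step; do 3 lstep; have e0 : tlist [::] = NILL by [].
  rewrite [map _ _]/= e0; do 3 lstep; exact: hr_refl.
have ebits := all_elt_bits cs.
have ebits' := all_elt_bits (c :: cs).
have racc ts t : rep_bits ts t -> rep_bits ((rcons ds c) ++ ts) (LamB (acc @! (CONS @! Bit c @! Var 0)) @! t).
  move=> rt; rewrite cat_rcons; have := hacc _ _ (rep_bits_cons c rt).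
  by apply: rep_bits_expand; [solve_closed|lstep; exact: hr_refl].
have rs : rep n.+1 (SUCC @! tn) by apply: rep_SUCC.
have cl : closed (LamB (acc @! (CONS @! Bit c @! Var 0))) by solve_closed.
have [t' rt' [l rl' h]] := IH (rcons ds c) n.+1 (SUCC @! tn) _ rs cl racc.
exists t'; first by rewrite /= addnS -addSn.
exists l; first by rewrite cat_rcons in rl'.
apply: hr_trans h; fix_step; do 4 lstep.
have eB : elt (Bang (Bit c)) by [].
rewrite [map _ _]/=; list_elim; do 2 lstep; exact: hr_refl.
Qed.

Lemma hr_PROG MAIN cs : pure MAIN ->
  exists2 t, rep (size cs) t & exists2 l, rep_bits cs l &
    App (PROG MAIN) (bit_list cs) ==>* MAIN @! t @! l.
Proof.
move=> pM; have cI : closed (LamB (Var 0)) by [].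
have hI ts t : rep_bits ts t -> rep_bits ([::] ++ ts) (LamB (Var 0) @! t).
  by move=> rt; apply: rep_bits_expand (rt); [solve_closed|lstep; exact: hr_refl].
have [t rt [l rl' h]] := @hr_LOOP MAIN [::] cs 0 ZERO _ pM rep_ZERO cI hI.
exists t => //; exists l => //; apply: hr_trans h.
have e := all_elt_bits cs.
rewrite /PROG /bit_list; lstep; exact: hr_refl.
Qed.

Local Close Scope fset_scope.

(** * Recognising the gates of a finite set *)

Definition rec1 (F : nat -> nat) : Prop := exists e, forall n, rec_eval e [:: n] (F n).

Lemma rec_eval_RComp e es Fs (n y : nat) : size Fs = size es ->
  (forall i, i < size es -> rec_eval (nth RZero es i) [:: n] (nth id Fs i n)) ->
  rec_eval e [seq F n | F <- Fs] y -> rec_eval (RComp e es) [:: n] y.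
Proof.
move=> sz h; apply: rev_comp; first by rewrite size_map.
by move=> i ie; rewrite (nth_map id) ?sz //; apply: h.
Qed.

(** Composition of a fixed code with unary functions; the gate test is assembled in this way from a
    few arithmetical codes. *)
Lemma rec1_app e Fs G : List.Forall rec1 Fs ->
  (forall n, rec_eval e [seq F n | F <- Fs] (G n)) -> rec1 G.
Proof.
move=> hF hG; have [es [sz h]] : exists es, size Fs = size es /\
    forall n i, i < size es -> rec_eval (nth RZero es i) [:: n] (nth id Fs i n).
  elim: hF {hG} => [|F {}Fs [e' he'] _ [es [sz h]]]; first by exists [::].
  exists (e' :: es); split; first by rewrite /= sz.
  by move=> n [|i] //= ie; apply: h.
by exists (RComp e es) => n; apply: rec_eval_RComp (hG n) => // i; apply: h.
Qed.

Lemma rec1_id : rec1 id.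
Proof. by exists (RProj 0) => n; apply: (rev_proj 0 [:: n]). Qed.

Lemma rec1_S F : rec1 F -> rec1 (fun n => (F n).+1).
Proof.
by move=> h; apply: (@rec1_app RSucc [:: F]) => [|n]; [constructor|constructor].
Qed.

Lemma rec1_const c : rec1 (fun=> c).
Proof. by elim: c => [|c /rec1_S//]; exists RZero => n; constructor. Qed.

Lemma rec1_addc c F : rec1 F -> rec1 (fun n => F n + c).
Proof.
move=> h; elim: c => [|c /rec1_S [e he]]; last by exists e => n; rewrite addnS.
by case: h => e he; exists e => n; rewrite addn0.
Qed.

Definition pred_code : rec_code := RRec RZero (RProj 0).
(** [RRec] recurs on its first argument, which is therefore the one subtracted. *)
Definition sub_code : rec_code := RRec (RProj 0) (RComp pred_code [:: RProj 1]).
Definition isz_code : rec_code := RRec (RComp RSucc [:: RZero]) RZero.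
(** The step sees the counter, the previous value, [x] and [y], so projection 3 selects [y]. *)
Definition cond_code : rec_code := RRec (RProj 0) (RProj 3).

Lemma pred_codeE n xs : rec_eval pred_code (n :: xs) n.-1.
Proof.
elim: n => [|n IH]; first by apply: rev_rec0; constructor.
by apply: (rev_recS IH); apply: (rev_proj 0 [:: n, n.-1 & xs]).
Qed.

Lemma sub_codeE m n : rec_eval sub_code [:: m; n] (n - m).
Proof.
elim: m => [|m IH]; first by rewrite subn0; apply: rev_rec0; apply: (rev_proj 0 [:: n]).
apply: (rev_recS IH); apply: (@rev_comp _ _ _ [:: n - m]) => //.
  by case=> // _; apply: (rev_proj 1 [:: m; n - m; n]).
by rewrite subnS; apply: pred_codeE.
Qed.

Lemma isz_codeE n : rec_eval isz_code [:: n] (n == 0).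
Proof.
elim: n => [|n IH]; last by apply: (rev_recS IH); constructor.
apply: rev_rec0; apply: (@rev_comp _ _ _ [:: 0]) => //; last by constructor.
by case=> // _; constructor.
Qed.

Lemma cond_codeE b x y : rec_eval cond_code [:: b; x; y] (if b == 0 then x else y).
Proof.
elim: b => [|b IH]; first by apply: rev_rec0; apply: (rev_proj 0 [:: x; y]).
by apply: (rev_recS IH); apply: (rev_proj 3 [:: b; _; x; y]).
Qed.

Lemma rec1_le F G : rec1 F -> rec1 G -> rec1 (fun n => F n <= G n).
Proof.
move=> hF hG; have h : rec1 (fun n => F n - G n).
  by apply: (@rec1_app sub_code [:: G; F]) => [|n]; [do 2 constructor=> //|exact: sub_codeE].
have [e he] : rec1 (fun n => F n - G n == 0).
  by apply: (@rec1_app isz_code [:: _] _ (List.Forall_cons _ h (List.Forall_nil _))) => n; apply: isz_codeE.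
by exists e => n; have := he n; rewrite subn_eq0.
Qed.

Lemma rec1_if (b : nat -> bool) F G : rec1 (fun n => b n) -> rec1 F -> rec1 G ->
  rec1 (fun n => if b n then F n else G n).
Proof.
move=> hb hF hG; apply: (@rec1_app cond_code [:: fun n => nat_of_bool (b n); G; F]).
  by do 3 constructor=> //.
by move=> n; have := cond_codeE (b n) (G n) (F n); rewrite /=; case: (b n).
Qed.

Lemma rec1_and (b c : nat -> bool) : rec1 (fun n => b n) -> rec1 (fun n => c n) ->
  rec1 (fun n => b n && c n).
Proof.
move=> hb hc; have [e he] := rec1_if hb hc (rec1_const 0).
by exists e => n; have := he n; case: (b n).
Qed.

Lemma rec1_all (I : Type) (s : seq I) (b : I -> nat -> bool) :
  (forall i, rec1 (fun n => b i n)) -> rec1 (fun n => all (b^~ n) s).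
Proof. by move=> h; elim: s => [|i s IH] /=; [exact: rec1_const|exact: rec1_and]. Qed.

Lemma rec1_find (I : Type) (s : seq I) (b : I -> nat -> bool) :
  (forall i, rec1 (fun n => b i n)) -> rec1 (fun n => find (b^~ n) s).
Proof.
move=> h; elim: s => [|i s IH] /=; first exact: rec1_const.
by apply: rec1_if => //; [exact: rec1_const|exact: rec1_S].
Qed.

Lemma rec1_computable4 (F : nat -> nat -> nat -> nat -> nat) a b c :
  computable (k := 4) F -> rec1 (fun n => F n a b c).
Proof.
move=> [e he]; apply: (@rec1_app e [:: id; fun=> a; fun=> b; fun=> c]).
  by constructor; [exact: rec1_id|do 3 (constructor; first exact: rec1_const)].
by move=> n; have := he n a b c.
Qed.

Lemma rec1_computable1 (F : nat -> nat) : computable (k := 1) F -> rec1 F.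
Proof. by move=> [e he]; exists e => n; have := he n. Qed.

Section Dyadic.

Local Open Scope ring_scope.

(** Two approximations of one number within [2 ^- k] differ by at most twice that, so their
    numerators differ by at most 2. Sums replace differences in order to stay within the natural
    numbers. *)
Lemma near_numerators (R : realFieldType) (x : R) (a b c d k : nat) :
  `|x - (a%:R - b%:R) / 2 ^+ k| <= 2 ^- k -> `|x - (c%:R - d%:R) / 2 ^+ k| <= 2 ^- k ->
  (a + d <= b + c + 2)%N.
Proof.
have u0 : (0 : R) < 2 ^- k by rewrite invr_gt0 exprn_gt0.
move: (2 ^- k) u0 => u u0; rewrite !ler_norml => /andP[h1 h2] /andP[h3 h4].
rewrite -(@ler_nat R) !natrD -(ler_pM2r u0); lra.
Qed.

(** The constant 4 collects two approximation errors of one unit [2 ^- k] each and a gap of two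
    units between the numerators. *)
Lemma near_entries (R : realFieldType) (x y : R) (a b c d k : nat) :
  `|x - (a%:R - b%:R) / 2 ^+ k| <= 2 ^- k -> `|y - (c%:R - d%:R) / 2 ^+ k| <= 2 ^- k ->
  (a + d <= b + c + 2)%N -> (b + c <= a + d + 2)%N -> `|x - y| <= 4 / 2 ^+ k.
Proof.
have u0 : (0 : R) < 2 ^- k by rewrite invr_gt0 exprn_gt0.
move: (2 ^- k) u0 => u u0; rewrite !ler_norml => /andP[h1 h2] /andP[h3 h4] h5 h6.
have {}h5 : (a%:R + d%:R) * u <= (b%:R + c%:R + 2) * u by rewrite ler_pM2r // -!natrD ler_nat.
have {}h6 : (b%:R + c%:R) * u <= (a%:R + d%:R + 2) * u by rewrite ler_pM2r // -!natrD ler_nat.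
by apply/andP; split; lra.
Qed.

Lemma dyadic_small (R : realType) (e : R) : 0 < e -> exists k0, forall k, (k0 <= k)%N -> 4 / 2 ^+ k < e.
Proof.
move=> e0; have b0 : 0 <= 4 / e by rewrite divr_ge0 // ltW.
have [k0 hk] : exists k0 : nat, 4 / e < k0%:R.
  by exists (Num.bound (4 / e)); have := archi_boundP b0.
exists k0 => k kk; rewrite ltr_pdivrMr ?exprn_gt0 // mulrC -ltr_pdivrMr //.
apply: lt_le_trans hk _; apply: le_trans (_ : k%:R <= _); first by rewrite ler_nat.
by rewrite -natrX ler_nat ltnW // ltn_expl.
Qed.

End Dyadic.

(* Entries as a function of natural numbers, with junk value 0. *)
Definition entry (R : realType) (u : qgate R) (r c : nat) : R[i] :=
  match insub r, insub c with
  | Some r', Some c' => gmat u r' c'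
  | _, _ => 0%R
  end.

Lemma entry_ord (R : realType) (u : qgate R) (r c : 'I_(2 ^ arity u)) : entry u r c = gmat u r c.
Proof. by rewrite /entry !valK. Qed.

Lemma qgate_eq (R : realType) (u v : qgate R) : arity u = arity v ->
  (forall r c, r < 2 ^ arity u -> c < 2 ^ arity u -> entry u r c = entry v r c) -> u = v.
Proof.
case: u v => [n A] [m B]; rewrite /arity /= => e; subst m => h.
congr existT; apply/matrixP => r c.
have := h r c (ltn_ord r) (ltn_ord c).
by rewrite (@entry_ord _ (existT _ n A) r c) (@entry_ord _ (existT _ n B) r c).
Qed.

Definition approximates (R : realType) (U : nat -> qgate R) (part : R[i] -> R)
    (p n : nat -> nat -> nat -> nat -> nat) : Prop :=
  forall i r c k, r < 2 ^ arity (U i) -> c < 2 ^ arity (U i) ->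
    (`|part (entry (U i) r c) - ((p i r c k)%:R - (n i r c k)%:R) / 2 ^+ k| <= 2 ^- k)%R.

Lemma uniformly_approximates (R : realType) (U : nat -> qgate R) (part : R[i] -> R) :
  uniformly_approximable (dim := fun i => 2 ^ arity (U i)) (fun i r c => part (gmat (U i) r c)) ->
  exists p n, [/\ computable (k := 4) p, computable (k := 4) n & approximates U part p n].
Proof.
move=> [p [n [cp cn h]]]; exists p, n; split=> // i r c k hr hc.
by have := h i (Ordinal hr) (Ordinal hc) k; rewrite -entry_ord.
Qed.

(** The tolerance 2 is the bound of [near_numerators], so that two names of one gate always pass. *)
Definition close_entry (p n : nat -> nat -> nat -> nat -> nat) (k i : nat) (rc : nat * nat) (j : nat) : bool :=
  (p j rc.1 rc.2 k + n i rc.1 rc.2 k <= n j rc.1 rc.2 k + (p i rc.1 rc.2 k + 2)) &&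
  (n j rc.1 rc.2 k + p i rc.1 rc.2 k <= p j rc.1 rc.2 k + (n i rc.1 rc.2 k + 2)).

Lemma rec1_close_entry p n k i rc : computable (k := 4) p -> computable (k := 4) n ->
  rec1 (fun j => close_entry p n k i rc j).
Proof.
move=> cp cn; have hp := rec1_computable4 rc.1 rc.2 k cp; have hn := rec1_computable4 rc.1 rc.2 k cn.
by apply: rec1_and; apply: rec1_le; apply: rec1_addc.
Qed.

Definition gate_test (a : nat -> nat) p1 n1 p2 n2 (k i j : nat) : bool :=
  [&& a j <= a i, a i <= a j &
    all (fun rc => close_entry p1 n1 k i rc j && close_entry p2 n2 k i rc j)
      (allpairs pair (iota 0 (2 ^ a i)) (iota 0 (2 ^ a i)))].

Lemma rec1_gate_test (a : nat -> nat) p1 n1 p2 n2 k i : computable (k := 1) a ->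
  computable (k := 4) p1 -> computable (k := 4) n1 ->
  computable (k := 4) p2 -> computable (k := 4) n2 ->
  rec1 (fun j => gate_test a p1 n1 p2 n2 k i j).
Proof.
move=> /rec1_computable1 ca c1 c2 c3 c4; apply: rec1_and; first exact: rec1_le (rec1_const _).
apply: rec1_and; first exact: rec1_le (rec1_const _) _.
apply: (@rec1_all _ _ (fun rc j => close_entry p1 n1 k i rc j && close_entry p2 n2 k i rc j)) => rc.
by apply: rec1_and; apply: rec1_close_entry.
Qed.

Lemma gate_test_same (R : realType) (U : nat -> qgate R) p1 n1 p2 n2 k i j :
  approximates U (@complex.Re R) p1 n1 -> approximates U (@complex.Im R) p2 n2 ->
  U j = U i -> gate_test (fun i => arity (U i)) p1 n1 p2 n2 k i j.
Proof.
move=> h1 h2 e; rewrite /gate_test e !leqnn /=; apply/allP => _ /allpairsP[[r c] /= [hr hc ->]].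
move: hr hc; rewrite !mem_iota !add0n => hr hc.
have aux part p n : approximates U part p n -> close_entry p n k i (r, c) j.
  move=> h; have hi := h i r c k hr hc.
  have := h j r c k; rewrite e => /(_ hr hc) hj; rewrite /close_entry /=.
  have := near_numerators hj hi; have := near_numerators hi hj; lia.
by rewrite (aux _ _ _ h1) (aux _ _ _ h2).
Qed.

(** The precision may depend on [i] and [j], but it has to serve all names [j'] of the gate [U j] at
    once. There can be infinitely many of them, each with approximations of its own; the distance
    between the two gates controls them all. *)
Lemma gate_test_separates (R : realType) (U : nat -> qgate R) p1 n1 p2 n2 i j :
  approximates U (@complex.Re R) p1 n1 -> approximates U (@complex.Im R) p2 n2 ->
  exists k0, forall k, k0 <= k -> forall j', U j' = U j ->
    gate_test (fun i => arity (U i)) p1 n1 p2 n2 k i j' -> U j = U i.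
Proof.
move=> h1 h2; case: (pselect (U j = U i)) => [e|ne]; first by exists 0.
case: (arity (U j) =P arity (U i)) => [ea|na]; last first.
  exists 0 => k _ j' e /and3P[l1 l2 _]; case: na; rewrite -e; apply/eqP.
  by rewrite eqn_leq l1 l2.
have [r [c [hr hc nrc]]] : exists r c, [/\ r < 2 ^ arity (U j), c < 2 ^ arity (U j) & entry (U j) r c <> entry (U i) r c].
  apply: contra_notP ne => hn; apply: qgate_eq => // r c hr hc.
  by apply: contra_notP hn => h; exists r, c.
(* Two different matrices of the same size differ in some entry by a positive amount [d] in the real
   or the imaginary part. Any precision with [4 / 2 ^+ k < d] then tells them apart by
   [near_entries]. *)
have [d [d0 hd]] : exists d : R, (0 < d)%R /\
    ((d <= `|complex.Re (entry (U j) r c) - complex.Re (entry (U i) r c)|)%R \/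
     (d <= `|complex.Im (entry (U j) r c) - complex.Im (entry (U i) r c)|)%R).
  case: (complex.Re (entry (U j) r c) =P complex.Re (entry (U i) r c)) => [e1|n1'].
    case: (complex.Im (entry (U j) r c) =P complex.Im (entry (U i) r c)) => [e2|n2'].
      by case: nrc; move: e1 e2; case: (entry (U j) r c) (entry (U i) r c) => [a b] [a' b'] /= -> ->.
    eexists; split; last by right; apply: lexx.
    by rewrite normr_gt0 subr_eq0; apply/eqP.
  eexists; split; last by left; apply: lexx.
  by rewrite normr_gt0 subr_eq0; apply/eqP.
have [k0 hk] := dyadic_small d0; exists k0 => k kk j' e /and3P[_ _ /allP/(_ (r, c)) ha].
have hr' : r < 2 ^ arity (U i) by rewrite -ea.
have hc' : c < 2 ^ arity (U i) by rewrite -ea.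
have /andP[/= t1 t2] : close_entry p1 n1 k i (r, c) j' && close_entry p2 n2 k i (r, c) j'.
  by apply: ha; apply: allpairs_f; rewrite mem_iota.
have aux part p n : approximates U part p n -> close_entry p n k i (r, c) j' ->
    (`|part (entry (U j) r c) - part (entry (U i) r c)| <= 4 / 2 ^+ k)%R.
  move=> h /andP[/= l1 l2]; have := h j' r c k; rewrite e => /(_ hr hc) hj.
  have hi := h i r c k hr' hc'.
  by apply: (near_entries hj hi); rewrite -addnA; [exact: l1|exact: l2].
case: hd => hd.
  by have := lt_le_trans (hk k kk) (le_trans hd (aux _ _ _ h1 t1)); rewrite ltxx.
by have := lt_le_trans (hk k kk) (le_trans hd (aux _ _ _ h2 t2)); rewrite ltxx.
Qed.

(** One name is chosen for each gate of [G] in the range of [U]. The choice is not effective, but it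
    concerns finitely many gates only. *)
Lemma finite_gate_indices (R : realType) (U : nat -> qgate R) (G : set (qgate R)) :
  finite_set G -> exists s : seq nat, forall j, G (U j) -> exists2 i, i \in s & U i = U j.
Proof.
move=> /finite_seqP[us ->]; elim: us => [|u us [s hs]]; first by exists [::].
case: (pselect (exists i, U i = u)) => [[i ei]|no].
  exists (i :: s) => j /=; rewrite inE => /orP[/eqP e|/hs[i' i's e']].
    by exists i; rewrite ?mem_head // ei e.
  by exists i' => //; rewrite inE i's orbT.
exists s => j /=; rewrite inE => /orP[/eqP e|]; last exact: hs.
by case: no; exists j.
Qed.

(** A precision is fixed that separates the finitely many chosen gates, and [j] is sent to the first
    entry of [s] that passes the test against it. Some entry passes, since one of them names the
    gate [U j], and a passing entry cannot name another gate. The search is computable for every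
    [j]; its answer is trusted only when [U j] lies in [G]. *)
Lemma classify_gates (R : realType) (U : nat -> qgate R) (G : set (qgate R)) :
  effective_gate_enum U -> finite_set G ->
  exists (s : seq nat) e, forall j, G (U j) ->
    exists a, [/\ a < size s, rec_eval e [:: j] a & U (nth 0 s a) = U j].
Proof.
move=> [_ _ ca /uniformly_approximates[p1 [n1 [cp1 cn1 h1]]] /uniformly_approximates[p2 [n2 [cp2 cn2 h2]]]].
move=> /(finite_gate_indices U)[s hs].
have [k hk] : exists k, forall i j j', i \in s -> j \in s -> U j' = U j ->
    gate_test (fun i => arity (U i)) p1 n1 p2 n2 k i j' -> U j = U i.
  have pairs (t : seq (nat * nat)) : exists k0, forall k, k0 <= k -> forall ij, ij \in t ->
      forall j', U j' = U ij.2 ->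
      gate_test (fun i => arity (U i)) p1 n1 p2 n2 k ij.1 j' -> U ij.2 = U ij.1.
    elim: t => [|ij t [k1 hk1]]; first by exists 0.
    have [k2 hk2] := gate_test_separates ij.1 ij.2 h1 h2.
    exists (maxn k1 k2) => k; rewrite geq_max => /andP[l1 l2] ij'; rewrite inE => /orP[/eqP ->|it].
      exact: hk2.
    exact: hk1.
  have [k0 hk0] := pairs (allpairs pair s s); exists k0 => i j j' si sj.
  by apply: (hk0 k0 (leqnn _) (i, j)); apply: allpairs_f.
have [e he] : rec1 (fun j => find (gate_test (fun i => arity (U i)) p1 n1 p2 n2 k ^~ j) s).
  by apply: rec1_find => i; apply: rec1_gate_test.
exists s, e => j /hs[i si ei].
have hf : has (gate_test (fun i => arity (U i)) p1 n1 p2 n2 k ^~ j) s.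
  by apply/hasP; exists i => //; apply: gate_test_same.
exists (find (gate_test (fun i => arity (U i)) p1 n1 p2 n2 k ^~ j) s); split=> //.
  by rewrite -has_find.
have := nth_find 0 hf; set i' := nth 0 s _ => t.
by rewrite -ei; symmetry; apply: (hk i' i j) => //; rewrite /i' mem_nth // -has_find.
Qed.

Local Open Scope fset_scope.

(** * Assembling the term *)

Definition prog1 (e : rec_code) : term := LamB (comp e @! (CONS @! Var 0 @! ZERO)).
Definition prog2 (e : rec_code) : term :=
  LamB (LamB (comp e @! (CONS @! Var 1 @! (CONS @! Var 0 @! ZERO)))).
Definition prog3 (e : rec_code) : term :=
  LamB (LamB (LamB (comp e @! (CONS @! Var 2 @! (CONS @! Var 1 @! (CONS @! Var 0 @! ZERO)))))).

Lemma pure_prog1 e : pure (prog1 e).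
Proof. by have h := pure_comp e; rewrite /prog1; move: (comp e) h => T h; pure_tac. Qed.
Lemma pure_prog2 e : pure (prog2 e).
Proof. by have h := pure_comp e; rewrite /prog2; move: (comp e) h => T h; pure_tac. Qed.
Lemma pure_prog3 e : pure (prog3 e).
Proof. by have h := pure_comp e; rewrite /prog3; move: (comp e) h => T h; pure_tac. Qed.
#[export] Hint Resolve pure_prog1 pure_prog2 pure_prog3 : closed.

Lemma rep_prog1 e x y t : rec_eval e [:: x] y -> rep x t -> rep y (prog1 e @! t).
Proof.
move=> he rt; apply: rep_expand (comp_correct he (rep_list_cons rt rep_list_nil)); first solve_closed.
lstep; exact: hr_refl.
Qed.

Lemma rep_prog2 e x1 x2 y t1 t2 : rec_eval e [:: x1; x2] y -> rep x1 t1 -> rep x2 t2 ->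
  rep y (prog2 e @! t1 @! t2).
Proof.
move=> he r1 r2; apply: rep_expand (comp_correct he (rep_list_cons r1 (rep_list_cons r2 rep_list_nil))); first solve_closed.
do 2 lstep; exact: hr_refl.
Qed.

Lemma rep_prog3 e x1 x2 x3 y t1 t2 t3 : rec_eval e [:: x1; x2; x3] y ->
  rep x1 t1 -> rep x2 t2 -> rep x3 t3 -> rep y (prog3 e @! t1 @! t2 @! t3).
Proof.
move=> he r1 r2 r3.
apply: rep_expand (comp_correct he (rep_list_cons r1 (rep_list_cons r2 (rep_list_cons r3 rep_list_nil)))); first solve_closed.
do 3 lstep; exact: hr_refl.
Qed.

Definition add_num (n : nat) (t : term) : term := iter n (fun t => SUCC @! t) t.

Lemma rep_add_num n m t : rep m t -> rep (n + m) (add_num n t).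
Proof. by move=> rt; elim: n => //= n IH; apply: rep_SUCC. Qed.

Lemma csub_add_num k N n t : csub k N (add_num n t) = add_num n (csub k N t).
Proof. by elim: n => //= n ->. Qed.

Definition PRED : term := LamB (Var 0 @! ZERO @! LamB (Var 0)).

Lemma pure_PRED : pure PRED. Proof. by []. Qed.
#[export] Hint Resolve pure_PRED : closed.

Lemma rep_PRED n t : rep n t -> rep n.-1 (PRED @! t).
Proof.
case: n => [|n] rt.
  by apply: rep_expand rep_ZERO; [solve_closed|lstep; apply: rep_0_elim rt _ _; solve_closed].
have [t' rt' h] := rep_S_elim rt; apply: rep_expand (rt'); first solve_closed.
lstep; head_apply h; lstep; exact: hr_refl.
Qed.

(* Wires are numbered from 1 but list positions from 0. *)
Definition POS (ew : rec_code) (off l : nat) : term :=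
  LamB (LamB (add_num off (PRED @! (prog3 ew @! Var 1 @! Var 0 @! add_num l ZERO)))).

Lemma pure_add_num n t : pure t -> pure (add_num n t).
Proof. by move=> h; elim: n => //= n; move: (add_num n t) => T IH; pure_tac. Qed.

Lemma pure_POS ew off l : pure (POS ew off l).
Proof.
have h1 := pure_prog3 ew; have h2 := pure_add_num l pure_ZERO.
rewrite /POS; move: (prog3 ew) (add_num l ZERO) h1 h2 => T1 T2 h1 h2.
set t := PRED @! _; have ht : [/\ lfv t = [::], {subset bfv t <= [:: 0; 1]}, lin t & qvars t = [::]].
  case: h1 h2 => [a1 a2 a3 a4] [b1 b2 b3 b4].
  by rewrite /t /= a1 a2 a3 a4 b1 b2 b3 b4; split=> // x; rewrite !inE => /orP[] /eqP ->.
have [c1 c2 c3 c4] : [/\ lfv (add_num off t) = [::], {subset bfv (add_num off t) <= [:: 0; 1]},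
    lin (add_num off t) & qvars (add_num off t) = [::]].
  by elim: off => //= n [d1 d2 d3 d4]; rewrite d1 d3 d4.
rewrite /pure /= c1 c3 c4; split=> //.
case E: (unbind _ _) => [|x s] //.
have : x \in unbind 1 (unbind 1 (bfv (add_num off t))) by rewrite E mem_head.
by rewrite !mem_unbind => /c2; rewrite !inE.
Qed.
#[export] Hint Resolve pure_POS : closed.

Lemma rep_POS ew wire off l n j tn tj : rec_eval ew [:: n; j; l] wire -> rep n tn -> rep j tj ->
  rep (off + wire.-1) (POS ew off l @! tn @! tj).
Proof.
move=> he rn rj; have rep_list : rep l (add_num l ZERO).
  by have := rep_add_num l rep_ZERO; rewrite addn0.
have h := rep_add_num off (rep_PRED (rep_prog3 he rn rj rep_list)).
apply: rep_expand h; first solve_closed.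
have cn : closed (add_num l ZERO) by exact: rep_closed rep_list.
rewrite /POS; apply: hr_trans.
  by apply: hr_appl; apply: hr_bang; solve_closed.
cbn [csub]; rewrite csub_add_num; apply: hr_trans; first by apply: hr_bang; solve_closed.
rewrite csub_add_num; cbn [csub Nat.eqb Nat.ltb Nat.leb predn].
rewrite !(csub_closed _ _ cn) !(csub_closed _ _ (pure_closed (pure_prog3 ew))).
by rewrite !(csub_closed _ _ (rep_closed rn)) !(csub_closed _ _ (pure_closed pure_PRED)); exact: hr_refl.
Qed.

(** The final [ZERO] is a dummy entry for indices beyond the table. *)
Fixpoint SWITCH (Cs : seq term) : term :=
  if Cs is C :: Cs' then LamB (Var 0 @! C @! SWITCH Cs') else LamB ZERO.

Lemma pure_SWITCH Cs : List.Forall pure Cs -> pure (SWITCH Cs).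
Proof.
elim=> [|C {}Cs pC _ IH] //=; move: (SWITCH Cs) IH => T IH.
by pure_tac.
Qed.

Lemma hr_SWITCH Cs a u : List.Forall pure Cs -> rep a u -> a < size Cs ->
  SWITCH Cs @! u ==>* nth ZERO Cs a.
Proof.
move=> pCs; elim: pCs a u => // C {}Cs pC pCs IH a u ra ha.
have pS := pure_SWITCH pCs; rewrite [SWITCH _]/=; lstep.
case: a ra ha => [|a] ra ha; first by apply: rep_0_elim ra _ _; solve_closed.
have [u' ru' h] := rep_S_elim ra; head_apply h.
exact: IH.
Qed.

(** The last wire is moved to the front first, hence the index [k.-1 - off]; at that moment [off]
    qubits already stand before the list. *)
Definition CODE (ew : rec_code) (i k : nat) : term :=
  code (GATE i k) [seq POS ew off (k.-1 - off) | off <- iota 0 k].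

(** The indices of the circuit and of the gate are passed on to the selected entry, which needs them
    to compute the wires. *)
Definition ONE (Cs : seq term) (ecls egate : rec_code) : term :=
  LamB (LamB (SWITCH Cs @! (prog1 ecls @! (prog2 egate @! Var 1 @! Var 0)) @! Var 1 @! Var 0)).

(** The qubits are numbered from 1 and the gates of the circuit from 0, hence the two different
    starting values. *)
Definition MAIN (T : term) (ef eg eh elen : rec_code) : term :=
  LamB (LamB (App
    (RUN T @! (prog1 eh @! Var 1) @! ZERO @! (prog1 elen @! (prog1 eh @! Var 1)))
    (INIT (prog2 eg) @! Var 1 @! Var 0 @! (SUCC @! ZERO) @! (prog1 ef @! Var 1)))).

Lemma pure_CODE ew i k : 0 < k -> pure (CODE ew i k).
Proof.
move=> k0; apply: pure_code; first exact: pure_GATE.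
by elim: (iota 0 k) => //= off s IH; constructor => //; apply: pure_POS.
Qed.

Lemma pure_ONE Cs e1 e2 : List.Forall pure Cs -> pure (ONE Cs e1 e2).
Proof.
move=> /pure_SWITCH; have h1 := pure_prog1 e1; have h2 := pure_prog2 e2; rewrite /ONE.
move: (prog1 e1) (prog2 e2) (SWITCH Cs) h1 h2 => T1 T2 T3 h1 h2 h3; pure_tac.
Qed.

Lemma pure_MAIN T ef eg eh elen : pure T -> pure (MAIN T ef eg eh elen).
Proof.
move=> /pure_RUN; have h1 := pure_prog1 eh; have h2 := pure_prog1 elen; have h3 := pure_prog1 ef.
have := pure_INIT (pure_prog2 eg); rewrite /MAIN.
move: (prog1 eh) (prog1 elen) (prog1 ef) (INIT _) (RUN T) h1 h2 h3 => T1 T2 T3 T4 T5 h1 h2 h3 h4 h5.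
by pure_tac.
Qed.

Lemma gs_CODE (R : realType) (U : nat -> qgate R) ew i (wires : nat -> nat) n j tn tj m V q :
  0 < arity (U i) ->
  (forall l, l < arity (U i) -> rec_eval ew [:: n; j; l] (wires l)) ->
  (forall l, l < arity (U i) -> 1 <= wires l <= m) ->
  uniq [seq wires l | l <- iota 0 (arity (U i))] ->
  rep n tn -> rep j tj ->
  gsteps U (ACfg V q (App (CODE ew i (arity (U i)) @! tn @! tj) (qvar_list (iota 1 m))))
    (ACfg V (agate (U i) [seq wires l | l <- iota 0 (arity (U i))] q) (qvar_list (iota 1 m))).
Proof.
move=> k0; set k := arity (U i) => he hw uw rn rj.
(* [ps] gives the list positions in the order in which the qubits are moved, from the last wire to
   the first. Reversing it and adding 1 recovers the wires, which is why [S] is the map from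
   positions to names below. *)
pose ps := [seq (wires (k.-1 - off)).-1 | off <- iota 0 k].
have eps : [seq wires l | l <- iota 0 k] = rev (map S ps).
  rewrite /ps -map_comp -map_rev; apply: (@eq_from_nth _ 0); rewrite ?size_map ?size_rev ?size_iota // => l lk.
  rewrite (nth_map 0) ?size_iota // nth_iota // (nth_map 0) ?size_rev ?size_iota //.
  rewrite nth_rev ?size_iota // nth_iota; last by lia.
  rewrite /= !add0n (_ : k.-1 - (k - l.+1) = l); last by lia.
  by rewrite prednK //; have /andP[] := hw l lk.
have := @gs_code R U i (GATE i k) [seq POS ew off (k.-1 - off) | off <- iota 0 k] ps tn tj S V q [::]
  (map QVar (iota 1 m)).
rewrite cats0 -eps; apply.
- exact: pure_GATE.
- by elim: (iota 0 k) => //= off s IH; constructor => //; apply: pure_POS.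
- solve_closed.
- solve_closed.
- move=> V' q' rs Ms; rewrite add0n size_map size_iota => srs eMs.
  by rewrite -srs; apply: gs_GATE => //; rewrite srs.
- by rewrite !size_map.
- move=> s; rewrite size_map size_iota => sk; rewrite addn0.
  rewrite (nth_map 0) ?size_iota // (nth_map 0) ?size_iota // !nth_iota // add0n.
  by apply: rep_POS rn rj; apply: he; lia.
- rewrite -(map_inj_uniq succn_inj) -rev_uniq -eps //.
- exact: all_elt_QVars.
- move=> p /mapP[off]; rewrite mem_iota => /andP[_ ok] ->.
  have := hw (k.-1 - off); case: (wires _) => [|x] /= h; first by (have := h _); lia.
  have xm : x < m by have := h _; lia.
  by rewrite size_map size_iota (nth_map 0) ?size_iota // nth_iota.
Qed.

(** * Circuits and basis vectors as amplitudes *)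

Lemma new_ampE (R : realType) (c : nat -> bool) rs (q : amp R) b :
  new_amp c q rs b = if all (fun r => b r == c r) rs then q b else 0%R.
Proof.
elim: rs q => //= r rs IH q; rewrite IH /atens.
by case: (all _ _); case: (b r == c r).
Qed.

Lemma mem_new_regs V rs x : (x \in new_regs V rs) = (x \in rs) || (x \in V).
Proof.
elim: rs V => //= r rs IH V; rewrite IH in_fset1U inE.
by case: (x == r); case: (x \in rs).
Qed.

Definition run_gates (R : realType) (K : circuit R) (q : amp R) : amp R :=
  foldl (fun q (a : gate_app R) => agate (tag a) (tval (tagged a)) q) q K.

Lemma abs_circuit_op (R : realType) (K : circuit R) V (Q : hilb R V) (L : pred nat) G :
  circuit_on G L K -> (forall x, L x -> x \in V) -> forall b,
  circuit_op K Q [ffun v : V => b (val v)] =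
  run_gates K (fun b => Q [ffun v : V => b (val v)]) b.
Proof.
move=> hK sub; elim: hK Q => // a {}K [_ _ /allP la] _ IH Q b; rewrite /circuit_op /= -/(circuit_op K _) IH.
congr (foldl _ _ _ _); apply: functional_extensionality => b'.
rewrite abs_gate; last by move=> x /la/sub.
by case: (tag a) (tagged a).
Qed.

(** Creating the qubits one by one multiplies indicators, and the product is the indicator of
    agreement with [c] on the whole register. *)
Lemma abs_ket (R : realType) m c b :
  ket R (qfv (qvar_list (iota 1 m))) c [ffun v : qfv (qvar_list (iota 1 m)) => b (val v)] =
  new_amp c (fun=> 1%R) (iota 1 m) b.
Proof.
rewrite /ket ffunE new_ampE; have -> : ([ffun v : qfv (qvar_list (iota 1 m)) => b (val v)] ==
    [ffun v : qfv (qvar_list (iota 1 m)) => c (val v)]) = all (fun r => b r == c r) (iota 1 m).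
  apply/eqP/allP => [/ffunP h r rm|h].
    have rV : r \in qfv (qvar_list (iota 1 m)) by rewrite qfvP qvars_list.
    by have := h [` rV]; rewrite !ffunE /= => ->.
  apply/ffunP => v; rewrite !ffunE; apply/eqP/h.
  by have := valP v; rewrite qfvP qvars_list.
by case: (all _ _).
Qed.

Theorem mainTheorem12 (R : realType) (U : nat -> qgate R)
    (HU : effective_gate_enum U) (K : nat -> circuit R)
    (HK : effective_circuit_enum U K)
    (f : nat -> nat) (g : nat -> nat -> nat) (h : nat -> nat)
    (Hfam : finitely_generated_family K f g h) :
  exists M : term,
    quantum_relevant U M /\
    forall (cs : seq bool) (m : nat) (Q : hilb R (qfv (qvar_list (iota 1 m)))),
      evaluates U (init_conf R M cs) (conf Q) <->
      m = f (size cs) /\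
      Q = circuit_op (K (h (size cs)))
            (ket R (qfv (qvar_list (iota 1 m)))
               (fun i => ext_bit cs (g (size cs) i))).
Proof.
have [G [finG qG [[ef hf] [eg hg] [eh hh] _ onG]]] := Hfam.
have [_ _ [len [gate [wire [[elen hlen] [egate hgate] [ewire hwire] HKE]]]]] := HK.
have [s [ecls hcls]] := classify_gates HU finG.
have ar0 i : 0 < arity (U i) by case: HU => /(_ i) [[]].
pose Cs := [seq CODE ewire i (arity (U i)) | i <- s].
have pCs : List.Forall pure Cs.
  by rewrite /Cs; elim: (s) => //= i t IH; constructor => //; apply: pure_CODE.
pose T := ONE Cs ecls egate.
have pT : pure T by apply: pure_ONE.
pose MN := MAIN T ef eg eh elen.
have pMN : pure MN by apply: pure_MAIN.
pose M := PROG MN; have [m1 m2 m3 m4] : pure M := pure_PROG pMN.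
have cM : fv M = [::] by rewrite /fv m1 m2.
pose app i j : gate_app R := Tagged (fun u : qgate R => (arity u).-tuple nat)
  [tuple wire i j l | l < arity (U (gate i j))].
(* The condition on the circuits of the family is restated for the data that [gate] and [wire]
   compute. *)
have facts n j : j < len (h n) -> [/\ G (U (gate (h n) j)),
    uniq [seq wire (h n) j l | l <- iota 0 (arity (U (gate (h n) j)))] &
    forall l, l < arity (U (gate (h n) j)) -> 1 <= wire (h n) j l <= f n].
  move=> jl; have := onG n; rewrite /circuit_on HKE => /List.Forall_forall ha.
  have ewl : tval [tuple wire (h n) j l | l < arity (U (gate (h n) j))] =
      [seq wire (h n) j l | l <- iota 0 (arity (U (gate (h n) j)))].
    by rewrite /= -val_enum_ord -map_comp.
  have [|h1 h2 h3] := ha (app (h n) j).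
    have aux : forall k t, k \in t -> List.In (app (h n) k) [seq app (h n) k | k <- t].
      by move=> k; elim=> //= k' t IH; rewrite inE => /orP[/eqP ->|/IH]; [left|right].
    by apply: aux; rewrite mem_iota.
  split=> //; first by rewrite -ewl.
  move=> l ll; move/allP: h3; apply; rewrite [tagged _]/= ewl; apply/mapP.
  by exists l; rewrite ?mem_iota.
(* A single restricted run for each input; through [evaluates_spec] it yields both the existence of
   a result and the equivalence. *)
have path cs : gsteps U (ACfg fset0 (fun=> 1%R) (App M (bit_list cs)))
    (ACfg (qfv (qvar_list (iota 1 (f (size cs)))))
      (run_gates (K (h (size cs)))
         (new_amp (fun r => ext_bit cs (g (size cs) r)) (fun=> 1%R) (iota 1 (f (size cs)))))
      (qvar_list (iota 1 (f (size cs))))).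
  set n := size cs; have [t rt [l rep_list hM]] := hr_PROG cs pMN.
  have rh : rep (h n) (prog1 eh @! t) by apply: rep_prog1 rt; apply: hh.
  have rlen : rep (len (h n)) (prog1 elen @! (prog1 eh @! t)) by apply: rep_prog1 rh; apply: hlen.
  have rf : rep (f n) (prog1 ef @! t) by apply: rep_prog1 rt; apply: hf.
  have rg : rep_fun2 g (prog2 eg).
    by move=> n1 t1 i1 u1 r1 r2; apply: rep_prog2 r1 r2; apply: hg.
  apply: gsteps_trans; first by apply: hreds_gsteps hM.
  apply: gsteps_trans.
    by apply: hreds_gsteps; rewrite /MN /MAIN; do 2 lstep; exact: hr_refl.
  apply: gsteps_trans.
    apply: gsteps_appr; apply: (@gs_INIT R U g _ n t cs l (f n) 1 _ _ fset0) => //.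
    - exact: pure_prog2.
    - exact: (rep_SUCC rep_ZERO).
  have -> : new_regs fset0 (iota 1 (f n)) = qfv (qvar_list (iota 1 (f n))).
    by apply/fsetP => x; rewrite mem_new_regs qfvP qvars_list inE orbF.
  set q0 := new_amp _ _ _; set V := qfv _.
  have -> : run_gates (K (h n)) q0 =
      foldl (fun q k => agate (U (gate (h n) k))
        [seq wire (h n) k l | l <- iota 0 (arity (U (gate (h n) k)))] q) q0 (iota 0 (len (h n))).
    rewrite /run_gates HKE /mkseq; elim: (iota 0 (len (h n))) q0 => //= k ks IH q0; rewrite IH; congr foldl.
    by congr agate; rewrite /= -val_enum_ord -map_comp.
  apply: (gs_RUN (th := prog1 eh @! t)) => //.
  - solve_closed.
  - exact: all_elt_QVars.
  - move=> k u q /andP[_ kl] ru; rewrite add0n in kl.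
    have [hG uw hw] := facts n k kl; have [a [sa ea eU]] := hcls _ hG.
    have rgt : rep (gate (h n) k) (prog2 egate @! (prog1 eh @! t) @! u).
      by apply: (rep_prog2 _ rh ru); apply: hgate.
    have ra : rep a (prog1 ecls @! (prog2 egate @! (prog1 eh @! t) @! u)) by apply: rep_prog1 rgt.
    have pS := pure_SWITCH pCs.
    apply: gsteps_trans.
      apply: hreds_gsteps; apply: hr_appl; rewrite /T /ONE; do 2 lstep.
      do 2 apply: hr_appl; apply: (hr_SWITCH pCs ra); by rewrite size_map.
    (* The table entry may carry another name of the same gate. Rewriting with [eU] replaces the
       gate together with its arity. *)
    rewrite /Cs (nth_map 0) // -eU; rewrite -eU in uw hw.
    by apply: (gs_CODE V q _ _ hw uw rh ru) => // l' _; apply: hwire.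
  - exact: rep_ZERO.
have spec cs := evaluates_spec m3 m4 cM (path cs) erefl.
have final cs b : run_gates (K (h (size cs)))
    (new_amp (fun r => ext_bit cs (g (size cs) r)) (fun=> 1%R) (iota 1 (f (size cs)))) b =
    circuit_op (K (h (size cs))) (ket R (qfv (qvar_list (iota 1 (f (size cs)))))
      (fun i => ext_bit cs (g (size cs) i))) [ffun v : qfv (qvar_list (iota 1 (f (size cs)))) => b (val v)].
  rewrite (abs_circuit_op _ (onG (size cs))); last first.
    by move=> x hx; rewrite qfvP qvars_list mem_iota; lia.
  congr (run_gates _ _ _); apply: functional_extensionality => b'.
  by rewrite abs_ket.
have ev cs m (Q : hilb R (qfv (qvar_list (iota 1 m)))) :
    evaluates U (init_conf R M cs) (conf Q) <-> m = f (size cs) /\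
    Q = circuit_op (K (h (size cs))) (ket R (qfv (qvar_list (iota 1 m)))
      (fun i => ext_bit cs (g (size cs) i))).
  rewrite spec; split=> -[em hQ]; subst m; split=> //.
    apply/ffunP => F; have := hQ (qget F); rewrite final.
    have -> : [ffun v : qfv (qvar_list (iota 1 (f (size cs)))) => qget F (val v)] = F.
      by apply/ffunP => v; rewrite ffunE qget_in.
    by [].
  by move=> b; rewrite final hQ.
exists M; split=> //; split; first by apply: wf_term_complete => //; rewrite m4.
(* Quantum relevance is [ev] read from right to left for the register that the circuit produces. *)
move=> cs; exists (f (size cs)), (iota_tuple (f (size cs)) 1).
exists (circuit_op (K (h (size cs))) (ket R (qfv (qvar_list (iota 1 (f (size cs)))))
      (fun i => ext_bit cs (g (size cs) i)))).
by apply/ev.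
Qed.
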